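(* For each $n\ge1$ let $\mathbf{X}_n=[X_{k,\ell}^{(n)}]_{k,\ell=1}^n$ be a symmetric matrix of order $n$ whose entries $(X_{k,\ell}^{(n)},\,1\le\ell\le k\le n)$ are real-valued random variables defined on a common probability space and satisfying the following three conditions. ($\mathbf{A_1}$) For all positive integers $n$, $\mathbb{E}(X_{k,\ell}^{(n)})=0$ for all $1\le\ell\le k\le n$, and $$\frac1{n^2}\sum_{k=1}^n\sum_{\ell=1}^k\mathbb{E}(|X_{k,\ell}^{(n)}|^2)\le C<\infty$$ with $C$ not depending on $n$. ($\mathbf{A_2}$) For any $\tau>0$, $$\frac1{n^2}\sum_{k=1}^n\sum_{\ell=1}^k\mathbb{E}\big(|X_{k,\ell}^{(n)}|^2\mathbf{1}_{|X_{k,\ell}^{(n)}|>\tau\sqrt n}\big)\to0\quad\text{as }n\to\infty.$$ ($\mathbf{A_3}$) There exists a positive integer $K$ such that for all positive integers $n$ and all nonempty subsets $A,B\subset\{(k,\ell)\in\{1,\dots,n\}^2 : 1\le\ell\le k\le n\}$ with $$\min_{(i,j)\in A}\min_{(k,\ell)\in B}\max(|i-k|,|j-\ell|)>K,$$ the $\sigma$-fields $\sigma(X_{i,j}^{(n)},(i,j)\in A)$ and $\sigma(X_{k,\ell}^{(n)},(k,\ell)\in B)$ are independent. Let $\mathbf{G}_n=[G_{i,j}^{(n)}]_{i,j=1}^n$ be a symmetric matrix of order $n$ whose entries $(G_{k,\ell}^{(n)})_{1\le\ell\le k\le n}$ are real-valued centered (jointly) Gaussian random variables with covariance function $\mathbb{E}(G_{k,\ell}^{(n)}G_{i,j}^{(n)})=\mathbb{E}(X_{k,\ell}^{(n)}X_{i,j}^{(n)})$.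 Let $\mathbb{X}_n=n^{-1/2}\mathbf{X}_n$ and $\mathbb{G}_n=n^{-1/2}\mathbf{G}_n$. Then, for any $z\in\mathbb{C}^+$, $$\lim_{n\to\infty}\big|S_{\mathbb{X}_n}(z)-\mathbb{E}\big(S_{\mathbb{G}_n}(z)\big)\big|=0\quad\text{almost surely.}$$
   Context: $\mathbb{C}^+$ is the set of complex numbers with positive imaginary part. For a real symmetric matrix $A$ of order $n$, $S_A(z)=\frac1n\mathrm{Tr}\big((A-z\mathbf{I}_n)^{-1}\big)$, where $\mathbf{I}_n$ is the identity matrix of order $n$. *)

(* Defs.v *)
From HB Require Import structures.
From mathcomp Require Import all_boot all_order all_algebra.
From mathcomp Require Import complex.
From mathcomp Require Import all_classical all_reals all_analysis.

Set Implicit Arguments.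
Unset Strict Implicit.
Unset Printing Implicit Defensive.

Import Order.TTheory GRing.Theory Num.Theory.
Import numFieldNormedType.Exports.

Local Open Scope classical_set_scope.
Local Open Scope ring_scope.

(* [invmx] is only the inverse on [unitmx]; this is the case here for
   symmetric [A] and [z] off the real line. *)
Definition stieltjes (R : realType) (n : nat) (A : 'M[R]_n) (z : R[i]) : R[i] :=
  n%:R^-1 * \tr (invmx (map_mx (real_complex R) A - z%:M)).

Definition cexpectation d (T : measurableType d) (R : realType)
    (P : probability T R) (Z : T -> R[i]) : R[i] :=
  Complex (fine 'E_P[fun w => complex.Re (Z w)])
          (fine 'E_P[fun w => complex.Im (Z w)]).

Definition scaled_mx (T : Type) (R : realType) (n : nat)
    (X : 'I_n -> 'I_n -> T -> R) (w : T) : 'M[R]_n :=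
  (Num.sqrt n%:R)^-1 *: \matrix_(k, l) X k l w.

Definition lower_triangle (n : nat) : {set 'I_n * 'I_n} :=
  [set p : 'I_n * 'I_n | (p.2 <= p.1)%N]%SET.

Definition index_dist (n : nat) (p q : 'I_n * 'I_n) : nat :=
  maxn `|(p.1 : nat)%:Z - (q.1 : nat)%:Z| `|(p.2 : nat)%:Z - (q.2 : nat)%:Z|.

Definition sigma_field (I T : Type) (R : realType) (A : set I)
    (Y : I -> T -> R) : set (set T) :=
  <<s \bigcup_(i in A) preimage_set_system setT (Y i) measurable >>.

Definition independent_sigma_fields d (T : measurableType d) (R : realType)
    (P : probability T R) (F G : set (set T)) : Prop :=
  forall E E', F E -> G E' -> P (E `&` E') = (P E * P E')%E.

(* The case [s = 0] is separate because [normal_prob m 0] is, by convention,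
   the uniform law on [0, 1] rather than the Dirac mass at [m]. *)
Definition gaussian_law (R : realType) (m s : R) (V : set R) : \bar R :=
  if s == 0 then \d_m V else normal_prob m s V.

(* Variances may vanish: the law of a linear combination may be a Dirac mass. *)
Definition jointly_gaussian d (T : measurableType d) (R : realType)
    (P : probability T R) (I : finType) (D : {set I}) (Y : I -> T -> R) : Prop :=
  forall c : I -> R, exists m s : R, forall V : set R, measurable V ->
    P ((fun w => \sum_(i in D) c i * Y i w) @^-1` V) = gaussian_law m s V.

(* Main.v *)
(* Let f be the real or the imaginary part of the Stieltjes transform, as a
   function of the lower triangle of the matrix.

   Concentration. Cut the rows into blocks of L consecutive rows separated by K
   rows. Zeroing the separating rows changes f by O(K/L), because f moves by
   O(rank/n); the remaining blocks are independent and each of them moves f by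
   O(L/n), so a bounded-difference martingale argument and Borel-Cantelli give
   f(X_n) - E f(X_n) -> 0 almost surely.

   Comparison of E f(X_n) with E f(G_n). Cut the triangle into L x L cells
   separated by strips of width K, the grid being shifted so that the strips
   carry a proportion O(K/L) of the total variance; f is Lipschitz for the
   normalised Frobenius norm, so the strips can be dropped. The X-cells are
   independent, and the G-cells as well since they are uncorrelated Gaussian
   vectors. Replace the X-cells by the G-cells one at a time (Lindeberg): in the
   second-order resolvent expansion the first two moments agree, and the third
   order remainder is controlled by the Lindeberg condition, which G inherits
   from X because the fourth moment of a Gaussian variable is a multiple of the
   square of its variance. *)
Require Import Defs.
From HB Require Import structures.
From mathcomp Require Import all_boot all_order all_algebra.
From mathcomp Require Import complex.
From mathcomp Require Import all_classical all_reals all_analysis.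
From mathcomp Require Import measurable_realfun zify ring lra.

Set Implicit Arguments.
Unset Strict Implicit.
Unset Printing Implicit Defensive.

Import Order.TTheory GRing.Theory Num.Theory.
Import numFieldNormedType.Exports.

Local Open Scope classical_set_scope.
Local Open Scope ring_scope.

(** * Frobenius norm *)

(** The two ensembles live on unrelated probability spaces and no joint space is built: independence
    enters only as a rule that replaces one sample point by two inside an integral, and a hybrid of
    X and G is an iterated integral. The hypothesis concerns two families at a time, so blocks are
    treated one by one, the next block against all the earlier ones.

    Spectral theory is replaced by an identity in Frobenius norm, [frob2_mul_shift], which gives the
    usual bounds of resolvents by 1 / Im z.

    Only second moments of X are known to be finite, so a third order remainder cannot be integrated
    directly: the Taylor remainder is bounded both quadratically and cubically, and the large
    entries use the quadratic bound.

    Independence of uncorrelated jointly Gaussian families is derived from the laws of linear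
    combinations: equality of all trigonometric integrals is turned into equality for bounded
    Lipschitz functions by Bernstein polynomials in sines. *)

Section frobenius.
Variable R : rcfType.
Implicit Types (w z : R[i]) (m n p : nat).
Local Notation normc := ComplexField.Normc.normc.

Lemma normc_sqr w : normc w ^+ 2 = complex.Re w ^+ 2 + complex.Im w ^+ 2.
Proof. by case: w => a b /=; rewrite sqr_sqrtr // addr_ge0 ?sqr_ge0. Qed.

Lemma normc_ge0 w : 0 <= normc w.
Proof. by case: w => a b; exact: sqrtr_ge0. Qed.

Lemma normr_Re_le w : `|complex.Re w| <= normc w.
Proof.
case: w => a b /=; rewrite -sqrtr_sqr ler_wsqrtr // lerDl; exact: sqr_ge0.
Qed.

Lemma normr_Im_le w : `|complex.Im w| <= normc w.
Proof.
case: w => a b /=; rewrite -sqrtr_sqr ler_wsqrtr // lerDr; exact: sqr_ge0.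
Qed.

Lemma normc_Re_Im w : normc w <= `|complex.Re w| + `|complex.Im w|.
Proof.
rewrite -(@ler_pXn2r _ 2) ?nnegrE ?addr_ge0 ?normc_ge0 //.
rewrite normc_sqr -(real_normK (num_real (complex.Re w))).
rewrite -(real_normK (num_real (complex.Im w))).
have := mulr_ge0 (normr_ge0 (complex.Re w)) (normr_ge0 (complex.Im w)).
by move=> ?; lra.
Qed.

Lemma normc_sum (I : Type) (r : seq I) (Q : pred I) (F : I -> R[i]) :
  normc (\sum_(i <- r | Q i) F i) <= \sum_(i <- r | Q i) normc (F i).
Proof.
elim/big_ind2: _ => [|x1 x2 y1 y2 h1 h2|//].
  by rewrite ComplexField.Normc.normc0.
exact: le_trans (le_normcD _ _) (lerD h1 h2).
Qed.

Lemma normc_real (a : R) : normc a%:C%C = `|a|.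
Proof. by rewrite /= expr0n addr0 sqrtr_sqr. Qed.

(** Lagrange's identity: the difference of the two sides is half the sum of the squares (a_i b_j -
    a_j b_i)^2. *)
Lemma sum_mul_sqr_le (I : finType) (a b : I -> R) :
  (\sum_i a i * b i) ^+ 2 <= (\sum_i a i ^+ 2) * (\sum_i b i ^+ 2).
Proof.
rewrite -subr_ge0.
suff -> : (\sum_i a i ^+ 2) * (\sum_i b i ^+ 2) - (\sum_i a i * b i) ^+ 2
   = 2^-1 * \sum_i \sum_j (a i * b j - a j * b i) ^+ 2.
  rewrite mulr_ge0 ?invr_ge0 // sumr_ge0 // => i _; rewrite sumr_ge0 // => j _.
  exact: sqr_ge0.
have -> : \sum_i \sum_j (a i * b j - a j * b i) ^+ 2 =
   \sum_i \sum_j (a i ^+ 2 * b j ^+ 2) + \sum_i \sum_j (b i ^+ 2 * a j ^+ 2)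
   - \sum_i \sum_j 2 * (a i * b i * (a j * b j)).
  rewrite -big_split /= -sumrB; apply: eq_bigr => i _.
  rewrite -big_split /= -sumrB; apply: eq_bigr => j _; ring.
have dist (u v : I -> R) : \sum_i \sum_j u i * v j = (\sum_i u i) * (\sum_i v i).
  by rewrite big_distrl /=; apply: eq_bigr => i _; rewrite big_distrr.
rewrite !dist.
have -> : \sum_i \sum_j 2 * (a i * b i * (a j * b j)) = 2 * (\sum_i a i * b i) ^+ 2.
  rewrite expr2 -dist big_distrr /=; apply: eq_bigr => i _.
  by rewrite big_distrr.
by field.
Qed.

Definition frob2 m n (M : 'M[R[i]]_(m, n)) : R :=
  \sum_i \sum_j normc (M i j) ^+ 2.
Definition frob m n (M : 'M[R[i]]_(m, n)) : R := Num.sqrt (frob2 M).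

Lemma frob2_ge0 m n (M : 'M[R[i]]_(m, n)) : 0 <= frob2 M.
Proof.
by rewrite sumr_ge0 // => i _; rewrite sumr_ge0 // => j _; exact: sqr_ge0.
Qed.

Lemma frob_ge0 m n (M : 'M[R[i]]_(m, n)) : 0 <= frob M.
Proof. exact: sqrtr_ge0. Qed.

Lemma frob_sqr m n (M : 'M[R[i]]_(m, n)) : frob M ^+ 2 = frob2 M.
Proof. by rewrite sqr_sqrtr // frob2_ge0. Qed.

Lemma frob2_tr m n (M : 'M[R[i]]_(m, n)) : frob2 M^T = frob2 M.
Proof.
rewrite /frob2 exchange_big; apply: eq_bigr => i _; apply: eq_bigr => j _.
by rewrite mxE.
Qed.

Lemma frob_tr m n (M : 'M[R[i]]_(m, n)) : frob M^T = frob M.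
Proof. by rewrite /frob frob2_tr. Qed.

Lemma normc_sum_mul_sqr (I : finType) (F G : I -> R[i]) :
  normc (\sum_i F i * G i) ^+ 2 <=
  (\sum_i normc (F i) ^+ 2) * (\sum_i normc (G i) ^+ 2).
Proof.
apply: le_trans (sum_mul_sqr_le _ _).
rewrite ler_pXn2r ?nnegrE ?normc_ge0 //; last first.
  by rewrite sumr_ge0 // => i _; rewrite mulr_ge0 ?normc_ge0.
apply: le_trans (normc_sum _ _ _) _.
by apply: ler_sum => i _; rewrite ComplexField.Normc.normcM.
Qed.

Lemma frob2_mul m n p (X : 'M[R[i]]_(m, n)) (Y : 'M[R[i]]_(n, p)) :
  frob2 (X *m Y) <= frob2 X * frob2 Y.
Proof.
have -> : frob2 X * frob2 Y =
  \sum_i \sum_j (\sum_k normc (X i k) ^+ 2) * (\sum_k normc (Y k j) ^+ 2).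
  rewrite -[frob2 Y]frob2_tr /frob2 big_distrl /=; apply: eq_bigr => i _.
  rewrite big_distrr /=; apply: eq_bigr => j _; congr (_ * _).
  by apply: eq_bigr => k _; rewrite mxE.
apply: ler_sum => i _; apply: ler_sum => j _.
by rewrite mxE; exact: normc_sum_mul_sqr.
Qed.

Lemma frob_mul m n p (X : 'M[R[i]]_(m, n)) (Y : 'M[R[i]]_(n, p)) :
  frob (X *m Y) <= frob X * frob Y.
Proof.
by rewrite /frob -sqrtrM ?frob2_ge0 // ler_wsqrtr // frob2_mul.
Qed.

(** The trace is the bilinear pairing of X with the transpose of Y, so this is Cauchy-Schwarz over
    all index pairs. *)
Lemma normc_trace_mul m n (X : 'M[R[i]]_(m, n)) (Y : 'M[R[i]]_(n, m)) :
  normc (\tr (X *m Y)) <= frob X * frob Y.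
Proof.
rewrite -(@ler_pXn2r _ 2) ?nnegrE ?mulr_ge0 ?frob_ge0 ?normc_ge0 //.
rewrite exprMn !frob_sqr -[frob2 Y]frob2_tr /frob2.
rewrite !(pair_big xpredT xpredT) /=.
have -> : \tr (X *m Y) = \sum_(q : 'I_m * 'I_n) X q.1 q.2 * Y^T q.1 q.2.
  rewrite -(pair_big xpredT xpredT (fun i j => X i j * Y^T i j)) /=.
  by apply: eq_bigr => i _; rewrite mxE; apply: eq_bigr => j _; rewrite mxE.
exact: normc_sum_mul_sqr.
Qed.

Lemma frob2_1 n : frob2 (1%:M : 'M[R[i]]_n) = n%:R.
Proof.
rewrite /frob2 -[RHS]mulr1n -[in RHS](card_ord n) -sum1_card natr_sum.
apply: eq_bigr => i _; rewrite (bigD1 i) //= mxE eqxx big1 ?addr0.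
  by rewrite ComplexField.Normc.normc1 expr1n.
move=> j /negbTE ji; rewrite mxE eq_sym ji.
by rewrite ComplexField.Normc.normc0 expr0n.
Qed.

End frobenius.

(** * Resolvents of real symmetric matrices *)

(** The resolvent identity is substituted into itself, and only the last term keeps the unknown S'.
    A ring in which 1 = 0 is allowed, so that matrices of order 0 are covered. *)
Lemma neumann_expand (L : pzRingType) (S S' K : L) : S' = S - S' * K * S ->
  S' = S - S * K * S + S' * K * S * K * S /\
  S' = S - S * K * S + S * K * S * K * S - S' * K * S * K * S * K * S.
Proof.
move=> e1; set U := S' * K * S in e1 *.
have e2 : S' = S - S * K * S + U * K * S.
  by rewrite [LHS]e1 {1}/U e1 !mulrBl opprB addrA addrAC.
split=> //; rewrite [LHS]e2 -[RHS]addrA; congr (_ + _).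
by rewrite {1}/U e1 !mulrBl.
Qed.

Lemma mxtraceB (L : pzRingType) n (A B : 'M[L]_n) : \tr (A - B) = \tr A - \tr B.
Proof. by rewrite mxtraceD raddfN. Qed.

Section resolvent.
Variables (R : rcfType) (n : nat).
Implicit Types (A B : 'M[R]_n) (z : R[i]).
Local Notation normc := ComplexField.Normc.normc.
Local Notation "A %:CM" := (map_mx (real_complex R) A) (at level 2, format "A %:CM").

Definition resolvent A z : 'M[R[i]]_n := invmx (A%:CM - z%:M).

(* For a real symmetric matrix the cross terms between [A - Re z] and [Im z]
   cancel in the Frobenius norm. *)
Lemma frob2_mul_shift m (M : 'M[R[i]]_(m, n)) A z : A^T = A ->
  frob2 (M *m (A%:CM - z%:M)) =
  frob2 (M *m (A - (complex.Re z)%:M)%:CM) + complex.Im z ^+ 2 * frob2 M.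
Proof.
case: z => x y /= symA; set B := A - x%:M.
have symB k l : B k l = B l k.
  by rewrite !mxE eq_sym; congr (_ - _); rewrite -{1}symA mxE.
(* The real part of z is absorbed into the symmetric matrix B, so that the remaining shift is purely
   imaginary. *)
have -> : A%:CM - (x +i* y)%C%:M = B%:CM - (0 +i* y)%C%:M.
  apply/matrixP => k l; rewrite !mxE.
  by apply/eqP; rewrite eq_complex; apply/andP; split; apply/eqP;
     case: (k == l) => /=; rewrite ?mulr1n ?mulr0n /=; ring.
rewrite mulmxBr mul_mx_scalar; set MB := M *m B%:CM.
have entry k l : normc ((MB - (0 +i* y)%C *: M) k l) ^+ 2 =
   normc (MB k l) ^+ 2 + y ^+ 2 * normc (M k l) ^+ 2 +
   2 * y * (complex.Re (MB k l) * complex.Im (M k l)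
            - complex.Im (MB k l) * complex.Re (M k l)).
  rewrite [in LHS]mxE [(- _ : matrix _ _ _) k l]mxE [(_ *: _ : matrix _ _ _) k l]mxE.
  rewrite !normc_sqr.
  by case: (MB k l) => a1 a2; case: (M k l) => b1 b2 /=; ring.
rewrite /frob2.
under eq_bigr do under eq_bigr do rewrite entry.
under eq_bigr do rewrite big_split big_split /= -mulr_sumr -mulr_sumr.
rewrite big_split big_split /= -mulr_sumr -mulr_sumr.
(* In each row this is a difference of two values of the real bilinear form of B, with the real and
   imaginary parts of the row exchanged; it vanishes because B is symmetric. *)
suff -> : \sum_i \sum_j (complex.Re (MB i j) * complex.Im (M i j)
            - complex.Im (MB i j) * complex.Re (M i j)) = 0.
  by rewrite mulr0 addr0.
apply: big1 => i _; rewrite sumrB.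
have reMB j : complex.Re (MB i j) = \sum_k complex.Re (M i k) * B k j.
  rewrite mxE (raddf_sum (@complex.Re R : Rcomplex R -> R)); apply: eq_bigr => k _.
  by rewrite [_%:CM k j]mxE; case: (M i k) => a1 a2 /=; ring.
have imMB j : complex.Im (MB i j) = \sum_k complex.Im (M i k) * B k j.
  rewrite mxE (raddf_sum (@complex.Im R : Rcomplex R -> R)); apply: eq_bigr => k _.
  by rewrite [_%:CM k j]mxE; case: (M i k) => a1 a2 /=; ring.
under eq_bigr do rewrite reMB mulr_suml.
under [X in _ - X]eq_bigr do rewrite imMB mulr_suml.
rewrite [X in _ - X]exchange_big /=; apply/eqP; rewrite subr_eq0; apply/eqP.
apply: eq_bigr => j _; apply: eq_bigr => k _.
by rewrite (symB j k); ring.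
Qed.

Lemma frob2_mul_shift_ge m (M : 'M[R[i]]_(m, n)) A z : A^T = A ->
  complex.Im z ^+ 2 * frob2 M <= frob2 (M *m (A%:CM - z%:M)).
Proof. by move=> /frob2_mul_shift ->; rewrite lerDr frob2_ge0. Qed.

Lemma frob2_eq0 m p (M : 'M[R[i]]_(m, p)) : frob2 M = 0 -> M = 0.
Proof.
move=> /eqP; rewrite psumr_eq0 => [/allP h|i _]; last first.
  by rewrite sumr_ge0 // => j _; exact: sqr_ge0.
apply/matrixP => i j; have := h i (mem_index_enum _).
rewrite psumr_eq0 => [/allP/(_ j (mem_index_enum _))|k _]; last exact: sqr_ge0.
rewrite sqrf_eq0 => /eqP h0; rewrite mxE.
exact: ComplexField.Normc.eq0_normc h0.
Qed.

Lemma frob2_0 m p : frob2 (0 : 'M[R[i]]_(m, p)) = 0.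
Proof.
by apply: big1 => i _; apply: big1 => j _; rewrite mxE ComplexField.Normc.normc0 expr0n.
Qed.

Variable z : R[i].
Hypothesis hz : 0 < complex.Im z.
Local Notation y := (complex.Im z).

(** A row vector v in the kernel satisfies (Im z)^2 |v|^2 <= 0. *)
Lemma shift_unit A : A^T = A -> A%:CM - z%:M \in unitmx.
Proof.
move=> symA; rewrite -row_free_unit -kermx_eq0; apply/rowV0P => v.
move/sub_kermxP => v0; apply: frob2_eq0; apply/eqP; rewrite eq_le frob2_ge0 andbT.
have := @frob2_mul_shift_ge _ v A z symA.
by rewrite v0 frob2_0 pmulr_rle0 // exprn_gt0.
Qed.

Lemma resolvent_tr A : A^T = A -> (resolvent A z)^T = resolvent A z.
Proof.
move=> symA; rewrite /resolvent trmx_inv; congr invmx.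
by rewrite linearB /= tr_scalar_mx map_trmx symA.
Qed.

(** This takes the place of the operator norm bound by 1 / Im z: the lower bound
    [frob2_mul_shift_ge] is applied to M times the resolvent. *)
Lemma frob_mul_resolvent m (M : 'M[R[i]]_(m, n)) A : A^T = A ->
  frob (M *m resolvent A z) <= frob M / y.
Proof.
move=> symA; rewrite ler_pdivlMr // -(@ler_pXn2r _ 2) ?nnegrE ?frob_ge0 ?mulr_ge0 ?frob_ge0 ?(ltW hz) //.
rewrite exprMn !frob_sqr mulrC.
have := @frob2_mul_shift_ge _ (M *m resolvent A z) A z symA.
by rewrite mulmxKV ?shift_unit.
Qed.

Lemma frob_resolvent_mul m (M : 'M[R[i]]_(n, m)) A : A^T = A ->
  frob (resolvent A z *m M) <= frob M / y.
Proof.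
move=> symA; rewrite -frob_tr trmx_mul resolvent_tr // -(frob_tr M).
exact: frob_mul_resolvent.
Qed.

Lemma resolvent_sub A B : A^T = A -> B^T = B ->
  resolvent A z - resolvent B z = resolvent A z *m (B - A)%:CM *m resolvent B z.
Proof.
move=> symA symB.
have -> : (B - A)%:CM = (B%:CM - z%:M) - (A%:CM - z%:M).
  by rewrite map_mxB opprB addrA subrK.
rewrite mulmxBr mulmxBl mulmxK ?shift_unit // mulVmx ?shift_unit // mul1mx //.
Qed.

(** By the resolvent identity and a cyclic shift, B - A is paired with a product of two resolvents,
    whose Frobenius norm is at most sqrt n / y^2. *)
Lemma trace_resolvent_lipschitz A B : A^T = A -> B^T = B ->
  normc (\tr (resolvent A z) - \tr (resolvent B z)) <=
  frob (B - A)%:CM * Num.sqrt n%:R / y ^+ 2.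
Proof.
move=> symA symB; rewrite -raddfB /= resolvent_sub // -mulmxA mxtrace_mulC -mulmxA.
apply: le_trans (normc_trace_mul _ _) _; rewrite -mulrA ler_wpM2l ?frob_ge0 //.
apply: le_trans (frob_mul_resolvent _ symA) _.
rewrite -[X in frob X](mul1mx (resolvent B z)) expr2 invfM mulrA ler_pM2r ?invr_gt0 //.
by apply: le_trans (frob_mul_resolvent _ symB) _; rewrite /frob frob2_1.
Qed.

Lemma resolvent_expand A H : A^T = A -> H^T = H ->
  let S := resolvent A z in let S' := resolvent (A + H) z in
  let K := H%:CM in
  S' = S - S *m K *m S + S' *m K *m S *m K *m S /\
  S' = S - S *m K *m S + S *m K *m S *m K *m S
       - S' *m K *m S *m K *m S *m K *m S.
Proof.
move=> symA symH S S' K.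
have symAH : (A + H)^T = A + H by rewrite linearD /= symA symH.
have e1 : S' = S - S' *m K *m S.
  have := resolvent_sub symAH symA.
  rewrite opprD addrA subrr sub0r -/S -/S' map_mxN -/K mulmxN mulNmx => <-.
  by rewrite [RHS]addrC subrK.
by move: (S) (S') (K) e1 => {}S {}S' {}K; exact: (@neumann_expand 'M[R[i]]_n).
Qed.

(** The same remainder is bounded twice. The cubic bound is efficient for small H; the quadratic one
    stays integrable when H has only two moments. Its factor 2 counts the exact second order
    remainder and the second order term that is subtracted from it. *)
Lemma trace_resolvent_taylor A H : A^T = A -> H^T = H ->
  let S := resolvent A z in let K := H%:CM in
  let r := normc (\tr (resolvent (A + H) z) -
     (\tr S - \tr (S *m K *m S) + \tr (S *m K *m S *m K *m S))) in
  r <= 2 * frob K ^+ 2 / y ^+ 3 /\ r <= frob K ^+ 3 / y ^+ 4.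
Proof.
move=> symA symH S K r.
have symAH : (A + H)^T = A + H by rewrite linearD /= symA symH.
have y0 := ltW hz.
have [e1 e2] := resolvent_expand symA symH.
rewrite -/S -/K in e1 e2; set S' := resolvent (A + H) z in e1 e2 r *.
have K0 := frob_ge0 K.
have bKS' : frob (S' *m K) <= frob K / y by exact: frob_resolvent_mul.
have bKS : frob (S *m K) <= frob K / y by exact: frob_resolvent_mul.
have bSKS : frob (S *m K *m S) <= frob K / y / y.
  apply: le_trans (frob_mul_resolvent _ symA) _.
  by rewrite ler_pM2r ?invr_gt0.
split.
  have -> : r = normc (\tr (S' *m K *m (S *m K *m S)) - \tr (S *m K *m (S *m K *m S))).
    rewrite /r [X in \tr X - _]e1 mxtraceD mxtraceB !mulmxA; congr normc.
    by rewrite opprD addrACA subrr add0r.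
  apply: le_trans (le_normcD _ _) _; rewrite normcN.
  have -> : 2 * frob K ^+ 2 / y ^+ 3 =
     frob K / y * (frob K / y / y) + frob K / y * (frob K / y / y).
    by field; rewrite gt_eqF.
  apply: lerD; apply: le_trans (normc_trace_mul _ _) _.
    by apply: ler_pM bKS' bSKS; exact: frob_ge0.
  by apply: ler_pM bKS bSKS; exact: frob_ge0.
have -> : r = normc (\tr (S' *m K *m ((S *m K) *m (S *m K *m S)))).
  rewrite /r [X in \tr X - _]e2 -normcN mxtraceB mxtraceD mxtraceB !mulmxA; congr normc.
  by rewrite opprB subKr.
apply: le_trans (normc_trace_mul _ _) _.
have -> : frob K ^+ 3 / y ^+ 4 = frob K / y * (frob K / y * (frob K / y / y)).
  by field; rewrite gt_eqF.
apply: (ler_pM (frob_ge0 _) (frob_ge0 _) bKS').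
apply: le_trans (frob_mul _ _) _.
by apply: ler_pM bKS bSKS; exact: frob_ge0.
Qed.

(** Let the rows of W be an orthonormal basis of the row space of M. Then M = M W^H W, so the trace
    of M is that of W M W^H, a sum of rank-many diagonal entries, each at most c because the rows of
    W have norm 1. *)
Lemma normc_trace_rank (M : 'M[R[i]]_n) (c : R) :
  (forall v : 'rV[R[i]]_n, frob (v *m M) <= c * frob v) ->
  normc (\tr M) <= c * (\rank M)%:R.
Proof.
move=> hM; set r := \rank M; pose W : 'M[R[i]]_(r, n) := schmidt (row_base M).
have Wu : W \is unitarymx by rewrite schmidt_unitarymx // rank_leq_col.
have /submxP[C hC] : (M <= W)%MS.
  by apply: submx_trans (schmidt_sub _); rewrite eq_row_base.
have CE : C = M *m map_mx Num.conj W^T.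
  by rewrite {1}hC -mulmxA (unitarymxP Wu) mulmx1.
rewrite {1}hC mxtrace_mulC CE mulmxA.
apply: le_trans (normc_sum _ _ _) _.
have -> : c * r%:R = \sum_(i < r) c.
  by rewrite sumr_const card_ord mulr_natr.
apply: ler_sum => i _.
have norm1 : frob (row i W) = 1.
  have : normc (\sum_k W i k * Num.conj (W i k)) = 1.
    have := unitarymxP Wu => /matrixP/(_ i i); rewrite !mxE eqxx /= => e.
    rewrite -[RHS](ComplexField.Normc.normc1 R) -[X in _ = normc X]e.
    by congr normc; apply: eq_bigr => k _; rewrite !mxE.
  rewrite /frob /frob2 big_ord1 => h.
  suff -> : \sum_j normc (row i W 0 j) ^+ 2 = 1 by rewrite sqrtr1.
  rewrite -[RHS]h.
  have -> : \sum_k W i k * Num.conj (W i k) = (\sum_j normc (row i W 0 j) ^+ 2)%:C%C.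
    rewrite rmorph_sum; apply: eq_bigr => k _; rewrite mxE -normCK.
    by rewrite normc_def rmorphXn /=; case: (W i k).
  by rewrite normc_real ger0_norm // sumr_ge0 // => j _; exact: sqr_ge0.
have -> : (W *m M *m map_mx Num.conj W^T) i i =
   \tr (row i W *m M *m map_mx Num.conj (row i W)^T).
  by rewrite trace_mx11 -row_mul !mxE; apply: eq_bigr => k _; rewrite !mxE.
apply: le_trans (normc_trace_mul _ _) _.
apply: (le_trans (y := c * frob (row i W) * frob (row i W))); last by rewrite norm1 !mulr1.
have -> : frob (map_mx Num.conj (row i W)^T) = frob (row i W).
  rewrite -[RHS]frob_tr; congr Num.sqrt; apply: eq_bigr => k _; apply: eq_bigr => j _.
  by rewrite !mxE; case: (W i k) => a b /=; rewrite sqrrN.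
by rewrite ler_wpM2r ?frob_ge0.
Qed.

(** D is supported on the rows and columns indexed by J, hence is a sum of |J| one-row matrices and
    |J| one-column matrices. *)
Lemma rank_cross (J : {set 'I_n}) (D : 'M[R[i]]_n) :
  (forall k l, k \notin J -> l \notin J -> D k l = 0) -> (\rank D <= 2 * #|J|)%N.
Proof.
move=> hD.
have rsum (F : 'I_n -> 'M[R[i]]_n) : (forall j, (\rank (F j) <= 1)%N) ->
    (\rank (\sum_(j in J) F j)%R <= #|J|)%N.
  move=> hF; rewrite -sum1_card.
  apply: (big_ind2 (fun (M : 'M[R[i]]_n) k => (\rank M <= k)%N)) => //.
    by rewrite mxrank0.
  move=> M1 k1 M2 k2 h1 h2. exact: leq_trans (mxrank_add _ _) (leq_add h1 h2).
(* [E1] collects the rows in J; [E2] collects the columns in J after deletion of these rows, so that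
   no entry is counted twice. *)
pose E1 := \sum_(j in J) (delta_mx j j *m D).
pose E2 := \sum_(j in J) ((\matrix_(k, l) (if k \in J then 0 else D k l)) *m delta_mx j j).
have -> : D = E1 + E2.
  apply/matrixP => k l; rewrite mxE /E1 /E2 !summxE.
  have s1 : \sum_(j in J) (delta_mx j j *m D) k l = if k \in J then D k l else 0.
    case: ifPn => kJ; last first.
      apply: big1 => j jJ; rewrite mxE big1 // => i _; rewrite mxE.
      case: eqP => [kj|]; last by rewrite mul0r.
      by move: kJ; rewrite kj jJ.
    rewrite (bigD1 k) //= [X in _ + X]big1 ?addr0 => [|j /andP[_ jk]].
      rewrite mxE (bigD1 k) //= mxE !eqxx mul1r big1 ?addr0 // => i ik.
      by rewrite mxE (negbTE ik) andbF mul0r.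
    by rewrite mxE big1 // => i _; rewrite mxE eq_sym (negbTE jk) mul0r.
  have s2 : \sum_(j in J) ((\matrix_(k, l) (if k \in J then 0 else D k l)) *m delta_mx j j) k l
      = if l \in J then (if k \in J then 0 else D k l) else 0.
    case: ifPn => lJ; last first.
      apply: big1 => j jJ; rewrite mxE big1 // => i _; rewrite [delta_mx _ _ _ _]mxE.
      case: (l =P j) => [lj|]; last by rewrite andbF mulr0.
      by move: lJ; rewrite lj jJ.
    rewrite (bigD1 l) //= [X in _ + X]big1 ?addr0 => [|j /andP[_ jl]].
      rewrite mxE (bigD1 l) //= [delta_mx _ _ _ _]mxE !eqxx mulr1 mxE big1 ?addr0 // => i il.
      by rewrite [delta_mx _ _ _ _]mxE (negbTE il) mulr0.
    by rewrite mxE big1 // => i _; rewrite [delta_mx _ _ _ _]mxE [l == j]eq_sym (negbTE jl) andbF mulr0.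
  rewrite s1 s2; case: ifPn => kJ; first by case: ifP; rewrite addr0.
  by case: ifPn => lJ; rewrite add0r // hD.
rewrite mul2n -addnn; apply: leq_trans (mxrank_add _ _) (leq_add _ _); apply: rsum => j.
  by rewrite (leq_trans (mxrankM_maxl _ _)) // mxrank_delta.
by rewrite (leq_trans (mxrankM_maxr _ _)) // mxrank_delta.
Qed.

(** The constant 4 is the product of two factors 2: the difference of the resolvents has rank at
    most 2 |J| and multiplies norms by at most 2 / y. *)
Lemma trace_resolvent_rank (J : {set 'I_n}) A B : A^T = A -> B^T = B ->
  (forall k l, k \notin J -> l \notin J -> A k l = B k l) ->
  normc (\tr (resolvent A z) - \tr (resolvent B z)) <= 4 * #|J|%:R / y.
Proof.
move=> symA symB hJ; rewrite -raddfB /=; set M := _ - _.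
have rM : (\rank M <= 2 * #|J|)%N.
  rewrite /M resolvent_sub //.
  apply: leq_trans (mxrankM_maxl _ _) _; apply: leq_trans (mxrankM_maxr _ _) _.
  by apply: rank_cross => k l kJ lJ; rewrite !mxE hJ // subrr.
have : normc (\tr M) <= (2 / y) * (\rank M)%:R.
  apply: normc_trace_rank => v; rewrite mulmxBr.
  have frobD (m : nat) (X Y : 'M[R[i]]_(1, m)) : frob (X - Y) <= frob X + frob Y.
    rewrite -(@ler_pXn2r _ 2) ?nnegrE ?addr_ge0 ?frob_ge0 //.
    rewrite sqrrD !frob_sqr /frob2 !big_ord1.
    have e j : normc ((X - Y) 0 j) ^+ 2 <=
       normc (X 0 j) ^+ 2 + normc (Y 0 j) ^+ 2 + normc (X 0 j) * normc (Y 0 j) *+ 2.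
      rewrite [in leLHS]mxE [(- _ : matrix _ _ _) _ _]mxE addrAC -sqrrD.
      rewrite ler_pXn2r ?nnegrE ?addr_ge0 ?normc_ge0 //.
      by rewrite -(normcN (Y 0 j)) le_normcD.
    apply: le_trans (ler_sum _ (fun j _ => e j)) _.
    rewrite big_split /= sumrMnl big_split /= [leRHS]addrAC lerD2l lerMn2r /=.
    rewrite -(@ler_pXn2r _ 2) ?nnegrE ?mulr_ge0 ?frob_ge0 //.
      by apply: le_trans (sum_mul_sqr_le _ _) _; rewrite exprMn !frob_sqr /frob2 !big_ord1.
    by rewrite sumr_ge0 // => j _; rewrite mulr_ge0 ?normc_ge0.
  apply: le_trans (frobD _ _ _) _.
  have -> : 2 / y * frob v = frob v / y + frob v / y by rewrite mulrAC mulrC -mulrDr mulr2n; ring.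
  by rewrite lerD ?frob_mul_resolvent.
move=> h; apply: le_trans h _.
have -> : 4 * #|J|%:R / y = 2 / y * (2 * #|J|)%:R by rewrite natrM; ring.
by rewrite ler_wpM2l ?ler_nat ?divr_ge0 // ltW.
Qed.

End resolvent.

(** * The Stieltjes transform as a function of the lower triangle *)

Section complex_measurability.
Context d (T : measurableType d) (R : realType).
Implicit Types F G : T -> R[i].

Definition cmeasurable F :=
  measurable_fun setT (fun w => complex.Re (F w)) /\
  measurable_fun setT (fun w => complex.Im (F w)).

Lemma cmeasurable_cst (c : R[i]) : cmeasurable (fun=> c).
Proof. by split; exact: measurable_cst. Qed.

Lemma cmeasurable_real (f : T -> R) :
  measurable_fun setT f -> cmeasurable (fun w => (f w)%:C%C).
Proof. by move=> mf; split => //=; exact: measurable_cst. Qed.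

Lemma cmeasurableD F G : cmeasurable F -> cmeasurable G ->
  cmeasurable (fun w => F w + G w).
Proof.
move=> [rF iF] [rG iG]; split.
  rewrite (_ : (fun w => _) = (fun w => complex.Re (F w) + complex.Re (G w))).
    exact: measurable_funD.
  by apply/funext => w; case: (F w) => ? ?; case: (G w).
rewrite (_ : (fun w => _) = (fun w => complex.Im (F w) + complex.Im (G w))).
  exact: measurable_funD.
by apply/funext => w; case: (F w) => ? ?; case: (G w).
Qed.

Lemma cmeasurableM F G : cmeasurable F -> cmeasurable G ->
  cmeasurable (fun w => F w * G w).
Proof.
move=> [rF iF] [rG iG]; split.
  rewrite (_ : (fun w => _) = (fun w => complex.Re (F w) * complex.Re (G w) -
      complex.Im (F w) * complex.Im (G w))).
    by apply: measurable_funB; exact: measurable_funM.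
  by apply/funext => w; case: (F w) => ? ?; case: (G w).
rewrite (_ : (fun w => _) = (fun w => complex.Re (F w) * complex.Im (G w) +
      complex.Im (F w) * complex.Re (G w))).
  by apply: measurable_funD; exact: measurable_funM.
by apply/funext => w; case: (F w) => ? ?; case: (G w).
Qed.

Lemma cmeasurable_sum (I : Type) (r : seq I) (Q : pred I) (F : I -> T -> R[i]) :
  (forall i, Q i -> cmeasurable (F i)) ->
  cmeasurable (fun w => \sum_(i <- r | Q i) F i w).
Proof.
move=> mF; elim: r => [|i r ih].
  by under eq_fun do rewrite big_nil; exact: cmeasurable_cst.
under eq_fun do rewrite big_cons; case: (boolP (Q i)) => // Qi.
by apply: cmeasurableD => //; exact: mF.
Qed.

Lemma cmeasurable_prod (I : Type) (r : seq I) (Q : pred I) (F : I -> T -> R[i]) :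
  (forall i, Q i -> cmeasurable (F i)) ->
  cmeasurable (fun w => \prod_(i <- r | Q i) F i w).
Proof.
move=> mF; elim: r => [|i r ih].
  by under eq_fun do rewrite big_nil; exact: cmeasurable_cst.
under eq_fun do rewrite big_cons; case: (boolP (Q i)) => // Qi.
by apply: cmeasurableM => //; exact: mF.
Qed.

(** 1 / f is written as f exp(- ln (f^2)); at a zero of f both expressions are 0, whatever value
    [ln] takes there. *)
Lemma measurable_funV (f : T -> R) : measurable_fun setT f ->
  measurable_fun setT (fun w => (f w)^-1).
Proof.
move=> mf; rewrite (_ : (fun w => _) = (fun w => f w * expR (- ln (f w ^+ 2)))).
  apply: measurable_funM => //; apply: measurableT_comp => //.
  apply: measurableT_comp => //; apply: measurableT_comp; first exact: measurable_ln.
  exact: measurable_funX.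
apply/funext => w; have [->|f0] := eqVneq (f w) 0; first by rewrite invr0 mul0r.
rewrite expRN lnK; last by rewrite posrE exprn_even_gt0.
by rewrite expr2 invfM mulrA divff // mul1r.
Qed.

Lemma cmeasurableV F : cmeasurable F -> cmeasurable (fun w => (F w)^-1).
Proof.
move=> [rF iF].
have m2 : measurable_fun setT
    (fun w => (complex.Re (F w) ^+ 2 + complex.Im (F w) ^+ 2)^-1).
  apply: measurable_funV; apply: measurable_funD; exact: measurable_funX.
split.
  rewrite (_ : (fun w => _) = (fun w => complex.Re (F w) *
      (complex.Re (F w) ^+ 2 + complex.Im (F w) ^+ 2)^-1)).
    exact: measurable_funM.
  by apply/funext => w; case: (F w).
rewrite (_ : (fun w => _) = (fun w => - (complex.Im (F w)) *
      (complex.Re (F w) ^+ 2 + complex.Im (F w) ^+ 2)^-1)).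
  by apply: measurable_funM => //; exact: measurableT_comp.
by apply/funext => w; case: (F w) => a b /=; rewrite mulNr.
Qed.

Lemma cmeasurable_det m (M : T -> 'M[R[i]]_m) :
  (forall i j, cmeasurable (fun w => M w i j)) -> cmeasurable (fun w => \det (M w)).
Proof.
move=> mM; apply: cmeasurable_sum => s _; apply: cmeasurableM.
  exact: cmeasurable_cst.
by apply: cmeasurable_prod => i _; exact: mM.
Qed.

(** Cramer's formula: each entry is a polynomial in the entries divided by the determinant. *)
Lemma cmeasurable_invmx m (M : T -> 'M[R[i]]_m) : (forall w, M w \in unitmx) ->
  (forall i j, cmeasurable (fun w => M w i j)) ->
  forall i j, cmeasurable (fun w => invmx (M w) i j).
Proof.
move=> uM mM i j.
under eq_fun do rewrite /invmx uM mxE.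
apply: cmeasurableM; first exact/cmeasurableV/cmeasurable_det.
under eq_fun do rewrite mxE; apply: cmeasurableM; first exact: cmeasurable_cst.
by apply: cmeasurable_det => k l; under eq_fun do rewrite !mxE; exact: mM.
Qed.

End complex_measurability.

(** * Bounds and Taylor expansion of the Stieltjes transform on lower triangles *)

Section stieltjes_state.
Variables (R : realType) (n : nat) (z : R[i]).
Hypothesis hz : 0 < complex.Im z.
Local Notation normc := ComplexField.Normc.normc.
Local Notation y := (complex.Im z).
Local Notation state := ('I_n * 'I_n -> R).
Local Notation c := ((Num.sqrt n%:R)^-1 : R).
Implicit Types x h : state.

(* Symmetric matrices are coordinatised by their lower triangles: the values
   of [x] strictly above the diagonal are ignored. *)
Definition symx x : 'M[R]_n :=
  \matrix_(k, l) x (if (l <= k)%N then (k, l) else (l, k)).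

Definition state_stieltjes x : R[i] := stieltjes (c *: symx x) z.

(** A majorant of the squared Frobenius norm of n^(-1/2) [symx x]: an off-diagonal coordinate occurs
    twice in the matrix, and the diagonal is counted twice as well to keep the formula uniform. *)
Definition tri_norm2 x : R := 2 / n%:R * \sum_(u in lower_triangle n) x u ^+ 2.

Lemma tri_norm2_ge0 x : 0 <= tri_norm2 x.
Proof. by rewrite mulr_ge0 // ?divr_ge0 // sumr_ge0 // => u _; exact: sqr_ge0. Qed.

Lemma symx_tr x : (c *: symx x)^T = c *: symx x.
Proof.
apply/matrixP => k l; rewrite !mxE; congr (_ * x _).
by case: ltngtP => // /val_inj ->.
Qed.

Lemma symxD x h : c *: symx (fun u => x u + h u) = c *: symx x + c *: symx h.
Proof. by apply/matrixP => k l; rewrite !mxE mulrDr. Qed.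

Lemma symxB x h : c *: symx (fun u => x u - h u) = c *: symx x - c *: symx h.
Proof. by apply/matrixP => k l; rewrite !mxE mulrBr. Qed.

Lemma frob2_symx x : frob2 (map_mx (real_complex R) (c *: symx x)) <= tri_norm2 x.
Proof.
have -> : frob2 (map_mx (real_complex R) (c *: symx x)) =
   n%:R^-1 * \sum_(p : 'I_n * 'I_n) x (if (p.2 <= p.1)%N then p else (p.2, p.1)) ^+ 2.
  rewrite /frob2 (pair_big xpredT xpredT) /= big_distrr /=; apply: eq_bigr => p _.
  rewrite mxE normc_real real_normK ?num_real // !mxE exprMn exprVn sqr_sqrtr //.
  by congr (_ * x _ ^+ _); case: p => a b /=.
rewrite /tri_norm2 [2 / _]mulrC -mulrA ler_wpM2l ?invr_ge0 //.
rewrite (bigID (fun p : 'I_n * 'I_n => p.2 <= p.1)%N) /= mulr_natl mulr2n.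
apply: lerD.
  rewrite le_eqVlt; apply/orP; left; apply/eqP; apply: eq_big => [p|p ->//].
  by rewrite inE.
pose sw (p : 'I_n * 'I_n) := (p.2, p.1).
have swK : involutive sw by case.
rewrite (reindex_inj (inv_inj swK)) /=.
rewrite [leRHS](bigID (fun p : 'I_n * 'I_n => p.1 <= p.2)%N) /=.
rewrite addrC -[leLHS]addr0; apply: lerD.
  rewrite le_eqVlt; apply/orP; left; apply/eqP; apply: eq_big => [p|p h].
    rewrite inE /=; case: (leqP p.1 p.2) => h; rewrite ?andbF ?andbT //.
    by rewrite ltnW.
  by rewrite (negbTE h); case: p h.
by rewrite sumr_ge0 // => u _; exact: sqr_ge0.
Qed.

Lemma frob_symx x : frob (map_mx (real_complex R) (c *: symx x)) <= Num.sqrt (tri_norm2 x).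
Proof. by rewrite /frob ler_wsqrtr // frob2_symx. Qed.

Lemma state_stieltjesE x : state_stieltjes x = n%:R^-1 * \tr (resolvent (c *: symx x) z).
Proof. by []. Qed.

Lemma normc_invn : normc ((n%:R : R[i])^-1) = n%:R^-1.
Proof.
rewrite ComplexField.Normc.normcV; congr (_^-1).
by rewrite -(rmorph_nat (real_complex R)) normc_real ger0_norm.
Qed.

Lemma state_stieltjes_bound x : normc (state_stieltjes x) <= y^-1.
Proof.
rewrite state_stieltjesE ComplexField.Normc.normcM normc_invn.
(* For n = 0 the convention 0^-1 = 0 makes the transform vanish. *)
have [n0|n0] := posnP n.
  have -> : (n%:R : R)^-1 = 0 by rewrite n0 invr0.
  by rewrite mul0r invr_ge0 ltW.
rewrite ler_pdivrMl ?ltr0n // -[X in \tr X]mul1mx.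
apply: le_trans (normc_trace_mul _ _) _.
rewrite -[X in _ * frob X]mul1mx.
have h := frob_mul_resolvent hz (1%:M : 'M[R[i]]_n) (symx_tr x).
apply: le_trans (ler_wpM2l (frob_ge0 _) h) _.
by rewrite mulrA -expr2 frob_sqr frob2_1.
Qed.

Lemma state_stieltjes_lipschitz x x' :
  normc (state_stieltjes x - state_stieltjes x') <=
  Num.sqrt (tri_norm2 (fun u => x u - x' u) / n%:R) / y ^+ 2.
Proof.
rewrite !state_stieltjesE -mulrBr ComplexField.Normc.normcM normc_invn.
have [n0|n0] := posnP n.
  have -> : (n%:R : R)^-1 = 0 by rewrite n0 invr0.
  by rewrite mul0r divr_ge0 ?sqrtr_ge0 // sqr_ge0.
have hn : 0 < Num.sqrt (n%:R : R) by rewrite sqrtr_gt0 ltr0n.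
rewrite ler_pdivrMl ?ltr0n //.
apply: le_trans (trace_resolvent_lipschitz hz (symx_tr x) (symx_tr x')) _.
rewrite mulrA ler_pM2r ?invr_gt0 ?exprn_gt0 //.
rewrite sqrtrM ?tri_norm2_ge0 // sqrtrV //.
have -> : n%:R * (Num.sqrt (tri_norm2 (fun u => x u - x' u)) / Num.sqrt n%:R) =
   Num.sqrt (tri_norm2 (fun u => x u - x' u)) * Num.sqrt n%:R.
  rewrite mulrCA; congr (_ * _).
  by rewrite -{1}(sqr_sqrtr (ler0n R n)) expr2 mulfK ?gt_eqF.
rewrite ler_pM2r // -symxB.
have -> : tri_norm2 (fun u => x u - x' u) = tri_norm2 (fun u => x' u - x u).
  by congr (_ * _); apply: eq_bigr => u _; rewrite -opprB sqrrN.
exact: frob_symx.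
Qed.

(** Rows of the triangle become rows and columns of the matrix. If k and l are both outside J, the
    coordinate giving the entry (k, l) lies in row max(k, l), also outside J, so the two matrices
    differ only on a cross. *)
Lemma state_stieltjes_rank (J : {set 'I_n}) x x' :
  (forall u, u \in lower_triangle n -> u.1 \notin J -> x u = x' u) ->
  normc (state_stieltjes x - state_stieltjes x') <= 4 * #|J|%:R / (n%:R * y).
Proof.
move=> hJ; rewrite !state_stieltjesE -mulrBr ComplexField.Normc.normcM normc_invn.
rewrite invfM [n%:R^-1 * _]mulrC [X in _ <= _ * X]mulrC mulrA ler_wpM2r ?invr_ge0 //.
apply: (trace_resolvent_rank hz (symx_tr x) (symx_tr x')) => k l kJ lJ.
rewrite !mxE hJ //; first by rewrite inE; case: (leqP l k) => //= /ltnW.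
by case: ifP.
Qed.

(** The coefficients depend on x only. Once h is random and independent of x, the expectation of the
    polynomial part therefore involves only the first two moments of h. *)
Lemma state_stieltjes_taylor x : exists (a : 'I_n * 'I_n -> R[i])
    (q : 'I_n * 'I_n -> 'I_n * 'I_n -> R[i]),
  forall h, let r := normc (state_stieltjes (fun u => x u + h u) -
    (state_stieltjes x + \sum_(u in lower_triangle n) a u * (h u)%:C%C
      + \sum_(u in lower_triangle n) \sum_(v in lower_triangle n)
          q u v * (h u * h v)%:C%C)) in
   r <= 2 / y ^+ 3 / n%:R * tri_norm2 h /\
   r <= (y ^+ 4)^-1 / n%:R * (tri_norm2 h * Num.sqrt (tri_norm2 h)).
Proof.
pose S := resolvent (c *: symx x) z.
pose K (h : state) := map_mx (real_complex R) (c *: symx h).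
pose e (u : 'I_n * 'I_n) : state := fun v => (u == v)%:R.
have Ke h : K h = \sum_(u in lower_triangle n) (h u)%:C%C *: K (e u).
  apply/matrixP => k l; rewrite summxE !mxE.
  set s := if _ then _ else _.
  have st : s \in lower_triangle n.
    by rewrite /s inE; case: (leqP l k) => //= /ltnW.
  rewrite (bigD1 s) //= !mxE -/s /e eqxx mulr1 big1 ?addr0.
    by rewrite -rmorphM /= mulrC.
  move=> u /andP[_ us]; rewrite !mxE -/s (negbTE us) mulr0.
  by rewrite [real_complex _ 0]rmorph0 mulr0.
(* The coefficients are the first and second order terms of the resolvent expansion, evaluated on
   the basis matrices [K (e u)]. *)
exists (fun u => - (n%:R^-1 * \tr (S *m K (e u) *m S))).
exists (fun u v => n%:R^-1 * \tr (S *m K (e u) *m S *m K (e v) *m S)).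
move=> h r.
have l1 : \tr (S *m K h *m S) =
    \sum_(u in lower_triangle n) (h u)%:C%C * \tr (S *m K (e u) *m S).
  rewrite Ke mulmx_sumr mulmx_suml linear_sum; apply: eq_bigr => u _.
  by rewrite /= -scalemxAr -scalemxAl mxtraceZ.
have l2 : \tr (S *m K h *m S *m K h *m S) =
    \sum_(u in lower_triangle n) \sum_(v in lower_triangle n)
     (h u * h v)%:C%C * \tr (S *m K (e u) *m S *m K (e v) *m S).
  rewrite {1}(Ke h) mulmx_sumr !mulmx_suml linear_sum; apply: eq_bigr => u _ /=.
  rewrite -scalemxAr -!scalemxAl mxtraceZ (Ke h) mulmx_sumr !mulmx_suml linear_sum.
  rewrite big_distrr /=; apply: eq_bigr => v _.
  by rewrite /= -scalemxAr -!scalemxAl mxtraceZ rmorphM /= mulrA.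
have -> : r = n%:R^-1 * normc (\tr (resolvent (c *: symx x + c *: symx h) z) -
     (\tr S - \tr (S *m K h *m S) + \tr (S *m K h *m S *m K h *m S))).
  rewrite -normc_invn -ComplexField.Normc.normcM /r !state_stieltjesE -/S symxD.
  congr normc; rewrite mulrBr !mulrDr mulrN l1 l2 !mulr_sumr -sumrN.
  congr (_ - (_ + _ + _)).
    by apply: eq_bigr => u _; rewrite mulNr -mulrA [_ * (h u)%:C%C]mulrC.
  apply: eq_bigr => u _; rewrite mulr_sumr; apply: eq_bigr => v _.
  by rewrite -mulrA; congr (_ * _); rewrite mulrC.
have [b1 b2] := trace_resolvent_taylor hz (symx_tr x) (symx_tr h).
rewrite -/S -/(K h) in b1 b2.
have hb : frob (K h) <= Num.sqrt (tri_norm2 h) := frob_symx h.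
split.
  rewrite [2 / _ / _]mulrC -[leRHS]mulrA ler_wpM2l ?invr_ge0 //.
  apply: le_trans b1 _; rewrite mulrAC ler_wpM2l ?divr_ge0 ?exprn_ge0 ?(ltW hz) //.
  by rewrite frob_sqr; exact: frob2_symx.
rewrite [_^-1 / _]mulrC -[leRHS]mulrA ler_wpM2l ?invr_ge0 //.
apply: le_trans b2 _; rewrite mulrC ler_wpM2l ?invr_ge0 ?exprn_ge0 ?(ltW hz) //.
rewrite exprSr; apply: ler_pM => //; rewrite ?sqr_ge0 ?frob_ge0 //.
by rewrite frob_sqr; exact: frob2_symx.
Qed.

Lemma cmeasurable_state_stieltjes d (T : measurableType d) (Y : T -> state) :
  (forall u, measurable_fun setT (fun w => Y w u)) ->
  cmeasurable (fun w => state_stieltjes (Y w)).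
Proof.
move=> mY; apply: cmeasurableM; first exact: cmeasurable_cst.
apply: cmeasurable_sum => i _; apply: cmeasurable_invmx.
  by move=> w; apply: shift_unit; rewrite ?symx_tr.
move=> k l; under eq_fun do rewrite !mxE.
apply: cmeasurableD; last exact: cmeasurable_cst.
apply: cmeasurable_real; apply: measurable_funM => //.
Qed.

End stieltjes_state.

(** * Independence and decoupling *)

Section bounded_integrals.
Context d (T : measurableType d) (R : realType) (P : probability T R).
Implicit Types f g : T -> R.

Lemma measurable_norm_ge f (s : R) : measurable_fun setT f ->
  measurable [set w | s <= `|f w|].
Proof.
move=> mf; have mnf : measurable_fun setT (fun w => `|f w|) by apply: measurableT_comp.
rewrite [X in measurable X](_ : _ = (fun w => `|f w|) @^-1` `[s, +oo[).
  by rewrite -[X in measurable X]setTI; apply: mnf.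
by apply/seteqP; split => w /=; rewrite in_itv /= andbT.
Qed.

Lemma bounded_integrable f (B : R) : measurable_fun setT f ->
  (forall x, `|f x| <= B) -> P.-integrable setT (EFin \o f).
Proof.
move=> mf bf; apply: measurable_bounded_integrable => //.
  by apply: (le_lt_trans (probability_le1 P measurableT)); rewrite ltry.
exists B; split; first exact: num_real.
by move=> M BM x _; exact: le_trans (bf x) (ltW BM).
Qed.

Lemma integrable_EFinD f g : P.-integrable setT (EFin \o f) ->
  P.-integrable setT (EFin \o g) -> P.-integrable setT (EFin \o (fun x => f x + g x)).
Proof. by move=> fi gi; exact: (integrableD _ fi gi). Qed.

Lemma integrable_EFinB f g : P.-integrable setT (EFin \o f) ->
  P.-integrable setT (EFin \o g) -> P.-integrable setT (EFin \o (fun x => f x - g x)).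
Proof. by move=> fi gi; exact: (integrableB _ fi gi). Qed.

Lemma integrable_EFinZ (k : R) f : P.-integrable setT (EFin \o f) ->
  P.-integrable setT (EFin \o (fun x => k * f x)).
Proof. by move=> fi; exact: (integrableZl _ _ fi). Qed.

Lemma integrable_EFinZr (k : R) f : P.-integrable setT (EFin \o f) ->
  P.-integrable setT (EFin \o (fun x => f x * k)).
Proof. by move=> fi; exact: (integrableZr _ _ fi). Qed.

Lemma integrable_EFin_cst (k : R) : P.-integrable setT (EFin \o (fun=> k)).
Proof. exact: finite_measure_integrable_cst. Qed.

Lemma EFin_Rintegral f : P.-integrable setT (EFin \o f) ->
  (\int[P]_x f x)%:E = (\int[P]_x (f x)%:E)%E.
Proof. by move=> h; rewrite fineK // integrable_fin_num. Qed.

Lemma Rintegral_prob_cst (r : R) : \int[P]_x r = r.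
Proof. by rewrite Rintegral_cst //= probability_setT mulr1. Qed.

Lemma Rintegral_norm_le f (B : R) : P.-integrable setT (EFin \o f) ->
  (forall x, `|f x| <= B) -> `|\int[P]_x f x| <= B.
Proof.
move=> fi fB; apply: le_trans (le_normr_Rintegral _ _) _ => //.
rewrite -[leRHS]Rintegral_prob_cst; apply: le_Rintegral => //.
- exact: integrable_norm.
- exact: finite_measure_integrable_cst.
Qed.

Lemma Rintegral_sum (I : Type) (r : seq I) (Q : pred I) (F : I -> T -> R) :
  (forall i, P.-integrable setT (EFin \o F i)) ->
  \int[P]_x (\sum_(i <- r | Q i) F i x) = \sum_(i <- r | Q i) \int[P]_x F i x.
Proof.
move=> iF.
have iS s : P.-integrable setT (EFin \o (fun x => \sum_(i <- s | Q i) F i x)).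
  rewrite (_ : _ \o _ = (fun x => \sum_(i <- s | Q i) (EFin \o F i) x)%E).
    by apply: integrable_sum => // i _; exact: iF.
  by apply/funext => x /=; rewrite sumEFin.
elim: r => [|i r ih].
  by rewrite big_nil; under eq_Rintegral do rewrite big_nil; exact: Rintegral_prob_cst.
rewrite big_cons; under eq_Rintegral do rewrite big_cons.
by case: (Q i) => //; rewrite RintegralD // ih.
Qed.

End bounded_integrals.

Lemma Rintegral_distribution d1 d2 (T1 : measurableType d1) (T2 : measurableType d2)
    (R : realType) (P : probability T1 R) (X : {mfun T1 >-> T2}) (f : T2 -> R) :
  measurable_fun setT f -> P.-integrable setT (EFin \o (f \o X)) ->
  \int[distribution P X]_y f y = \int[P]_x f (X x).
Proof.
move=> mf fi; rewrite /Rintegral integral_distribution //.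
exact/measurable_EFinP.
Qed.

(** * Fubini's theorem for bounded functions *)

Section fubini_bounded.
Context d1 d2 (T1 : measurableType d1) (T2 : measurableType d2) (R : realType).
Variables (P : probability T1 R) (Q : probability T2 R).
Variables (f : T1 * T2 -> R) (B : R).
Hypothesis mf : measurable_fun setT f.
Hypothesis bf : forall x, `|f x| <= B.

Let B0 : 0 <= B.
Proof. exact: le_trans (normr_ge0 _) (bf point). Qed.

Let mf2 x : measurable_fun setT (fun y => f (x, y)).
Proof. exact: measurableT_comp. Qed.

Let mf1 y : measurable_fun setT (fun x => f (x, y)).
Proof. exact: measurableT_comp. Qed.

Let prod_integrable : (P \x Q)%E.-integrable setT (EFin \o f).
Proof.
apply/integrable12ltyP; first exact/measurable_EFinP.
apply: (@le_lt_trans _ _ (\int[P]_x B%:E)%E); last first.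
  by rewrite integral_cst //= probability_setT mule1 ltry.
apply: ge0_le_integral => //=.
- by move=> x _; exact: integral_ge0.
- apply: (measurable_fun_fubini_tonelli_F (fun p => `|(f p)%:E|%E)) => //=.
  by apply/measurable_EFinP; exact: measurableT_comp.
- move=> x _; apply: (@le_trans _ _ (\int[Q]_y B%:E)%E); last first.
    by rewrite integral_cst //= probability_setT mule1.
  apply: ge0_le_integral => //=.
  + by apply/measurable_EFinP; apply: measurableT_comp => //; exact: mf2.
  + by move=> y _; rewrite lee_fin.
Qed.

Lemma measurable_Rintegral_fst : measurable_fun setT (fun x => \int[Q]_y f (x, y)).
Proof.
apply/measurable_EFinP.
rewrite (_ : _ \o _ = (fun x => \int[Q]_y (f (x, y))%:E)%E); last first.
  by apply/funext => x /=; rewrite EFin_Rintegral //; exact: (bounded_integrable _ (mf2 x)).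
exact: (measurable_fubini_F prod_integrable).
Qed.

Lemma Rintegral_fst_bound x : `|\int[Q]_y f (x, y)| <= B.
Proof. by apply: Rintegral_norm_le => //; exact: (bounded_integrable _ (mf2 x)). Qed.

Lemma Rintegral_prod : \int[(P \x Q)%E]_p f p = \int[P]_x \int[Q]_y f (x, y).
Proof.
rewrite /Rintegral -integral12_prod_meas1 //; congr fine; apply: eq_integral => x _ /=.
by rewrite EFin_Rintegral //; exact: (bounded_integrable _ (mf2 x)).
Qed.

Lemma Rintegral_fubini :
  \int[P]_x \int[Q]_y f (x, y) = \int[Q]_y \int[P]_x f (x, y).
Proof.
rewrite -Rintegral_prod {1}/Rintegral -integral21_prod_meas1 //.
congr fine; apply: eq_integral => y _ /=.
by rewrite EFin_Rintegral //; exact: (bounded_integrable _ (mf1 y)).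
Qed.

End fubini_bounded.

(** No measure on the first factor is given; the Dirac mass at [point] serves to invoke Fubini, and
    measurability does not depend on it. *)
Lemma measurable_Rintegral_param d1 d2 (T1 : measurableType d1) (T2 : measurableType d2)
    (R : realType) (Q : probability T2 R) (f : T1 * T2 -> R) (B : R) :
  measurable_fun setT f -> (forall x, `|f x| <= B) ->
  measurable_fun setT (fun x => \int[Q]_y f (x, y)).
Proof. exact: (measurable_Rintegral_fst (dirac point)). Qed.

(* Measurability of functions of a family of random variables, phrased through
   composition so that no sigma-algebra on [I -> R] is needed. *)
Definition state_measurable (I : Type) (R : realType) (h : (I -> R) -> R) :=
  forall d (T : measurableType d) (Y : T -> I -> R),
    (forall i, measurable_fun setT (fun w => Y w i)) ->
    measurable_fun setT (fun w => h (Y w)).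

(** Discarded coordinates are set to 0 rather than removed: all subfamilies keep the same index type
    and recombine by addition. *)
Definition restr (I : Type) (R : realType) (a : pred I) (x : I -> R) : I -> R :=
  fun i => if a i then x i else 0.

Lemma measurable_restr d (T : measurableType d) (R : realType) (I : Type) (a : pred I)
    (Y : T -> I -> R) i : (forall i, measurable_fun setT (fun w => Y w i)) ->
  measurable_fun setT (fun w => restr a (Y w) i).
Proof. by move=> mY; rewrite /restr; case: (a i). Qed.

(** * Independent sigma-fields and integration over two copies *)

Section decoupling.
Context d (T : measurableType d) (R : realType) (P : probability T R).
Variables (I : Type) (A B : set I) (Y : I -> T -> R).
Hypothesis mY : forall i, measurable_fun setT (Y i).
Hypothesis ind : independent_sigma_fields P (sigma_field A Y) (sigma_field B Y).

Let gen (C : set I) : set (set T) :=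
  \bigcup_(i in C) preimage_set_system setT (Y i) measurable.
Let TA := g_sigma_algebraType (gen A).
Let TB := g_sigma_algebraType (gen B).

Let sub_measurable (C : set I) : <<s gen C >> `<=` @measurable _ T.
Proof.
apply: smallest_sub; first exact: sigma_algebra_measurable.
by move=> _ [i _ [V mV <-]]; exact: mY.
Qed.

Let measurable_idA : measurable_fun (T := T) (U := TA) setT idfun.
Proof. by move=> _ V mV; rewrite setTI; exact: sub_measurable mV. Qed.

Let measurable_idB : measurable_fun (T := T) (U := TB) setT idfun.
Proof. by move=> _ V mV; rewrite setTI; exact: sub_measurable mV. Qed.

Let measurable_Y (C : set I) i : C i ->
  measurable_fun (T := g_sigma_algebraType (gen C)) setT (Y i).
Proof.
by move=> Ci _ V mV; apply: sub_sigma_algebra; exists i => //; exists V.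
Qed.

(** The identity, from T to the same set with the sigma-field generated by the family A; its law is
    P restricted to that sigma-field. *)
Let fA : {mfun T >-> TA} := HB.pack (idfun : T -> TA)
  (isMeasurableFun.Build _ _ _ _ _ measurable_idA).
Let fB : {mfun T >-> TB} := HB.pack (idfun : T -> TB)
  (isMeasurableFun.Build _ _ _ _ _ measurable_idB).

Let measurable_diag : measurable_fun (T := T) (U := (TA * TB)%type) setT (fun w => (w, w)).
Proof. exact: (measurable_fun_pair measurable_idA measurable_idB). Qed.
Let fD : {mfun T >-> (TA * TB)%type} := HB.pack (fun w : T => (w, w) : TA * TB)
  (isMeasurableFun.Build _ _ _ _ _ measurable_diag).

(** On rectangles this is the independence hypothesis, and rectangles determine the measure: the
    pair (w, w), seen through the two sigma-fields, is distributed as an independent pair. *)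
Let dist_diag (X : set (TA * TB)) : measurable X ->
  (distribution P fA \x distribution P fB)%E X = distribution P fD X.
Proof.
apply: product_measure_unique => U V mU mV.
by rewrite /distribution /pushforward; exact: (ind mU mV).
Qed.

Let Rintegral_diag (F : TA * TB -> R) (c : R) : measurable_fun setT F ->
  (forall p, `|F p| <= c) ->
  \int[P]_w F (w, w) = \int[P]_w \int[P]_w' F (w, w').
Proof.
move=> mF bF.
have iF : P.-integrable setT (EFin \o (F \o fD)).
  apply: (@bounded_integrable _ _ _ _ _ c).
    exact: (measurableT_comp mF measurable_diag).
  by move=> w; exact: bF.
have e := Rintegral_distribution mF iF.
rewrite -[LHS]e.
have -> : \int[distribution P fD]_y F y =
   \int[(distribution P fA \x distribution P fB)%E]_y F y.
  by congr fine; apply: eq_measure_integral => X mX _; exact/esym/dist_diag.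
rewrite (Rintegral_prod _ _ mF bF).
have mF2 x : measurable_fun setT (fun y => F (x, y)) by exact: measurableT_comp.
rewrite Rintegral_distribution.
- apply: eq_Rintegral => w _; rewrite Rintegral_distribution //.
  apply: (@bounded_integrable _ _ _ _ _ c).
    exact: (measurableT_comp (mF2 _) measurable_idB).
  by move=> w'; exact: bF.
- exact: (measurable_Rintegral_fst (distribution P fA) (distribution P fB) mF bF).
- apply: (@bounded_integrable _ _ _ _ _ c).
    apply: (@measurableT_comp _ _ _ _ _ _ (fun x => \int[distribution P fB]_y F (x, y))).
      exact: (measurable_Rintegral_fst (distribution P fA) (distribution P fB) mF bF).
    exact: measurable_idA.
  by move=> w; exact: Rintegral_fst_bound.
Qed.

(** Each restriction is measurable for its own sigma-field, since the discarded coordinates are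
    constant, so the integrand is a bounded measurable function on the product. *)
Lemma decouple_state (a b : pred I) (h : (I -> R) -> R) (c : R) :
  (forall i, a i -> A i) -> (forall i, b i -> B i) ->
  state_measurable h -> (forall x, `|h x| <= c) ->
  \int[P]_w h (fun i => restr a (Y ^~ w) i + restr b (Y ^~ w) i) =
  \int[P]_w \int[P]_w' h (fun i => restr a (Y ^~ w) i + restr b (Y ^~ w') i).
Proof.
move=> aA bB mh bh.
apply: (Rintegral_diag
  (F := fun p => h (fun i => restr a (Y ^~ p.1) i + restr b (Y ^~ p.2) i))) => //.
apply: mh => i; apply: measurable_funD.
  rewrite /restr; case ai : (a i) => //.
  exact: (measurableT_comp (measurable_Y (aA i ai)) measurable_fst).
rewrite /restr; case bi : (b i) => //.
exact: (measurableT_comp (measurable_Y (bB i bi)) measurable_snd).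
Qed.

(** [decouple_state] handles bounded functions only; here integrability on the product is first
    obtained from Tonelli. The result shows that entries of X in different cells are uncorrelated, a
    property that G then inherits. *)
Lemma decouple_product i j : A i -> B j ->
  P.-integrable setT (EFin \o Y i) -> P.-integrable setT (EFin \o Y j) ->
  (\int[P]_w (Y i w * Y j w)%:E = (\int[P]_w (Y i w)%:E) * (\int[P]_w (Y j w)%:E))%E.
Proof.
move=> Ai Bj ii ij.
pose F (p : TA * TB) : \bar R := (Y i p.1 * Y j p.2)%:E.
have mF : measurable_fun setT F.
  apply/measurable_EFinP; apply: measurable_funM.
    exact: (measurableT_comp (measurable_Y Ai) measurable_fst).
  exact: (measurableT_comp (measurable_Y Bj) measurable_snd).
have distE (C : set I) (k : I) (f : {mfun T >-> g_sigma_algebraType (gen C)})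
    (g : R -> R) : (f : T -> T) =1 id -> C k -> measurable_fun setT g ->
    P.-integrable setT (EFin \o (g \o Y k)) ->
    (\int[distribution P f]_x (g (Y k x))%:E = \int[P]_x (g (Y k x))%:E)%E.
  move=> fE Ck mg gi; rewrite integral_distribution.
  - by apply: eq_integral => x _ /=; rewrite fE.
  - apply/measurable_EFinP; apply: measurableT_comp => //; exact: measurable_Y.
  - by apply: eq_integrable gi => // x _ /=; rewrite fE.
have iF : (distribution P fA \x distribution P fB)%E.-integrable setT F.
  apply/integrable12ltyP => //.
  have -> : (\int[distribution P fA]_x \int[distribution P fB]_y `|F (x, y)|)%E =
     ((\int[P]_x `|Y i x|%:E) * (\int[P]_x `|Y j x|%:E))%E.
    transitivity (\int[distribution P fA]_x (`|Y i x|%:E * \int[P]_x `|Y j x|%:E))%E.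
      apply: eq_integral => x _.
      rewrite -(distE B j fB Num.norm) //; last exact: integrable_norm.
      rewrite -ge0_integralZl //=.
      - by apply: eq_integral => y _; rewrite /F /= normrM.
      - apply/measurable_EFinP; apply: measurableT_comp => //; exact: measurable_Y.
    rewrite ge0_integralZr //=.
    - rewrite (distE A i fA Num.norm) //; exact: integrable_norm.
    - apply/measurable_EFinP; apply: measurableT_comp => //; exact: measurable_Y.
    - exact: integral_ge0.
  apply: lte_mul_pinfty; first exact: integral_ge0.
    rewrite ge0_fin_numE; last exact: integral_ge0.
    by move/integrableP: ii => [_].
  by move/integrableP: ij => [_].
have e : (\int[P]_w (Y i w * Y j w)%:E = \int[distribution P fD]_p F p)%E.
  rewrite integral_distribution //.
  have : (distribution P fD).-integrable setT F.
    apply/integrableP; split => //.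
    rewrite -(eq_measure_integral _ (fun X mX _ => dist_diag mX)).
    by move/integrableP: iF => [].
  move/integrableP => [_ h]; apply/integrableP; split.
    exact: measurableT_comp.
  by move: h; rewrite ge0_integral_distribution //; exact: measurableT_comp.
rewrite e -(eq_measure_integral _ (fun X mX _ => dist_diag mX)) -integral12_prod_meas1 //.
transitivity (\int[distribution P fA]_x ((Y i x)%:E * \int[P]_x (Y j x)%:E))%E.
  apply: eq_integral => x _.
  rewrite -(distE B j fB id) // -integralZl //.
  apply/integrableP; split; first by apply/measurable_EFinP; exact: measurable_Y.
  rewrite (distE B j fB Num.norm) //; last exact: integrable_norm.
  by move/integrableP: ij => [_].
have fj : (\int[P]_x (Y j x)%:E \is a fin_num)%E by exact: integrable_fin_num.
rewrite -(fineK fj) integralZr //.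
  by rewrite (distE A i fA id).
apply/integrableP; split; first by apply/measurable_EFinP; exact: measurable_Y.
rewrite (distE A i fA Num.norm) //; last exact: integrable_norm.
by move/integrableP: ii => [_].
Qed.

End decoupling.

(** * Martingale concentration *)

(** From exp(-t) >= 1 - t, it suffices that (1 + t + 2 t^2) (1 - t) = 1 + t^2 (1 - 2 t) >= 1. *)
Lemma expR_le_quadratic (R : realType) (t : R) : t <= 2^-1 ->
  expR t <= 1 + t + 2 * t ^+ 2.
Proof.
move=> t2; have h := expR_ge1Dx (- t).
have p : 0 < 1 - t by lra.
have : expR t <= (1 - t)^-1.
  by rewrite -[expR t]invrK -expRN lef_pV2 ?posrE ?expR_gt0.
move/le_trans; apply; rewrite -[leLHS]mul1r ler_pdivrMr //.
have -> : (1 + t + 2 * t ^+ 2) * (1 - t) = 1 + t ^+ 2 * (1 - 2 * t) by ring.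
rewrite lerDl mulr_ge0 ?sqr_ge0 //; lra.
Qed.

Section concentration.
Context d (T : measurableType d) (R : realType) (P : probability T R).
Variables (I : Type) (Y : I -> T -> R) (D : pred I) (bid : I -> nat).
Hypothesis mY : forall i, measurable_fun setT (Y i).

(** [D] selects the retained coordinates and [bid] numbers the block of each of them. *)
Definition below b : pred I := fun i => D i && (bid i < b)%N.
Definition level b : pred I := fun i => D i && (bid i == b)%N.

Hypothesis ind : forall b, independent_sigma_fields P
  (sigma_field [set i | below b i] Y) (sigma_field [set i | level b i] Y).

Lemma restr_belowS b (x : I -> R) :
  restr (below b.+1) x = (fun i => restr (below b) x i + restr (level b) x i).
Proof.
apply/funext => i; rewrite /restr /below /level; case: (D i); rewrite ?addr0 //=.
by rewrite ltnS leq_eqVlt; case: ltngtP; rewrite /= ?addr0 ?add0r.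
Qed.

Lemma decouple_level b (h : (I -> R) -> R) (c : R) :
  state_measurable h -> (forall x, `|h x| <= c) ->
  \int[P]_w h (restr (below b.+1) (Y ^~ w)) =
  \int[P]_w \int[P]_w' h (fun i => restr (below b) (Y ^~ w) i + restr (level b) (Y ^~ w') i).
Proof.
move=> mh bh; under eq_Rintegral do rewrite restr_belowS.
exact: (decouple_state (a := below b) (b := level b) mY (@ind b) _ _ mh bh).
Qed.

(** Induction on the number of blocks, integrating out the last one; each block costs a factor 1 + 2
    (lam c)^2. The sign of [lam] is free, so that both tails are covered. *)
Lemma exp_moment_martingale (lam c B : R) b (h : (I -> R) -> R) :
  0 <= c -> `|lam| * c <= 2^-1 ->
  state_measurable h -> (forall x, `|h x| <= B) ->
  (forall k W x x', (k < b)%N ->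
    `|h (fun i => W i + restr (level k) x i) - h (fun i => W i + restr (level k) x' i)| <= c) ->
  \int[P]_w expR (lam * (h (restr (below b) (Y ^~ w)) -
                         \int[P]_w' h (restr (below b) (Y ^~ w')))) <=
  (1 + 2 * (lam * c) ^+ 2) ^+ b.
Proof.
move=> c0 lc; elim: b h => [|b ih] h mh bh dh.
  have e w : restr (below 0) (Y ^~ w) = (fun=> 0).
    by apply/funext => i; rewrite /restr /below ltn0 andbF.
  under eq_Rintegral do rewrite e.
  under [X in _ - X]eq_Rintegral do rewrite e.
  by rewrite !Rintegral_prob_cst subrr mulr0 expR0 expr0.
(* [g] averages over the last block. It plays the part of the conditional expectation given the
   earlier blocks and satisfies the induction hypotheses with the same [B] and [c]. *)
pose g (W : I -> R) := \int[P]_w h (fun i => W i + restr (level b) (Y ^~ w) i).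
have mV (d' : measure_display) (T' : measurableType d') (W : T' -> I -> R) :
    (forall i, measurable_fun setT (fun w => W w i)) ->
    measurable_fun setT (fun p : T' * T => h (fun i => W p.1 i + restr (level b) (Y ^~ p.2) i)).
  move=> mW; apply: mh => i; apply: measurable_funD.
    exact: (measurableT_comp (mW i) measurable_fst).
  apply: (measurableT_comp (f := fun w => restr (level b) (Y ^~ w) i)) => //.
  exact: measurable_restr.
have mVh W : measurable_fun setT (fun w => h (fun i => W i + restr (level b) (Y ^~ w) i)).
  by apply: mh => i; apply: measurable_funD => //; exact: measurable_restr.
have iVh W : P.-integrable setT (EFin \o (fun w => h (fun i => W i + restr (level b) (Y ^~ w) i))).
  exact: (@bounded_integrable _ _ _ _ _ B).
have mg : state_measurable g.
  move=> d' T' W mW.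
  apply: (@measurable_Rintegral_param _ _ _ _ _ P (fun p => h (fun i =>
    W p.1 i + restr (level b) (Y ^~ p.2) i)) B) => //.
  exact: mV.
have bg W : `|g W| <= B by apply: Rintegral_norm_le.
have dg k W x x' : (k < b)%N ->
    `|g (fun i => W i + restr (level k) x i) - g (fun i => W i + restr (level k) x' i)| <= c.
  move=> kb; rewrite /g -RintegralB //.
  apply: Rintegral_norm_le.
    by apply: integrable_EFinB; exact: iVh.
  move=> w.
  have sw (u : I -> R) : (fun i => W i + restr (level k) u i + restr (level b) (Y ^~ w) i) =
     (fun i => (fun i => W i + restr (level b) (Y ^~ w) i) i + restr (level k) u i).
    by apply/funext => i; rewrite addrAC.
  by rewrite !sw; apply: dh; rewrite ltnS ltnW.
set m := \int[P]_w h (restr (below b.+1) (Y ^~ w)).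
have mE : m = \int[P]_w g (restr (below b) (Y ^~ w)) by exact: decouple_level bh.
have hm x : lam * (h x - m) <= `|lam| * (2 * B).
  apply: le_trans (ler_norm _) _; rewrite normrM ler_wpM2l //.
  apply: le_trans (ler_normB _ _) _; rewrite mulr_natl mulr2n lerD //.
  apply: Rintegral_norm_le => //; apply: (@bounded_integrable _ _ _ _ _ B) => //.
  by apply: mh => i; exact: measurable_restr.
rewrite (@decouple_level b (fun x => expR (lam * (h x - m))) (expR (`|lam| * (2 * B)))); first last.
- by move=> x; rewrite ger0_norm ?expR_ge0 // ler_expR.
- move=> d' T' W mW; apply: measurableT_comp => //; apply: measurable_funM => //.
  by apply: measurable_funB => //; exact: mh.
have iH W : P.-integrable setT (EFin \o (fun w' =>
     expR (lam * (h (fun i => W i + restr (level b) (Y ^~ w') i) - m)))).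
  apply: (@bounded_integrable _ _ _ _ _ (expR (`|lam| * (2 * B)))).
    apply: measurableT_comp => //; apply: measurable_funM => //.
    by apply: measurable_funB => //; exact: mVh.
  by move=> x; rewrite ger0_norm ?expR_ge0 // ler_expR.
have inner W : \int[P]_w' expR (lam * (h (fun i => W i + restr (level b) (Y ^~ w') i) - m))
    <= expR (lam * (g W - m)) * (1 + 2 * (lam * c) ^+ 2).
  have dev w : `|h (fun i => W i + restr (level b) (Y ^~ w) i) - g W| <= c.
    rewrite /g -[X in `|X - _|](Rintegral_prob_cst P) -RintegralB //; last first.
      exact: integrable_EFin_cst.
    apply: Rintegral_norm_le.
      by apply: integrable_EFinB; [exact: integrable_EFin_cst|exact: iVh].
    by move=> w'; exact: dh.
  (* The increment has mean zero and absolute value at most |lam| c <= 1/2, so the linear term of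
     [expR_le_quadratic] integrates to zero. *)
  pose t w := lam * (h (fun i => W i + restr (level b) (Y ^~ w) i) - g W).
  have it : P.-integrable setT (EFin \o t).
    apply: (@bounded_integrable _ _ _ _ _ (`|lam| * c)).
      by apply: measurable_funM => //; apply: measurable_funB => //; exact: mVh.
    by move=> w; rewrite normrM ler_wpM2l.
  have t0 : \int[P]_w t w = 0.
    rewrite /t RintegralZl //; last first.
      apply: (@bounded_integrable _ _ _ _ _ c) => //.
      by apply: measurable_funB => //; exact: mVh.
    rewrite RintegralB // ?Rintegral_prob_cst ?subrr ?mulr0 //.
    exact: integrable_EFin_cst.
  apply: (@le_trans _ _ (\int[P]_w (expR (lam * (g W - m)) *
      (1 + 2 * (lam * c) ^+ 2 + t w)))).
    apply: le_Rintegral; [by []|exact: iH| |].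
      apply: (@bounded_integrable _ _ _ _ _
        (expR (lam * (g W - m)) * (1 + 2 * (lam * c) ^+ 2 + `|lam| * c))).
        apply: measurable_funM => //; apply: measurable_funD => //.
        by apply: measurable_funM => //; apply: measurable_funB => //; exact: mVh.
      move=> w; rewrite normrM (ger0_norm (expR_ge0 _)) ler_wpM2l ?expR_ge0 //.
      apply: le_trans (ler_normD _ _) _; apply: lerD.
        by rewrite ger0_norm // addr_ge0 // mulr_ge0 // sqr_ge0.
      by rewrite normrM ler_wpM2l.
    move=> w _.
    have -> : lam * (h (fun i => W i + restr (level b) (Y ^~ w) i) - m) =
        lam * (g W - m) + t w by rewrite /t; ring.
    rewrite expRD ler_wpM2l ?expR_ge0 //.
    have tle : `|t w| <= `|lam| * c by rewrite normrM ler_wpM2l.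
    apply: le_trans (expR_le_quadratic _) _.
      by apply: le_trans (ler_norm _) _; exact: le_trans tle lc.
    rewrite addrAC lerD2r lerD2l ler_wpM2l //.
    rewrite -(ger0_norm (sqr_ge0 (t w))) normrX -[leRHS]ger0_norm ?sqr_ge0 // normrX.
    by rewrite lerXn2r ?nnegrE // [`|lam * c|]normrM (ger0_norm c0).
  rewrite RintegralZl //; last first.
    by apply: integrable_EFinD => //; exact: integrable_EFin_cst.
  rewrite ler_wpM2l ?expR_ge0 // RintegralD //; last exact: integrable_EFin_cst.
  by rewrite t0 Rintegral_prob_cst addr0.
have gm x : lam * (g x - m) <= `|lam| * (2 * B).
  apply: le_trans (ler_norm _) _; rewrite normrM ler_wpM2l //.
  apply: le_trans (ler_normB _ _) _; rewrite mulr_natl mulr2n lerD //.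
  apply: Rintegral_norm_le => //; apply: (@bounded_integrable _ _ _ _ _ B) => //.
  by apply: mh => i; exact: measurable_restr.
have ig : P.-integrable setT (EFin \o (fun w => expR (lam * (g (restr (below b) (Y ^~ w)) - m)))).
  apply: (@bounded_integrable _ _ _ _ _ (expR (`|lam| * (2 * B)))).
    apply: measurableT_comp => //; apply: measurable_funM => //.
    by apply: measurable_funB => //; apply: mg => i; exact: measurable_restr.
  by move=> x; rewrite ger0_norm ?expR_ge0 // ler_expR.
apply: (@le_trans _ _ (\int[P]_w (expR (lam * (g (restr (below b) (Y ^~ w)) - m)) *
     (1 + 2 * (lam * c) ^+ 2)))).
  apply: le_Rintegral; [by []| | |by move=> w _; exact: inner].
    apply: (@bounded_integrable _ _ _ _ _ (expR (`|lam| * (2 * B)))).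
      apply: (@measurable_Rintegral_param _ _ _ _ _ P (fun p => expR (lam * (h (fun i =>
        restr (below b) (Y ^~ p.1) i + restr (level b) (Y ^~ p.2) i) - m)))
        (expR (`|lam| * (2 * B)))).
        apply: measurableT_comp => //; apply: measurable_funM => //.
        apply: measurable_funB => //.
        apply: (mV _ _ (fun w => restr (below b) (Y ^~ w))) => i.
        exact: measurable_restr.
      by move=> p; rewrite ger0_norm ?expR_ge0 // ler_expR.
    move=> w; apply: Rintegral_norm_le; first exact: iH.
    by move=> p; rewrite ger0_norm ?expR_ge0 // ler_expR.
  exact: integrable_EFinZr.
rewrite RintegralZr //.
rewrite [leRHS]exprSr; apply: ler_wpM2r.
  by rewrite addr_ge0 // mulr_ge0 // sqr_ge0.
rewrite mE; apply: ih => // k W x x' kb; exact: dg.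
Qed.

(** Chernoff's bound for the deviation and for its opposite, which accounts for the factor 2. *)
Lemma bounded_difference_tail (lam c B t : R) N (h : (I -> R) -> R) :
  0 < lam -> 0 <= c -> lam * c <= 2^-1 ->
  state_measurable h -> (forall x, `|h x| <= B) ->
  (forall k W x x', (k < N)%N ->
    `|h (fun i => W i + restr (level k) x i) - h (fun i => W i + restr (level k) x' i)| <= c) ->
  (P [set w | (t <= `|h (restr (below N) (Y ^~ w)) -
                     \int[P]_w' h (restr (below N) (Y ^~ w'))|)%R] <=
  (2 * expR (- (lam * t)) * (1 + 2 * (lam * c) ^+ 2) ^+ N)%:E)%E.
Proof.
move=> l0 c0 lc mh bh dh; set m := \int[P]_w' _.
pose Z w := h (restr (below N) (Y ^~ w)) - m.
have mZ : measurable_fun setT Z.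
  by apply: measurable_funB => //; apply: mh => i; exact: measurable_restr.
have bZ w : `|Z w| <= B + `|m| by apply: le_trans (ler_normB _ _) _; rewrite lerD2r.
have tail (s : R) : `|s| = 1 ->
   (P [set w | (t <= s * Z w)%R] <= (expR (- (lam * t)) * (1 + 2 * (lam * c) ^+ 2) ^+ N)%:E)%E.
  move=> s1.
  have msZ : measurable_fun setT (fun w => s * Z w) by apply: measurable_funM.
  pose X : {RV P >-> R} := HB.pack (fun w => s * Z w) (isMeasurableFun.Build _ _ _ _ _ msZ).
  apply: le_trans (chernoff X t l0) _.
  rewrite EFinM muleC [(lam * t)%R]mulrC lee_pmul2l ?lte_fin ?expR_gt0 //.
  rewrite /mmt_gen_fun unlock -[X in (X <= _)%E]/(\int[P]_w (expR (s * Z w * lam))%:E)%E.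
  rewrite -EFin_Rintegral; last first.
    apply: (@bounded_integrable _ _ _ _ _ (expR ((B + `|m|) * lam))).
      by apply: measurableT_comp => //; apply: measurable_funM.
    move=> w /=; rewrite ger0_norm ?expR_ge0 // ler_expR ler_wpM2r ?(ltW l0) //.
    by apply: le_trans (ler_norm _) _; rewrite normrM s1 mul1r.
  rewrite lee_fin.
  have := @exp_moment_martingale (s * lam) c B N h c0.
  rewrite normrM s1 mul1r (gtr0_norm l0) => /(_ lc mh bh dh).
  have -> : (s * lam * c) ^+ 2 = (lam * c) ^+ 2.
    by rewrite -mulrA exprMn -[s ^+ 2]ger0_norm ?sqr_ge0 // normrX s1 expr1n mul1r.
  apply: le_trans; rewrite le_eqVlt; apply/orP; left; apply/eqP.
  by apply: eq_Rintegral => w _; congr expR; rewrite -/m -/(Z w); ring.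
have mS (s : R) : measurable [set w | t <= s * Z w].
  have msZ : measurable_fun setT (fun w => s * Z w) by apply: measurable_funM.
  rewrite [X in measurable X](_ : _ = (fun w => s * Z w) @^-1` `[t, +oo[).
    by rewrite -[X in measurable X]setTI; apply: msZ.
  by apply/seteqP; split => w /=; rewrite in_itv /= andbT.
apply: (@le_trans _ _ (P ([set w | (t <= 1 * Z w)%R] `|` [set w | (t <= -1 * Z w)%R]))).
  apply: le_measure; rewrite ?inE.
  - exact: (measurable_norm_ge _ mZ).
  - exact: measurableU.
  - move=> w /=; rewrite -/(Z w) mul1r mulN1r.
    by case: (ger0P (Z w)) => _ ?; [left|right].
apply: le_trans (measureU2 _ _ _) _ => //.
rewrite -mulrA mulr_natl mulr2n EFinD.
by apply: leeD; apply: tail; rewrite ?normrN normr1.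
Qed.

End concentration.

(** * Almost sure convergence from geometrically decaying tails *)

Section borel_cantelli.
Context d (T : measurableType d) (R : realType) (P : probability T R).

Lemma ae_cvg0_geometric (Z : nat -> T -> R) :
  (forall n, measurable_fun setT (Z n)) ->
  (forall eps : R, 0 < eps -> exists N (C q : R), [/\ 0 <= q, q < 1 &
     forall n, (N <= n)%N -> (P [set w | (eps <= `|Z n w|)%R] <= (C * q ^+ n)%:E)%E]) ->
  {ae P, forall w, (fun n => Z n w) @ \oo --> (0 : R)}.
Proof.
move=> mZ hZ.
(* Restricting to the thresholds 1 / (k + 1) keeps the exceptional set a countable union of null
   sets. *)
have key (k : nat) : {ae P, forall w, \forall n \near \oo, `|Z n w| < k.+1%:R^-1}.
  have [N [C [q [q0 q1 hN]]]] := hZ k.+1%:R^-1 (ltac:(by rewrite invr_gt0)).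
  (* Events before [N] are emptied so that the tail bound holds at every index; the sign of [C] is
     unknown, hence its absolute value below. *)
  pose F n : set T := if (n < N)%N then set0 else [set w | k.+1%:R^-1 <= `|Z n w|].
  have mF n : measurable (F n).
    by rewrite /F; case: ifP => // _; exact: measurable_norm_ge.
  have sF : (\sum_(n <oo) P (F n) < +oo)%E.
    apply: (@le_lt_trans _ _ (`|C| / (1 - q))%:E); last exact: ltry.
    apply: lime_le; first by apply: is_cvg_nneseries => n _ _; exact: measure_ge0.
    apply: nearW => n; apply: (@le_trans _ _ (\sum_(0 <= i < n) (`|C| * q ^+ i)%:E)%E).
      apply: lee_sum => i _; rewrite /F; case: ltnP => Ni.
        by rewrite measure0 lee_fin mulr_ge0 // exprn_ge0.
      apply: le_trans (hN _ Ni) _; rewrite lee_fin ler_wpM2r ?exprn_ge0 //.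
      exact: ler_norm.
    rewrite sumEFin lee_fin -mulr_sumr ler_wpM2l //.
    have p1 : 0 < 1 - q by rewrite subr_gt0.
    rewrite -[leRHS]mul1r ler_pdivlMr // big_mkord mulrC -opprB mulNr -subrX1 opprB.
    by rewrite gerBl exprn_ge0.
  have := lim_sup_set_cvg0 mF sF => h0.
  exists (lim_sup_set F); split => //.
    by apply: bigcap_measurable => // n _; exact: bigcup_measurable.
  move=> w /= nh; apply: contrapT => nF; apply: nh.
  have : exists n, forall j, (n <= j)%N -> ~ F j w.
    apply: contrapT => h; apply: nF => n _.
    apply: contrapT => h2; apply: h; exists n => j nj Fj; apply: h2.
    by exists j.
  move=> [n hn]; exists (maxn n N) => // j /=.
  rewrite geq_max => /andP[nj Nj]; have := hn j nj; rewrite /F ltnNge Nj /=.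
  by move=> /negP; rewrite -ltNge.
have := ae_foralln key; apply: filterS => w hw.
apply/cvgrPdist_lt => e e0.
have [k hk] : exists k : nat, k.+1%:R^-1 < e.
  have := @ltr_add_invr R 0 e e0 => -[k]; rewrite add0r => ?; by exists k.
by apply: filterS (hw k) => n h; rewrite sub0r normrN; exact: lt_trans h hk.
Qed.

End borel_cantelli.

(** * Real and imaginary parts of the Stieltjes transform *)

Section part_stieltjes.
Variables (R : realType) (n : nat) (z : R[i]).
Hypothesis hz : 0 < complex.Im z.
Local Notation y := (complex.Im z).
Local Notation normc := ComplexField.Normc.normc.
Local Notation state := ('I_n * 'I_n -> R).

Definition cpart (re : bool) (w : R[i]) : R :=
  if re then complex.Re w else complex.Im w.

Lemma cpartD re (v w : R[i]) : cpart re (v + w) = cpart re v + cpart re w.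
Proof. by case: re; case: v => ? ?; case: w. Qed.

Lemma cpartB re (v w : R[i]) : cpart re (v - w) = cpart re v - cpart re w.
Proof. by case: re; case: v => ? ?; case: w. Qed.

Lemma cpart_sum re (I : Type) (r : seq I) (Q : pred I) (F : I -> R[i]) :
  cpart re (\sum_(i <- r | Q i) F i) = \sum_(i <- r | Q i) cpart re (F i).
Proof.
elim/big_rec2: _ => [|i a b _ <-]; first by case: re.
by rewrite cpartD.
Qed.

Lemma cpartMr re (w : R[i]) (a : R) : cpart re (w * a%:C%C) = cpart re w * a.
Proof. by case: re; case: w => u v /=; ring. Qed.

Lemma normr_cpart re (w : R[i]) : `|cpart re w| <= normc w.
Proof. by case: re; rewrite ?normr_Re_le ?normr_Im_le. Qed.

(** This is the function f of the overview; the Boolean chooses the part, so that each estimate is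
    proved once. *)
Definition pst re (x : state) : R := cpart re (state_stieltjes z x).

Lemma pst_bound re x : `|pst re x| <= y^-1.
Proof. exact: le_trans (normr_cpart _ _) (state_stieltjes_bound hz x). Qed.

Lemma pst_lipschitz re x x' :
  `|pst re x - pst re x'| <= Num.sqrt (tri_norm2 (fun u => x u - x' u) / n%:R) / y ^+ 2.
Proof.
by rewrite -cpartB; apply: le_trans (normr_cpart _ _) (state_stieltjes_lipschitz hz _ _).
Qed.

Lemma pst_rank re (J : {set 'I_n}) x x' :
  (forall u, u \in lower_triangle n -> u.1 \notin J -> x u = x' u) ->
  `|pst re x - pst re x'| <= 4 * #|J|%:R / (n%:R * y).
Proof.
move=> h; rewrite -cpartB; apply: le_trans (normr_cpart _ _) _.
exact: state_stieltjes_rank.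
Qed.

Lemma pst_taylor re x : exists (a : 'I_n * 'I_n -> R)
    (q : 'I_n * 'I_n -> 'I_n * 'I_n -> R),
  forall h, let r := `|pst re (fun u => x u + h u) -
    (pst re x + \sum_(u in lower_triangle n) a u * h u
      + \sum_(u in lower_triangle n) \sum_(v in lower_triangle n)
          q u v * (h u * h v))| in
   r <= 2 / y ^+ 3 / n%:R * tri_norm2 h /\
   r <= (y ^+ 4)^-1 / n%:R * (tri_norm2 h * Num.sqrt (tri_norm2 h)).
Proof.
have [a [q hq]] := state_stieltjes_taylor hz x.
exists (fun u => cpart re (a u)), (fun u v => cpart re (q u v)) => h r.
suff rle : r <= normc (state_stieltjes z (fun u => x u + h u) -
    (state_stieltjes z x + \sum_(u in lower_triangle n) a u * (h u)%:C%C
      + \sum_(u in lower_triangle n) \sum_(v in lower_triangle n)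
          q u v * (h u * h v)%:C%C)).
  by have [h1 h2] := hq h; split; exact: le_trans rle _.
apply: le_trans (normr_cpart re _); rewrite cpartB !cpartD !cpart_sum.
rewrite le_eqVlt; apply/orP; left; apply/eqP; congr (`|_ - (_ + _ + _)|).
  by apply: eq_bigr => u _; rewrite cpartMr.
by apply: eq_bigr => u _; rewrite cpart_sum; apply: eq_bigr => v _; rewrite cpartMr.
Qed.

Lemma pst_measurable re : state_measurable (pst re).
Proof.
move=> d T Y mY.
have [h1 h2] := @cmeasurable_state_stieltjes R n z hz d T Y mY.
by case: re.
Qed.

End part_stieltjes.

(** * Almost sure concentration of the Stieltjes transform *)

(** The independence hypothesis speaks of nonempty index sets only, whereas the families cut out by
    blocks may be empty; their sigma-field is then trivial, hence independent of any other. *)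
Lemma trivial_sigma_field (I T : Type) (R : realType) (A : set I) (Y : I -> T -> R) E :
  (forall i, ~ A i) -> sigma_field A Y E -> E = set0 \/ E = setT.
Proof.
move=> A0; suff : sigma_field A Y `<=` [set F | F = set0 \/ F = setT] by apply.
apply: smallest_sub; last by move=> F [i /A0].
split; first by left.
  by move=> F [->|->]; rewrite ?setD0 ?setDv; [right|left].
move=> F hF; have [[k Fk]|nF] := pselect (exists k, F k = setT).
  by right; rewrite -subTset => w _; exists k => //; rewrite Fk.
left; rewrite -subset0 => w [k _ Fkw].
by case: (hF k) => [e|e]; [rewrite e in Fkw|case: nF; exists k].
Qed.

Lemma independent_trivial_l d (T : measurableType d) (R : realType) (P : probability T R)
    (F G : set (set T)) :
  (forall E, F E -> E = set0 \/ E = setT) -> independent_sigma_fields P F G.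
Proof.
move=> hF E E' /hF[->|->] _; first by rewrite set0I measure0 mul0e.
by rewrite setTI [X in (_ = X * _)%E]probability_setT mul1e.
Qed.

Lemma independent_trivial_r d (T : measurableType d) (R : realType) (P : probability T R)
    (F G : set (set T)) :
  (forall E, G E -> E = set0 \/ E = setT) -> independent_sigma_fields P F G.
Proof.
move=> hG E E' _ /hG[->|->]; first by rewrite setI0 measure0 mule0.
by rewrite setIT [X in (_ = _ * X)%E]probability_setT mule1.
Qed.

(** Quotient and residue together determine r, so S embeds in a q by w box. *)
Lemma card_residues (n m c q o w : nat) (S : {set 'I_n}) :
  (forall r : 'I_n, r \in S -> (c <= r %/ m < c + q)%N /\ (o <= r %% m < o + w)%N) ->
  (#|S| <= q * w)%N.
Proof.
move=> hS.
have [S0|/set0Pn[r0 r0S]] := eqVneq S finset.set0; first by rewrite S0 cards0.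
have [h1 h2] := hS _ r0S.
case: q => [|q] in hS h1 *; first by move: h1; rewrite addn0; case: leqP => //= /leq_trans h /h; rewrite ltnn.
case: w => [|w] in hS h2 *; first by move: h2; rewrite addn0; case: leqP => //= /leq_trans h /h; rewrite ltnn.
pose f (r : 'I_n) : 'I_q.+1 * 'I_w.+1 := (inord (r %/ m - c), inord (r %% m - o)).
have fI : {in S &, injective f}.
  move=> r s /hS[/andP[a1 a2] /andP[a3 a4]] /hS[/andP[b1 b2] /andP[b3 b4]] [e1 e2].
  apply: val_inj => /=; rewrite (divn_eq r m) (divn_eq s m).
  have {}e1 : (r %/ m - c = s %/ m - c)%N.
    by rewrite -(@inordK q (r %/ m - c)) ?e1 ?inordK //; lia.
  have {}e2 : (r %% m - o = s %% m - o)%N.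
    by rewrite -(@inordK w (r %% m - o)) ?e2 ?inordK //; lia.
  by rewrite -(subnK a1) -(subnK b1) e1 -(subnK a3) -(subnK b3) e2.
rewrite -(card_in_imset fI); apply: leq_trans (max_card _) _.
by rewrite card_prod !card_ord.
Qed.

Definition far_independent d (T : measurableType d) (R : realType) (P : probability T R)
    (n K : nat) (Y : 'I_n * 'I_n -> T -> R) : Prop :=
  forall A B : {set 'I_n * 'I_n}, A != finset.set0 -> B != finset.set0 ->
  A \subset lower_triangle n -> B \subset lower_triangle n ->
  (forall p q, p \in A -> q \in B -> (K < index_dist p q)%N) ->
  independent_sigma_fields P (sigma_field [set` A] Y) (sigma_field [set` B] Y).

Section far_apart.
Context d (T : measurableType d) (R : realType) (P : probability T R).
Variables (n K : nat) (Y : 'I_n * 'I_n -> T -> R).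
Hypothesis indY : far_independent P K Y.

Lemma independent_pred (a b : pred ('I_n * 'I_n)) :
  (forall p, a p -> p \in lower_triangle n) ->
  (forall p, b p -> p \in lower_triangle n) ->
  (forall p q, a p -> b q -> (K < index_dist p q)%N) ->
  independent_sigma_fields P (sigma_field [set p | a p] Y) (sigma_field [set p | b p] Y).
Proof.
move=> ta tb far.
pose A := [set p | a p]%SET; pose B := [set p | b p]%SET.
have eA : [set` A] = [set p | a p] by apply/seteqP; split=> p /=; rewrite inE.
have eB : [set` B] = [set p | b p] by apply/seteqP; split=> p /=; rewrite inE.
have [A0|nA] := eqVneq A finset.set0.
  apply: independent_trivial_l => E; apply: trivial_sigma_field => p ap.
  by move/setP/(_ p): A0; rewrite !inE; move: ap => /= ->.
have [B0|nB] := eqVneq B finset.set0.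
  apply: independent_trivial_r => E; apply: trivial_sigma_field => p bp.
  by move/setP/(_ p): B0; rewrite !inE; move: bp => /= ->.
rewrite -eA -eB; apply: indY => //.
- by apply/fintype.subsetP => p; rewrite inE => /ta.
- by apply/fintype.subsetP => p; rewrite inE => /tb.
- by move=> p q; rewrite !inE; exact: far.
Qed.

Lemma index_dist_row (p q : 'I_n * 'I_n) : (p.1 + K < q.1)%N -> (K < index_dist p q)%N.
Proof. by move=> h; rewrite /index_dist leq_max; apply/orP; left; lia. Qed.

End far_apart.

(** With period L + K, u is at most (b - 1)(L + K) + L - 1 and v is at least b (L + K): the K
    discarded positions ending the period of u separate them. *)
Lemma divn_gap (K L u v b : nat) : (u %% (L + K) < L)%N -> (u %/ (L + K) < b)%N ->
  (b <= v %/ (L + K))%N -> (u + K < v)%N.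
Proof.
set m := (L + K)%N => um ub vb.
have := divn_eq u m; have := divn_eq v m.
have h1 : ((u %/ m).+1 * m <= b * m)%N by rewrite leq_mul.
have h2 : (b * m <= v %/ m * m)%N by rewrite leq_mul.
rewrite mulSn in h1; rewrite {1}/m in h1; lia.
Qed.

Section row_concentration.
Context d (T : measurableType d) (R : realType) (P : probability T R).
Variables (n K L : nat) (Y : 'I_n * 'I_n -> T -> R) (z : R[i]) (re : bool).
Hypothesis mY : forall p, measurable_fun setT (Y p).
Hypothesis indY : far_independent P K Y.
Hypothesis hz : 0 < complex.Im z.
Hypothesis n0 : (0 < n)%N.
Hypothesis L0 : (0 < L)%N.
Local Notation y := (complex.Im z).
Local Notation m := (L + K)%N.
Local Notation f := (pst z re).

Let kept (u : 'I_n * 'I_n) := (u \in lower_triangle n) && (u.1 %% m < L)%N.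
Let row_block (u : 'I_n * 'I_n) := (u.1 %/ m)%N.

Let row_blocks_independent b : independent_sigma_fields P
  (sigma_field [set i | below kept row_block b i] Y)
  (sigma_field [set i | level kept row_block b i] Y).
Proof.
apply: (independent_pred indY).
- by move=> p /andP[/andP[]].
- by move=> p /andP[/andP[]].
- move=> p q /andP[/andP[_ h1] h2] /andP[_ /eqP h3].
  by apply: index_dist_row; apply: divn_gap h1 h2 _; rewrite -h3.
Qed.

(** [c] bounds the effect on f of changing one block of L rows, and [defect] that of zeroing the
    separating rows, of which there are at most K (n / m + 1). *)
Let c : R := 4 * L%:R / (n%:R * y).
Let defect : R := 4 * K%:R / y * (m%:R^-1 + n%:R^-1).

Let kept_close x : `|f x - f (restr (below kept row_block n) x)| <= defect.
Proof.
pose J := [set r : 'I_n | (L <= r %% m)%N]%SET.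
apply: le_trans (pst_rank hz (J := J) _ _) _.
  move=> u ut; rewrite inE -ltnNge => uL.
  (* A block number is at most the row index, hence below n: the bound n in [below] discards no
     block. *)
  rewrite /restr /below /kept ut uL /= ifT //.
  by apply: leq_ltn_trans (ltn_ord u.1); exact: leq_div.
have hJ : (#|J| <= (n %/ m).+1 * K)%N.
  apply: (@card_residues n m 0 (n %/ m).+1 L K) => r; rewrite inE => h.
  rewrite h leq0n add0n ltnS leq_div2r ?(ltnW (ltn_ord r)) //=; split=> //.
  by rewrite ltn_pmod // addn_gt0 L0.
rewrite /defect.
have -> : 4 * K%:R / y * (m%:R^-1 + n%:R^-1) =
    4 * (K%:R * (n%:R / m%:R + 1)) / (n%:R * y) :> R.
  have nn : (n%:R : R) != 0 by rewrite pnatr_eq0 -lt0n.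
  have mm : (m%:R : R) != 0 by rewrite pnatr_eq0 -lt0n addn_gt0 L0.
  by move: (n%:R : R) (m%:R : R) (K%:R : R) nn mm => a b k a0 b0; field; rewrite a0 b0 gt_eqF.
rewrite ler_wpM2r ?invr_ge0 ?mulr_ge0 ?(ltW hz) // ler_wpM2l //.
have : (#|J|%:R : R) <= ((n %/ m).+1 * K)%:R by rewrite ler_nat.
move/le_trans; apply; rewrite natrM mulrC ler_wpM2l // -natr1 lerD2r.
rewrite ler_pdivlMr ?ltr0n ?addn_gt0 ?L0 // -natrM ler_nat.
exact: leq_trunc_div.
Qed.

(** The defect is paid twice, once for f and once for its mean. The exponent n is a crude bound on
    the number of blocks; it is harmless because [c] is of order 1 / n. *)
Lemma pst_tail (lam t : R) : 0 < lam -> lam * c <= 2^-1 ->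
  (P [set w | (t + 2 * defect <= `|f (Y ^~ w) - \int[P]_w' f (Y ^~ w')|)%R] <=
   (2 * expR (- (lam * t)) * (1 + 2 * (lam * c) ^+ 2) ^+ n)%:E)%E.
Proof.
move=> l0 lc.
have c0 : 0 <= c by rewrite divr_ge0 ?mulr_ge0 ?(ltW hz).
have key : (P [set w | (t <= `|f (restr (below kept row_block n) (Y ^~ w)) -
      \int[P]_w' f (restr (below kept row_block n) (Y ^~ w'))|)%R] <=
    (2 * expR (- (lam * t)) * (1 + 2 * (lam * c) ^+ 2) ^+ n)%:E)%E.
  apply: (bounded_difference_tail mY (@row_blocks_independent) t l0 c0 lc
    (@pst_measurable _ _ _ hz re) (@pst_bound _ _ _ hz re)) => k W x x' kn.
  pose J := [set r : 'I_n | (r %/ m == k)%N && (r %% m < L)%N]%SET.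
  apply: le_trans (pst_rank hz (J := J) _ _) _.
    move=> u ut; rewrite inE negb_and => uJ; congr (_ + _).
    rewrite /restr /level /kept /row_block ut /=.
    by case/orP: uJ => /negbTE ->; rewrite ?andbF.
  rewrite /c ler_wpM2r ?invr_ge0 ?mulr_ge0 ?(ltW hz) // ler_wpM2l // ler_nat.
  rewrite -[X in (_ <= X)%N]mul1n.
  apply: (@card_residues n m k 1 0 L) => r; rewrite inE => /andP[/eqP -> ->].
  by rewrite leqnn addn1 ltnSn.
have fm : measurable_fun setT (fun w => f (Y ^~ w)).
  exact: (@pst_measurable _ _ _ hz re).
have mf' : measurable_fun setT (fun w => f (restr (below kept row_block n) (Y ^~ w))).
  by apply: (@pst_measurable _ _ _ hz re) => i; exact: measurable_restr.
apply: le_trans key; apply: le_measure; rewrite ?inE.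
- by apply: measurable_norm_ge; apply: measurable_funB.
- by apply: measurable_norm_ge; apply: measurable_funB.
move=> w /= hw.
have i1 : P.-integrable setT (EFin \o (fun w => f (Y ^~ w))).
  by apply: (@bounded_integrable _ _ _ _ _ y^-1) => // w'; exact: pst_bound.
have i2 : P.-integrable setT (EFin \o (fun w => f (restr (below kept row_block n) (Y ^~ w)))).
  by apply: (@bounded_integrable _ _ _ _ _ y^-1) => // w'; exact: pst_bound.
have d1 := kept_close (Y ^~ w).
have d2 : `|\int[P]_w' f (Y ^~ w') -
            \int[P]_w' f (restr (below kept row_block n) (Y ^~ w'))| <= defect.
  rewrite -RintegralB //; apply: Rintegral_norm_le; first exact: integrable_EFinB.
  by move=> w'; exact: kept_close.
move: hw d1 d2.
move: (f (Y ^~ w)) (f (restr _ _)) (\int[P]_w' f (Y ^~ w')) (\int[P]_w' _) => a b e g.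
by rewrite !ler_norml => hw /andP[? ?] /andP[? ?]; move: hw; rewrite !ler_normr => /orP[] ?; apply/orP; [left|right]; lra.
Qed.

End row_concentration.

Lemma archi_inv (R : realType) (e : R) : 0 < e -> exists N : nat,
  forall n : nat, (N <= n)%N -> (0 < n)%N /\ n%:R^-1 <= e.
Proof.
move=> e0; exists (Num.bound e^-1).+1 => n hn.
have n0 : (0 < n)%N by apply: leq_trans hn.
split=> //; rewrite -[leRHS]invrK lef_pV2 ?posrE ?invr_gt0 ?ltr0n //.
apply: ltW; apply: lt_le_trans (archi_boundP _) _; first by rewrite invr_ge0 ltW.
by rewrite ler_nat ltnW.
Qed.

Lemma pst_ae_concentration d (T : measurableType d) (R : realType) (P : probability T R)
    (Y : forall n, 'I_n * 'I_n -> T -> R) (K : nat) (z : R[i]) (re : bool) :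
  (forall n p, measurable_fun setT (@Y n p)) ->
  (forall n, (0 < n)%N -> far_independent P K (@Y n)) ->
  0 < complex.Im z ->
  {ae P, forall w, (fun n => pst z re ((@Y n) ^~ w) -
     \int[P]_w' pst z re ((@Y n) ^~ w')) @ \oo --> (0 : R)}.
Proof.
move=> mY ind hz; set y := complex.Im z in hz *.
have mpst n : measurable_fun setT (fun w => pst z re ((@Y n) ^~ w)).
  exact: (@pst_measurable _ _ _ hz re).
apply: ae_cvg0_geometric => [n|eps e0]; first exact: measurable_funB.
(* The budget is t for the martingale tail and at most 2 t for twice the defect, so 3 t in all. *)
pose t := eps / 4; have t0 : 0 < t by rewrite divr_gt0.
(* Once 1 / (L + K) and 1 / n are below [e1], each contributes at most t to twice the defect; K + 1
   keeps the divisor positive for K = 0. *)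
pose e1 := t / (8 * (K%:R + 1) / y).
have k0 : 0 < 8 * (K%:R + 1) / y :> R.
  by rewrite divr_gt0 // mulr_gt0 // ltr_wpDl.
have e10 : 0 < e1 by rewrite divr_gt0.
have [N hN] := archi_inv e10.
pose L := N.+1.
pose c := 4 * L%:R / y.
have c0 : 0 < c by rewrite divr_gt0 // mulr_gt0.
(* The first bound gives s c <= 1/2, as the exponential estimate requires; the second gives 2 (s
   c)^2 <= s t / 2. *)
pose s := Num.min (2 * c)^-1 (t / (4 * c ^+ 2)).
have s0 : 0 < s.
  by rewrite lt_min invr_gt0 mulr_gt0 //= divr_gt0 // mulr_gt0 // exprn_gt0.
have s1 : s * c <= 2^-1.
  have h : s <= (2 * c)^-1 by rewrite ge_min lexx.
  have -> : 2^-1 = (2 * c)^-1 * c by rewrite invfM mulfVK // gt_eqF.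
  by rewrite ler_pM2r.
have s2 : 2 * (s * c) ^+ 2 < s * t.
  have h : s <= t / (4 * c ^+ 2) by rewrite ge_min lexx orbT.
  have c2 : 0 < 4 * c ^+ 2 by rewrite mulr_gt0 // exprn_gt0.
  rewrite ler_pdivlMr // in h.
  have -> : 2 * (s * c) ^+ 2 = s * (2^-1 * (s * (4 * c ^+ 2))) by field.
  by rewrite ltr_pM2l //; lra.
(* With lam = s n, the product of lam and the block increment is s c, free of n, so the tail bound
   is geometric. Its ratio is below 1 because 1 + 2 (s c)^2 < 1 + s t <= exp(s t). *)
exists N.+1, 2, (expR (- (s * t)) * (1 + 2 * (s * c) ^+ 2)).
have q0 : 0 <= 1 + 2 * (s * c) ^+ 2 by rewrite addr_ge0 // mulr_ge0 // sqr_ge0.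
split.
- by rewrite mulr_ge0 // expR_ge0.
- rewrite expRN mulrC ltr_pdivrMr ?expR_gt0 // mul1r.
  by apply: lt_le_trans (expR_ge1Dx _); rewrite ltrD2l.
move=> n nN; have [n0 ninv] := hN n (ltnW nN).
have nR : 0 < (n%:R : R) by rewrite ltr0n.
have lam0 : 0 < s * n%:R by rewrite mulr_gt0.
have lc : s * n%:R * (4 * L%:R / (n%:R * y)) = s * c.
  rewrite /c; move: (L%:R : R) => l.
  by field; rewrite !gt_eqF.
have := @pst_tail _ _ _ P n K L (@Y n) z re (@mY n)
   (ind n n0) hz n0 (ltn0Sn N) (s * n%:R) t lam0.
rewrite lc => /(_ s1).
have -> : 2 * expR (- (s * n%:R * t)) * (1 + 2 * (s * c) ^+ 2) ^+ n =
   2 * (expR (- (s * t)) * (1 + 2 * (s * c) ^+ 2)) ^+ n.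
  rewrite -[LHS]mulrA [in RHS]exprMn -expRM_natl; congr (2 * (expR _ * _)).
  ring.
apply: le_trans; apply: le_measure; rewrite ?inE.
- by apply: measurable_norm_ge; exact: measurable_funB.
- by apply: measurable_norm_ge; exact: measurable_funB.
move=> w /=; apply: le_trans.
have mL : (L + K)%:R^-1 <= e1.
  by have [] := hN (L + K)%N _; rewrite // /L addSn ltnW // ltnS leq_addr.
have : 2 * (4 * K%:R / y * ((L + K)%:R^-1 + n%:R^-1)) <=
     8 * (K%:R + 1) / y * (e1 + e1).
  rewrite mulrA; apply: ler_pM.
  - by rewrite mulr_ge0 // divr_ge0 ?(ltW hz) // mulr_ge0.
  - by rewrite addr_ge0.
  - have -> : 2 * (4 * K%:R / y) = 8 * K%:R / y by rewrite !mulrA; congr (_ * _ / _); ring.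
    by rewrite ler_wpM2r ?invr_ge0 ?(ltW hz) // ler_wpM2l // lerDl.
  - exact: lerD.
have -> : 8 * (K%:R + 1) / y * (e1 + e1) = t + t.
  by rewrite mulrDr /e1 [_ * (t / _)]mulrC divfK // gt_eqF.
by rewrite /t => ?; lra.
Qed.

(** * Laws determined by trigonometric integrals *)

Lemma cos_sub1_le (R : realType) (x : R) : 0 <= x -> `|cos x - 1| <= x.
Proof.
rewrite le_eqVlt => /predU1P[<-|x0]; first by rewrite cos0 subrr normr0.
have [|d dx e] := MVT (f := @cos R) (df := fun t => - sin t) x0.
  by apply: continuous_subspaceT; exact: continuous_cos.
rewrite cos0 subr0 in e; rewrite e.
by rewrite normrM normrN (gtr0_norm x0) ger_pMl // sin_max.
Qed.

Lemma sin_sub_le (R : realType) (x : R) : `|sin x - x| <= x ^+ 2.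
Proof.
wlog x0 : x / 0 < x => [h|].
  have [|x0|<-] := ltgtP 0 x; first exact: h.
    by have := h (- x); rewrite sinN -opprD normrN sqrrN oppr_gt0; apply.
  by rewrite sin0 subrr normr0 expr0n.
have [|c cx e] := MVT (f := @sin R) (df := @cos R) x0.
  by apply: continuous_subspaceT; exact: continuous_sin.
rewrite sin0 !subr0 in e; rewrite e.
move: cx; rewrite in_itv /= => /andP[c0 cx].
rewrite -{2}[x]mul1r -mulrBl normrM (gtr0_norm x0) expr2 ler_pM2r //.
exact: le_trans (cos_sub1_le (ltW c0)) (ltW cx).
Qed.

(** * Bernstein averages and their deviation *)

Section bernstein.
Variable R : realType.
Implicit Types (p : R) (phi : nat -> R) (m : nat).

(* The Bernstein average [\sum_(j <= m) 'C(m, j) p^j (1-p)^(m-j) phi j], by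
   recursion on the number of coin flips. *)
Fixpoint bern m p phi : R :=
  if m is k.+1 then (1 - p) * bern k p phi + p * bern k p (phi \o S) else phi 0%N.

Lemma bern_cst m p (a : R) : bern m p (fun=> a) = a.
Proof. by elim: m => //= m ih; rewrite -[_ \o S]/(fun=> a) ih; ring. Qed.

Lemma bern_lin m p (a : R) phi psi :
  bern m p (fun j => a * phi j + psi j) = a * bern m p phi + bern m p psi.
Proof.
elim: m phi psi => //= m ih phi psi.
by rewrite ih -[_ \o S]/(fun j => a * (phi \o S) j + (psi \o S) j) ih; ring.
Qed.

Lemma bern_le m p phi psi : 0 <= p <= 1 -> (forall j, phi j <= psi j) ->
  bern m p phi <= bern m p psi.
Proof.
move=> /andP[p0 p1]; elim: m phi psi => //= m ih phi psi h.
by rewrite lerD // ler_wpM2l ?subr_ge0 //; apply: ih => // j; exact: h.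
Qed.

(** The second moment of a binomial variable about -s. The shift is left free for the induction,
    since a successful flip replaces s by s + 1. *)
Lemma bern_var m p (s : R) :
  bern m p (fun j => (j%:R + s) ^+ 2) = (m%:R * p + s) ^+ 2 + m%:R * (p * (1 - p)).
Proof.
elim: m s => [|m ih] s /=; first by rewrite !mul0r addr0.
have -> : (fun j : nat => (j%:R + s) ^+ 2) \o S = (fun j => (j%:R + (s + 1)) ^+ 2).
  by apply/funext => j /=; rewrite -natr1 addrAC addrA.
by rewrite !ih -natr1; ring.
Qed.

(** The absolute value is linearised by |t| <= (del + t^2 / del) / 2, which leaves only the binomial
    variance p (1 - p) / m <= del^2. *)
Lemma bern_dev m p (del : R) phi (a c : R) : 0 <= p <= 1 -> 0 < del -> (0 < m)%N ->
  0 <= c -> m%:R^-1 <= del ^+ 2 ->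
  (forall j, `|phi j - a| <= c * `|j%:R / m%:R - p|) ->
  `|bern m p phi - a| <= c * del.
Proof.
move=> p01 d0 m0 c0 md h.
have mR : 0 < (m%:R : R) by rewrite ltr0n.
have bnd j : `|phi j - a| <= c / 2 * (del + (j%:R / m%:R - p) ^+ 2 / del).
  apply: le_trans (h j) _; rewrite -mulrA ler_wpM2l //.
  set t := j%:R / m%:R - p; rewrite -real_normK ?num_real //.
  move: (`|t|) => u.
  have -> : 2^-1 * (del + u ^+ 2 / del) = u + (u - del) ^+ 2 / (2 * del).
    by field; rewrite gt_eqF.
  by rewrite lerDl divr_ge0 ?sqr_ge0 // mulr_ge0 // ltW.
have eT : bern m p (fun j => c / 2 * (del + (j%:R / m%:R - p) ^+ 2 / del)) =
    c / 2 * (del + m%:R^-1 * (p * (1 - p)) / del).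
  have -> : (fun j : nat => c / 2 * (del + (j%:R / m%:R - p) ^+ 2 / del)) =
     (fun j => c / (2 * del * m%:R ^+ 2) * (j%:R - m%:R * p) ^+ 2 + c / 2 * del).
    by apply/funext => j; field; rewrite !gt_eqF.
  rewrite bern_lin bern_cst bern_var subrr expr0n add0r.
  by field; rewrite !gt_eqF.
have Tle : c / 2 * (del + m%:R^-1 * (p * (1 - p)) / del) <= c * del.
  have -> : c * del = c / 2 * (del + del ^+ 2 / del) by field; rewrite gt_eqF.
  rewrite ler_wpM2l ?divr_ge0 // lerD2l ler_pM2r ?invr_gt0 //.
  apply: le_trans md; rewrite ler_piMr ?invr_ge0 //.
  by case/andP: p01 => ? ?; nra.
rewrite ler_norml; apply/andP; split.
  rewrite lerBrDr; apply: (@le_trans _ _ (bern m p (fun j =>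
     -1 * (c / 2 * (del + (j%:R / m%:R - p) ^+ 2 / del)) + a))).
    by rewrite bern_lin bern_cst eT; lra.
  apply: bern_le => // j; have := bnd j; rewrite ler_norml => /andP[? ?]; lra.
rewrite lerBlDr; apply: (@le_trans _ _ (bern m p (fun j =>
   1 * (c / 2 * (del + (j%:R / m%:R - p) ^+ 2 / del)) + a))).
  apply: bern_le => // j; have := bnd j; rewrite ler_norml => /andP[? ?]; lra.
by rewrite bern_lin bern_cst eT; lra.
Qed.

End bernstein.

(** * Equality of laws from trigonometric integrals *)

Section same_law.
Context d1 d2 (T1 : measurableType d1) (T2 : measurableType d2) (R : realType).
Variables (P1 : probability T1 R) (P2 : probability T2 R) (I : finType).
Variables (U : T1 -> I -> R) (V : T2 -> I -> R).
Hypothesis mU : forall i, measurable_fun setT (fun w => U w i).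
Hypothesis mV : forall i, measurable_fun setT (fun w => V w i).
Hypothesis cosUV : forall (c : I -> R) (th : R),
  \int[P1]_w cos (\sum_i c i * U w i + th) = \int[P2]_w cos (\sum_i c i * V w i + th).

Let wave (c : I -> R) (th : R) (x : I -> R) := cos (\sum_i c i * x i + th).

(* The bounded functions that cannot distinguish the two laws, even after
   multiplication by a wave, form an algebra closed under uniform limits. *)
Definition undetected (Q : (I -> R) -> R) := [/\ state_measurable Q,
  exists B, forall x, `|Q x| <= B &
  forall c th, \int[P1]_w (Q (U w) * wave c th (U w)) =
               \int[P2]_w (Q (V w) * wave c th (V w))].

Let measurable_wave c th : state_measurable (wave c th).
Proof.
move=> d T Y mY; apply: (measurableT_comp (f := @cos R)).
  by apply: continuous_measurable_fun; exact: continuous_cos.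
apply: measurable_funD => //; apply: measurable_sum => i; exact: measurable_funM.
Qed.

Let wave_bound c th x : `|wave c th x| <= 1.
Proof. exact: cos_max. Qed.

Let wave_integrable d (T : measurableType d) (P : probability T R) (Y : T -> I -> R)
    (Q : (I -> R) -> R) c th B :
  (forall i, measurable_fun setT (fun w => Y w i)) ->
  state_measurable Q -> (forall x, `|Q x| <= B) ->
  P.-integrable setT (EFin \o (fun w => Q (Y w) * wave c th (Y w))).
Proof.
move=> mY mQ bQ; apply: (@bounded_integrable _ _ _ _ _ B).
  by apply: measurable_funM; [exact: mQ|exact: measurable_wave].
move=> w; rewrite normrM -[leRHS]mulr1; apply: ler_pM => //; exact: wave_bound.
Qed.

Lemma undetected_cst a : undetected (fun=> a).
Proof.
split; first by move=> *; exact: measurable_cst.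
  by exists `|a|.
have iw d (T : measurableType d) (P : probability T R) (Y : T -> I -> R) c th :
    (forall i, measurable_fun setT (fun w => Y w i)) ->
    P.-integrable setT (EFin \o (fun w => wave c th (Y w))).
  move=> mY; apply: (@bounded_integrable _ _ _ _ _ 1); first exact: measurable_wave.
  by move=> w; exact: wave_bound.
by move=> c th; rewrite !RintegralZl //; [congr (_ * _); exact: cosUV|exact: iw|exact: iw].
Qed.

Lemma undetectedD Q Q' : undetected Q -> undetected Q' ->
  undetected (fun x => Q x + Q' x).
Proof.
move=> [mQ [B bQ] eQ] [mQ' [B' bQ'] eQ']; split.
- by move=> d T Y mY; apply: measurable_funD; [exact: mQ|exact: mQ'].
- by exists (B + B') => x; apply: le_trans (ler_normD _ _) _; exact: lerD.
move=> c th; under eq_Rintegral do rewrite mulrDl.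
under [RHS]eq_Rintegral do rewrite mulrDl.
by rewrite !RintegralD ?eQ ?eQ' //; apply: wave_integrable; eassumption.
Qed.

Lemma undetectedZ a Q : undetected Q -> undetected (fun x => a * Q x).
Proof.
move=> [mQ [B bQ] eQ]; split.
- by move=> d T Y mY; apply: measurable_funM => //; exact: mQ.
- by exists (`|a| * B) => x; rewrite normrM ler_wpM2l.
move=> c th; under eq_Rintegral do rewrite -mulrA.
under [RHS]eq_Rintegral do rewrite -mulrA.
by rewrite !RintegralZl ?eQ //; apply: wave_integrable; eassumption.
Qed.

(** A product of two cosines is half the sum of two cosines; the free phase in [wave] makes the
    waves closed under this rule and provides the sines. *)
Lemma undetected_wave c th Q : undetected Q -> undetected (fun x => wave c th x * Q x).
Proof.
move=> [mQ [B bQ] eQ]; split.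
- by move=> d T Y mY; apply: measurable_funM; [exact: measurable_wave|exact: mQ].
- exists B => x; rewrite normrM -[leRHS]mul1r; apply: ler_pM => //; exact: wave_bound.
move=> c' th'.
have prod x : wave c th x * Q x * wave c' th' x =
   2^-1 * (Q x * wave (fun i => c i + c' i) (th + th') x +
           Q x * wave (fun i => c i - c' i) (th - th') x).
  rewrite /wave.
  have -> : \sum_i (c i + c' i) * x i + (th + th') =
     (\sum_i c i * x i + th) + (\sum_i c' i * x i + th').
    by rewrite addrACA -big_split /=; congr (_ + _); apply: eq_bigr => i _; rewrite mulrDl.
  have -> : \sum_i (c i - c' i) * x i + (th - th') =
     (\sum_i c i * x i + th) - (\sum_i c' i * x i + th').
    rewrite opprD addrACA -sumrB; congr (_ + _).
    by apply: eq_bigr => i _; rewrite mulrBl.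
  move: (\sum_i c i * x i + th) (\sum_i c' i * x i + th') => a b.
  by rewrite cosD cosB; field.
under eq_Rintegral do rewrite prod.
under [RHS]eq_Rintegral do rewrite prod.
have iQ d (T : measurableType d) (P : probability T R) (Y : T -> I -> R) c1 t1 :
    (forall i, measurable_fun setT (fun w => Y w i)) ->
    P.-integrable setT (EFin \o (fun w => Q (Y w) * wave c1 t1 (Y w))).
  by move=> mY; apply: wave_integrable; eassumption.
rewrite !RintegralZl //; try (by apply: integrable_EFinD; exact: iQ).
by rewrite !RintegralD ?eQ //; exact: iQ.
Qed.

Lemma undetected_limit Q : state_measurable Q ->
  (forall e, 0 < e -> exists2 Q', undetected Q' & forall x, `|Q x - Q' x| <= e) ->
  undetected Q.
Proof.
move=> mQ hQ.
have bQ : exists B, forall x, `|Q x| <= B.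
  have [Q' [_ [B bB] _] h] := hQ 1 ltr01; exists (1 + B) => x.
  rewrite -[Q x](subrK (Q' x)); apply: le_trans (ler_normD _ _) _.
  exact: lerD (h x) (bB x).
split=> // c th; have [B bB] := bQ.
apply/eqP; rewrite -subr_eq0 -normr_le0; apply/ler_addgt0Pl => e e0; rewrite addr0.
have [Q' [mQ' [B' bB'] eQ'] h] := hQ (e / 2) (divr_gt0 e0 (ltr0Sn _ 1)).
have close d (T : measurableType d) (P : probability T R) (Y : T -> I -> R) :
    (forall i, measurable_fun setT (fun w => Y w i)) ->
    `|\int[P]_w (Q (Y w) * wave c th (Y w)) - \int[P]_w (Q' (Y w) * wave c th (Y w))| <= e / 2.
  move=> mY.
  have i1 := @wave_integrable _ _ P Y Q c th B mY mQ bB.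
  have i2 := @wave_integrable _ _ P Y Q' c th B' mY mQ' bB'.
  rewrite -RintegralB //; apply: Rintegral_norm_le; first exact: integrable_EFinB.
  move=> w; rewrite -mulrBl normrM -[leRHS]mulr1; apply: ler_pM => //; exact: wave_bound.
have h1 := close _ _ P1 U mU; have h2 := close _ _ P2 V mV.
rewrite eQ' in h1; move: h1 h2; rewrite !ler_norml => /andP[? ?] /andP[? ?].
by apply/andP; split; lra.
Qed.

Lemma undetected_sin i (L : R) Q : undetected Q -> undetected (fun x => sin (x i / L) * Q x).
Proof.
move=> hQ; have := @undetected_wave (fun j => if j == i then L^-1 else 0) (- (pi / 2)) _ hQ.
rewrite (_ : (fun x => wave _ _ x * _) = (fun x => sin (x i / L) * Q x)) //.
apply/funext => x; congr (_ * _); rewrite /wave (bigD1 i) //= eqxx big1 ?addr0.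
  by rewrite cosB cos_pihalf sin_pihalf mulr0 add0r mulr1 mulrC.
by move=> j /negbTE ->; rewrite mul0r.
Qed.

(** With p = (1 + sin) / 2, one step of the recursion (1 - p) A + p B is (A + B) / 2 + sin (B - A) /
    2, which stays in the algebra. *)
Lemma undetected_bern i (L : R) m (Phi : nat -> (I -> R) -> R) :
  (forall j, undetected (Phi j)) ->
  undetected (fun x => bern m ((1 + sin (x i / L)) / 2) (Phi ^~ x)).
Proof.
elim: m Phi => [|m ih] Phi hPhi /=; first exact: hPhi.
pose A x := bern m ((1 + sin (x i / L)) / 2) (Phi ^~ x).
pose B x := bern m ((1 + sin (x i / L)) / 2) ((fun j => Phi j.+1) ^~ x).
have hA : undetected A := ih Phi hPhi.
have hB : undetected B := ih (fun j => Phi j.+1) (fun j => hPhi j.+1).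
have -> : (fun x => (1 - (1 + sin (x i / L)) / 2) * bern m ((1 + sin (x i / L)) / 2) (Phi ^~ x) +
     (1 + sin (x i / L)) / 2 * bern m ((1 + sin (x i / L)) / 2) ((Phi ^~ x) \o S)) =
   (fun x => 2^-1 * (A x + B x) + 2^-1 * (sin (x i / L) * (B x + (-1) * A x))).
  by apply/funext => x; rewrite -[(Phi ^~ x) \o S]/((fun j => Phi j.+1) ^~ x) -/(A x) -/(B x); field.
apply: (undetectedD (Q := fun x => 2^-1 * (A x + B x))).
  exact: (undetectedZ 2^-1 (undetectedD hA hB)).
exact: (undetectedZ 2^-1 (undetected_sin i L (undetectedD hB (undetectedZ (-1) hA)))).
Qed.

Let upd (x : I -> R) (i : I) (a : R) : I -> R := fun j => if j == i then a else x j.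

Let sinL (L : R) (x : I -> R) : I -> R := fun i => L * sin (x i / L).

Let measurable_sinL L d (T : measurableType d) (Y : T -> I -> R) i :
  (forall i, measurable_fun setT (fun w => Y w i)) ->
  measurable_fun setT (fun w => sinL L (Y w) i).
Proof.
move=> mY; apply: measurable_funM => //; apply: (measurableT_comp (f := @sin R)).
  by apply: continuous_measurable_fun; exact: continuous_sin.
exact: measurable_funM.
Qed.

(** Induction on the list of coordinates on which F depends. The Bernstein average in coordinate i
    only evaluates F with that coordinate frozen at a node, so i leaves the list. *)
Lemma undetected_lipschitz (L : R) (s : seq I) (F : (I -> R) -> R) (lip B : R) :
  0 < L -> 0 <= lip ->
  state_measurable F -> (forall x, `|F x| <= B) ->
  (forall x x', `|F x - F x'| <= lip * \sum_i `|x i - x' i|) ->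
  (forall x x', (forall i, i \in s -> x i = x' i) -> F x = F x') ->
  undetected (fun x => F (sinL L x)).
Proof.
move=> L0 l0; elim: s F => [|i s ih] F mF bF lF dF.
  rewrite (_ : (fun x => _) = (fun=> F (fun=> 0))); first exact: undetected_cst.
  by apply/funext => x; exact: dF.
apply: undetected_limit.
  by move=> d T Y mY; apply: (mF _ _ (fun w => sinL L (Y w))) => k; exact: measurable_sinL.
move=> e e0.
(* The Bernstein error is 2 lip L del; the added 1 keeps the divisor positive when [lip] is 0. *)
pose C := 2 * lip * L + 1.
have C0 : 0 < C by rewrite ltr_wpDl // mulr_ge0 ?mulr_ge0 // ltW.
pose del := e / C; have del0 : 0 < del by rewrite divr_gt0.
have [N hN] := archi_inv (exprn_gt0 2 del0).
have [m0 mdel] := hN N.+1 (leqnSn N); set m := N.+1 in m0 mdel.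
(* A uniform grid on [-L, L], matched with the weight p = (1 + sin) / 2, for which L (2 p - 1) = L
   sin. *)
pose node (j : nat) : R := L * (2 * (j%:R / m%:R) - 1).
pose Phi (j : nat) (x : I -> R) := F (upd (sinL L x) i (node j)).
exists (fun x => bern m ((1 + sin (x i / L)) / 2) (Phi ^~ x)).
  apply: undetected_bern => j.
  apply: (ih (fun x => F (upd x i (node j)))) => //.
  - move=> d T Y mY; apply: (mF _ _ (fun w => upd (Y w) i (node j))) => k.
    by rewrite /upd; case: eqP.
  - move=> x x'; apply: le_trans (lF _ _) _; rewrite ler_wpM2l //.
    apply: ler_sum => k _; rewrite /upd; case: eqP => // _.
    by rewrite subrr normr0.
  - move=> x x' h; apply: dF => k; rewrite inE /upd; case: eqP => //= _.
    exact: h.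
move=> x; rewrite distrC.
have p01 : 0 <= (1 + sin (x i / L)) / 2 <= 1.
  by have := sin_geN1 (x i / L); have := sin_le1 (x i / L) => ? ?; apply/andP; split; lra.
apply: (@le_trans _ _ (2 * lip * L * del)); last first.
  rewrite /del mulrA ler_pdivrMr // mulrC ler_wpM2l ?(ltW e0) // /C lerDl //.
apply: bern_dev => //; first by rewrite mulr_ge0 ?mulr_ge0 // ltW.
move=> j; apply: le_trans (lF _ _) _.
rewrite (bigD1 i) //= big1 ?addr0; last first.
  by move=> k /negbTE ki; rewrite /upd ki subrr normr0.
rewrite {1}/upd eqxx /node /sinL -mulrBr normrM (gtr0_norm L0).
have -> : 2 * (j%:R / m%:R) - 1 - sin (x i / L) =
   2 * (j%:R / m%:R - (1 + sin (x i / L)) / 2).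
  by move: (j%:R / m%:R : R) (sin _) => t u; field.
rewrite normrM (ger0_norm (ler0n _ 2)).
by rewrite le_eqVlt; apply/orP; left; apply/eqP; ring.
Qed.

(* Evaluating [F] at [L * sin (x_i / L)] makes it a continuous function of
   bounded coordinates, hence a limit of polynomials in the [sin (x_i / L)],
   which are combinations of waves; then [L] tends to infinity. *)
Lemma same_law_lipschitz (F : (I -> R) -> R) (lip B : R) :
  0 <= lip -> state_measurable F -> (forall x, `|F x| <= B) ->
  (forall x x', `|F x - F x'| <= lip * \sum_i `|x i - x' i|) ->
  \int[P1]_w F (U w) = \int[P2]_w F (V w).
Proof.
move=> l0 mF bF lF.
have eqL (k : nat) : \int[P1]_w F (sinL k.+1%:R (U w)) = \int[P2]_w F (sinL k.+1%:R (V w)).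
  have [_ _ /(_ (fun=> 0) 0)] : undetected (fun x => F (sinL k.+1%:R x)).
    apply: (@undetected_lipschitz _ (enum I) F lip B) => // x x' h.
    by congr F; apply/funext => i; apply: h; rewrite mem_enum.
  have w1 x : wave (fun=> 0) 0 x = 1.
    by rewrite /wave big1 ?addr0 ?cos0 // => i _; rewrite mul0r.
  under eq_Rintegral do rewrite w1 mulr1.
  by under [RHS]eq_Rintegral do rewrite w1 mulr1.
have cvgL d (T : measurableType d) (P : probability T R) (Y : T -> I -> R) :
    (forall i, measurable_fun setT (fun w => Y w i)) ->
    (fun k : nat => \int[P]_w F (sinL k.+1%:R (Y w))) @ \oo --> \int[P]_w F (Y w).
  move=> mY.
  have iF : P.-integrable setT (EFin \o (fun w => F (Y w))).
    by apply: (@bounded_integrable _ _ _ _ _ B) => //; exact: mF.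
  have mS k : measurable_fun setT (fun w => F (sinL k.+1%:R (Y w))).
    by apply: (mF _ _ (fun w => sinL k.+1%:R (Y w))) => i; exact: measurable_sinL.
  apply: fine_cvg.
  rewrite EFin_Rintegral //.
  apply: (@dominated_cvg _ _ _ P setT measurableT
     (fun k w => (F (sinL k.+1%:R (Y w)))%:E) (fun w => (F (Y w))%:E) (fun=> B%:E)) => //.
  - by move=> k; exact/measurable_EFinP.
  - move=> w _; apply: cvg_EFin; first exact: nearW.
    apply/cvgrPdist_le => e e0.
    (* From |sin t - t| <= t^2 with t = x / k, the error |k sin(x / k) - x| is at most x^2 / k. *)
    pose S2 := \sum_i (Y w i) ^+ 2.
    have S20 : 0 <= S2 by rewrite sumr_ge0 // => i _; exact: sqr_ge0.
    have C0 : 0 < lip * S2 + 1 by rewrite ltr_wpDl // mulr_ge0.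
    have [N hN] := archi_inv (divr_gt0 e0 C0).
    exists N => // k /= Nk; have [_ kle] := hN k.+1 (leqW Nk).
    rewrite /=; apply: le_trans (lF _ _) _.
    apply: (@le_trans _ _ (lip * (S2 / k.+1%:R))).
      rewrite ler_wpM2l // /S2 mulr_suml; apply: ler_sum => i _.
      rewrite distrC /sinL.
      have k0 : 0 < (k.+1%:R : R) by rewrite ltr0n.
      have -> : k.+1%:R * sin (Y w i / k.+1%:R) - Y w i =
         k.+1%:R * (sin (Y w i / k.+1%:R) - Y w i / k.+1%:R).
        by rewrite mulrBr [_ * (_ / _)]mulrC divfK // gt_eqF.
      rewrite normrM (gtr0_norm k0).
      apply: le_trans (ler_wpM2l (ltW k0) (sin_sub_le _)) _.
      by rewrite le_eqVlt; apply/orP; left; apply/eqP; field; rewrite gt_eqF.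
    apply: (@le_trans _ _ ((lip * S2 + 1) * (e / (lip * S2 + 1)))).
      rewrite mulrA; apply: ler_pM => //; first exact: mulr_ge0.
      by rewrite lerDl.
    by rewrite mulrC divfK // gt_eqF.
  - exact: integrable_EFin_cst.
  - by move=> k w _; rewrite lee_fin.
have h1 := cvgL _ _ P1 U mU; have h2 := cvgL _ _ P2 V mV.
have e12 : (fun k : nat => \int[P1]_w F (sinL k.+1%:R (U w))) =
           (fun k : nat => \int[P2]_w F (sinL k.+1%:R (V w))) by apply/funext.
rewrite e12 in h1.
exact: (cvg_unique _ h1 h2).
Qed.

End same_law.

(** * Gaussian variables *)

Section law_with_density.
Context d (T : measurableType d) (R : realType) (P : {measure set T -> \bar R}).
Local Notation mu := (@lebesgue_measure R).
Variables (Z : T -> R) (phi : R -> R).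
Hypothesis mZ : measurable_fun setT Z.
Hypothesis mphi : measurable_fun setT phi.
Hypothesis phi0 : forall x, 0 <= phi x.
Hypothesis lawZ : forall V : set R, measurable V ->
  P (Z @^-1` V) = (\int[mu]_(x in V) (phi x)%:E)%E.

Import HBNNSimple.

Let law_nnsfun (f : {nnsfun R >-> R}) :
  (\int[P]_w (f (Z w))%:E = \int[mu]_x ((f x)%:E * (phi x)%:E))%E.
Proof.
under eq_integral do rewrite fimfunE -fsumEFin//.
rewrite ge0_integral_fsum//; last 2 first.
- move=> r; apply/measurable_EFinP; apply: measurable_funM => //.
  have mr : measurable (f @^-1` [set r]) by [].
  by apply: (measurableT_comp _ mZ); exact: measurable_indic.
- by move=> r w _; rewrite EFinM nnfun_muleindic_ge0.
under [RHS]eq_integral do rewrite fimfunE -fsumEFin// muleC.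
under [RHS]eq_integral.
  move=> x _; rewrite ge0_mule_fsumr; last first.
    by move=> r; rewrite EFinM nnfun_muleindic_ge0.
  over.
rewrite ge0_integral_fsum//; last 2 first.
- move=> r; have mr : measurable (f @^-1` [set r]) by [].
  apply: emeasurable_funM; first exact/measurable_EFinP.
  by apply/measurable_EFinP; apply: measurable_funM => //; exact: measurable_indic.
- move=> r x _; apply: mule_ge0; first by rewrite lee_fin.
  by rewrite EFinM nnfun_muleindic_ge0.
apply: eq_fsbigr => r _.
have mr : measurable (f @^-1` [set r]) by [].
(* A negative r is not a value of the nonnegative simple function: its preimage is empty and both
   integrals vanish. *)
have [r0|r0] := ltP r 0.
  have -> : f @^-1` [set r] = set0.
    by rewrite -subset0 => x /= fx; have : 0 <= f x by []; rewrite fx leNgt r0.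
  rewrite !integral0_eq // => x _; rewrite indicE in_set0 mulr0 ?mule0 //.
under eq_integral do rewrite EFinM.
rewrite ge0_integralZl //; last first.
  apply/measurable_EFinP.
  by apply: (measurableT_comp _ mZ); exact: measurable_indic.
under [RHS]eq_integral do rewrite EFinM muleCA.
rewrite [RHS]ge0_integralZl //; first last.
- by move=> x _; rewrite mule_ge0 // lee_fin.
- by apply: emeasurable_funM; exact/measurable_EFinP.
congr (_ * _)%E.
rewrite (_ : (fun w => _) = (fun w => (\1_(Z @^-1` (f @^-1` [set r])) w)%:E)); last first.
  apply/funext => w; rewrite !indicE.
  suff -> : (Z w \in f @^-1` [set r]) = (w \in Z @^-1` (f @^-1` [set r])) by [].
  by apply/idP/idP; rewrite !inE.
rewrite integral_indic // ?setIT; last by rewrite -[X in measurable X]setTI; exact: mZ.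
rewrite lawZ // [LHS]integral_mkcond; apply: eq_integral => x _.
by rewrite patchE indicE; case: ifP; rewrite ?mule1 ?mule0.
Qed.

(** The formula for simple functions passes to g by monotone convergence on both sides. *)
Lemma ge0_integral_density (g : R -> R) : measurable_fun setT g -> (forall x, 0 <= g x) ->
  (\int[P]_w (g (Z w))%:E = \int[mu]_x (g x * phi x)%:E)%E.
Proof.
move=> mg g0.
have mEg : measurable_fun setT (EFin \o g) by exact/measurable_EFinP.
pose f_ := nnsfun_approx measurableT mEg.
have cf x : (f_ n x)%:E @[n --> \oo] --> (g x)%:E.
  by apply: cvg_nnsfun_approx => // y _; rewrite lee_fin.
have ndf x : {homo (fun n => f_ n x) : m n / (m <= n)%N >-> m <= n}.
  by move=> m n mn; exact/lefP/nd_nnsfun_approx.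
transitivity (lim (\int[P]_w (f_ n (Z w))%:E @[n --> \oo])%E).
  rewrite -monotone_convergence //=.
  - by apply: eq_integral => w _; apply/esym/cvg_lim => //; exact: cf.
  - by move=> n; apply/measurable_EFinP; apply: measurableT_comp.
  - by move=> n w _; rewrite lee_fin.
  - by move=> w _ m n mn; rewrite lee_fin; exact: ndf.
transitivity (lim (\int[mu]_x ((f_ n x)%:E * (phi x)%:E) @[n --> \oo])%E).
  by apply: congr_lim; apply/funext => n; exact: law_nnsfun.
rewrite -monotone_convergence //=.
- apply: eq_integral => x _; apply/cvg_lim => //.
  rewrite EFinM; apply: cvgeZr => //; exact: cf.
- move=> n; apply/measurable_EFinP; apply: measurable_funM => //.
  exact: (measurable_funPT (f_ n)).
- by move=> n w _; rewrite mule_ge0 // lee_fin.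
- by move=> w _ m n mn; rewrite lee_wpmul2r ?lee_fin // ndf.
Qed.

End law_with_density.

(** * Integrals against normal densities *)

Section normal_integrals.
Variable R : realType.
Local Notation mu := (@lebesgue_measure R).
Implicit Types (m s x y u : R) (g : R -> R).

Lemma normal_pdf_scale m s u : s != 0 ->
  normal_pdf m s (m + `|s| * u) * `|s| = normal_pdf 0 1 u.
Proof.
move=> s0; rewrite !normal_pdfE ?oner_eq0 // /normal_peak /normal_fun.
have sn : `|s| != 0 by rewrite normr_eq0.
have -> : (Num.sqrt (s ^+ 2 * pi *+ 2))^-1 = `|s|^-1 * (Num.sqrt (1 ^+ 2 * pi *+ 2))^-1.
  by rewrite expr1n mul1r -mulrnAr sqrtrM ?sqr_ge0 // sqrtr_sqr invfM.
have -> : - (m + `|s| * u - m) ^+ 2 / (s ^+ 2 *+ 2) = - (u - 0) ^+ 2 / (1 ^+ 2 *+ 2).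
  rewrite -(real_normK (num_real s)); field.
  by rewrite sn.
set b := (Num.sqrt _)^-1; set E := expR _; move: b E => b E.
by field.
Qed.

Lemma integral_normal_scale m s g : s != 0 -> continuous g -> (forall x, 0 <= g x) ->
  (\int[mu]_x (g x * normal_pdf m s x)%:E =
   \int[mu]_u (g (m + `|s| * u) * normal_pdf 0 1 u)%:E)%E.
Proof.
move=> s0 cg g0.
have sp : 0 < `|s| by rewrite normr_gt0.
pose F (u : R^o) : R^o := m + `|s| * u.
have dF : F^`()%classic = cst `|s|.
  apply/funext => u; rewrite /F derive1E deriveD // derive_cst add0r.
  by rewrite deriveM // derive_cst scaler0 addr0 derive_id /GRing.scale /= mulr1.
rewrite (@increasing_ge0_integration_by_substitutionT R F).
- apply: eq_integral => u _; congr (_%:E).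
  by rewrite dF !fctE /F /= -mulrA normal_pdf_scale.
- by move=> x y xy; rewrite /F ltrD2l ltr_pM2l.
- by rewrite dF => ?; exact: cvg_cst.
- by rewrite dF; exact: is_cvg_cst.
- by rewrite dF; exact: is_cvg_cst.
- by move=> x; apply: derivableD => //; exact: derivableM.
- apply: (@cvg_comp _ _ _ (fun u => `|s| * u) (fun u => m + u) _ -oo%R).
    exact: gt0_cvgMrNy.
  exact: cvg_addrl_Ny.
- apply: (@cvg_comp _ _ _ (fun u => `|s| * u) (fun u => m + u) _ +oo%R).
    exact: gt0_cvgMry.
  exact: cvg_addrl.
- move=> x; apply: cvgM; [exact: cg|exact: continuous_normal_pdf].
- by move=> x; rewrite mulr_ge0 // normal_pdf_ge0.
Qed.

Lemma measurable_mul_normal_pdf m s g : continuous g ->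
  measurable_fun setT (fun x => (g x * normal_pdf m s x)%:E).
Proof.
move=> cg; apply/measurable_EFinP; apply: measurable_funM.
  exact: continuous_measurable_fun.
exact: measurable_normal_pdf.
Qed.

Lemma integral_cst_normal_pdf m s x : 0 <= x ->
  (\int[mu]_u (x * normal_pdf m s u)%:E = x%:E)%E.
Proof.
move=> x0; under eq_integral do rewrite EFinM.
rewrite (@ge0_integralZl _ (measurableTypeR R)) //.
- by rewrite integral_normal_pdf mule1.
- by apply/measurable_EFinP; exact: measurable_normal_pdf.
- by move=> u _; rewrite lee_fin normal_pdf_ge0.
Qed.

(** Completing the square: the joint density is factored as the marginal of u times the conditional
    density of y given u. *)
Lemma normal_pdf_conv s1 s2 s u y : s1 != 0 -> s2 != 0 -> s != 0 ->
  s ^+ 2 = s1 ^+ 2 + s2 ^+ 2 ->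
  normal_pdf y s1 u * normal_pdf 0 s2 y =
  normal_pdf 0 s u * normal_pdf (u * s2 ^+ 2 / s ^+ 2) (s1 * s2 / s) y.
Proof.
move=> n1 n2 n e; have n3 : s1 * s2 / s != 0 by rewrite !mulf_neq0 // invr_neq0.
rewrite !normal_pdfE // /normal_peak /normal_fun mulrACA [RHS]mulrACA.
have h (a : R) : 0 <= a ^+ 2 * pi *+ 2 by rewrite mulrn_wge0 // mulr_ge0 ?sqr_ge0 ?pi_ge0.
rewrite -!expRD -!invfM -!sqrtrM ?h //.
congr (_^-1 * expR _).
  by congr Num.sqrt; field.
rewrite subr0 !mulNr -!opprD; congr (- _).
have -> : (s1 * s2 / s) ^+ 2 = s1 ^+ 2 * s2 ^+ 2 / s ^+ 2 by rewrite expr_div_n exprMn.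
have nv : s1 ^+ 2 + s2 ^+ 2 != 0 by rewrite -e expf_neq0.
rewrite e; field.
by rewrite nv n1 n2.
Qed.

(** After Tonelli's theorem, the conditional density of y in [normal_pdf_conv] integrates to one. *)
Lemma integral_normal_conv s1 s2 s g : s1 != 0 -> s2 != 0 ->
  s ^+ 2 = s1 ^+ 2 + s2 ^+ 2 -> continuous g -> (forall x, 0 <= g x) ->
  (\int[mu]_y ((\int[mu]_x (g x * normal_pdf y s1 x)%:E) * (normal_pdf 0 s2 y)%:E) =
   \int[mu]_x (g x * normal_pdf 0 s x)%:E)%E.
Proof.
move=> n1 n2 e cg g0.
have n : s != 0.
  by rewrite -sqrf_eq0 e gt_eqF // ltr_pwDl ?sqr_ge0 // exprn_even_gt0.
have mg : measurable_fun setT g by exact: continuous_measurable_fun.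
pose F (p : R * R) : \bar R := (g p.2 * normal_pdf p.1 s1 p.2 * normal_pdf 0 s2 p.1)%:E.
have mF : measurable_fun setT F.
  apply/measurable_EFinP; apply: measurable_funM; last first.
    exact: (measurableT_comp (measurable_normal_pdf 0 s2) measurable_fst).
  apply: measurable_funM; first exact: (measurableT_comp mg measurable_snd).
  under eq_fun do rewrite normal_pdfE //.
  apply: measurable_funM => //; apply: measurableT_comp => //.
  apply: measurable_funM => //; apply: measurableT_comp => //.
  by apply: measurable_funX; apply: measurable_funB.
have F0 p : (0 <= F p)%E by rewrite lee_fin !mulr_ge0 ?normal_pdf_ge0.
transitivity (\int[mu]_y \int[mu]_x F (y, x))%E.
  apply: eq_integral => y _; rewrite -ge0_integralZr //.
  - exact: measurable_mul_normal_pdf.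
  - by move=> x _; rewrite lee_fin mulr_ge0 ?normal_pdf_ge0.
  - by rewrite lee_fin normal_pdf_ge0.
transitivity (\int[mu]_x \int[mu]_y F (y, x))%E.
  exact: (@fubini_tonelli _ _ (measurableTypeR R) (measurableTypeR R) R mu mu F mF F0).
apply: eq_integral => u _.
transitivity (\int[mu]_y ((g u * normal_pdf 0 s u) *
    normal_pdf (u * s2 ^+ 2 / s ^+ 2) (s1 * s2 / s) y)%:E)%E.
  apply: eq_integral => y _; rewrite /F /= -[X in X%:E = _]mulrA -[X in _ = X%:E]mulrA; congr ((_ * _)%:E).
  exact: normal_pdf_conv.
by rewrite integral_cst_normal_pdf // mulr_ge0 // normal_pdf_ge0.
Qed.

Lemma integral_normal_reflect g : continuous g -> (forall x, 0 <= g x) ->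
  (\int[mu]_u (g (- u) * normal_pdf 0 1 u)%:E = \int[mu]_u (g u * normal_pdf 0 1 u)%:E)%E.
Proof.
move=> cg g0.
have pdfN u : normal_pdf 0 1 (- u) = normal_pdf 0 1 u.
  by rewrite !normal_pdfE ?oner_eq0 // /normal_fun !subr0 sqrrN.
transitivity (\int[pushforward mu (-%R : _ -> measurableTypeR R)]_u
   (g u * normal_pdf 0 1 u)%:E)%E; last first.
  by apply: eq_measure_integral => A mA _; exact: lebesgue_measureN.
rewrite ge0_integral_pushforward //.
- by apply: eq_integral => u _ /=; rewrite pdfN.
- exact: measurable_mul_normal_pdf.
- by move=> x _; rewrite lee_fin mulr_ge0 ?normal_pdf_ge0.
Qed.

(** The values of these moments are never computed: finiteness, and positivity for k = 2, are
    enough. *)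
Definition normal_moment (k : nat) : \bar R := (\int[mu]_u (u ^+ k * normal_pdf 0 1 u)%:E)%E.

Let continuous_expr (k : nat) : continuous (fun x : R => x ^+ k).
Proof. exact: exprn_continuous. Qed.

Lemma normal_moment4_fin : (normal_moment 4 < +oo)%E.
Proof.
(* 256 / 9 = (16 / 3)^2 comes from v^2 <= exp(v)^2 with v = 3 u^2 / 16; the two factors exp(v) turn
   exp(-u^2 / 2) into exp(-u^2 / 8), the kernel of the normal density of variance 4. *)
pose C : R := 256 / 9 * (normal_peak 1 / normal_peak 2).
have p1 : 0 < normal_peak 1 :> R by apply: normal_peak_gt0; rewrite oner_eq0.
have p2 : 0 < normal_peak 2 :> R by apply: normal_peak_gt0; rewrite pnatr_eq0.
have C0 : 0 <= C by apply: mulr_ge0; apply: divr_ge0; rewrite ?ler0n ?(ltW p1) ?(ltW p2).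
have key (u : R) : u ^+ 4 * normal_pdf 0 1 u <= C * normal_pdf 0 2 u.
  rewrite !normal_pdfE ?oner_eq0 ?pnatr_eq0 // /normal_fun !subr0 /C.
  have -> : 256 / 9 * (normal_peak 1 / normal_peak 2) *
     (normal_peak 2 * expR (- u ^+ 2 / (2 ^+ 2 *+ 2))) =
     normal_peak 1 * (256 / 9 * expR (- u ^+ 2 / (2 ^+ 2 *+ 2))).
    by move: (expR _) => E; field; rewrite gt_eqF.
  rewrite mulrCA ler_pM2l //.
  have -> : - u ^+ 2 / (2 ^+ 2 *+ 2) = - u ^+ 2 / (1 ^+ 2 *+ 2) + 3 * u ^+ 2 / 16 + 3 * u ^+ 2 / 16.
    by field.
  rewrite !expRD.
  have h1 : 3 * u ^+ 2 / 16 <= expR (3 * u ^+ 2 / 16).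
    by apply: le_trans (expR_ge1Dx _); rewrite lerDr.
  have v0 : 0 <= 3 * u ^+ 2 / 16 by apply: divr_ge0 => //; apply: mulr_ge0 => //; exact: sqr_ge0.
  set E := expR (3 * u ^+ 2 / 16) in h1 *; set E0 := expR _.
  have E00 : 0 < E0 by exact: expR_gt0.
  have EE : (3 * u ^+ 2 / 16) ^+ 2 <= E ^+ 2.
    by rewrite ler_pXn2r ?nnegrE // ltW // expR_gt0.
  have -> : u ^+ 4 = 256 / 9 * (3 * u ^+ 2 / 16) ^+ 2 by field.
  have -> : 256 / 9 * (E0 * E * E) = 256 / 9 * E ^+ 2 * E0 by ring.
  rewrite ler_pM2r //; apply: ler_wpM2l => //; exact: divr_ge0.
apply: (@le_lt_trans _ _ (\int[mu]_u (C * normal_pdf 0 2 u)%:E)%E).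
  apply: ge0_le_integral => //.
  - by move=> u _; rewrite lee_fin mulr_ge0 ?normal_pdf_ge0 // exprn_even_ge0.
  - exact: measurable_mul_normal_pdf.
  - apply/measurable_EFinP; apply: measurable_funM; first exact: measurable_cst.
    exact: measurable_normal_pdf.
  - by move=> u _; rewrite lee_fin.
by rewrite integral_cst_normal_pdf // ltry.
Qed.

Lemma normal_moment2_fin : (normal_moment 2 < +oo)%E.
Proof.
apply: (@le_lt_trans _ _ (\int[mu]_u ((u ^+ 4 * normal_pdf 0 1 u)%:E + (normal_pdf 0 1 u)%:E))%E).
  apply: ge0_le_integral => //.
  - by move=> u _; rewrite lee_fin mulr_ge0 ?normal_pdf_ge0 // sqr_ge0.
  - exact: measurable_mul_normal_pdf.
  - apply: emeasurable_funD; first exact: measurable_mul_normal_pdf.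
    by apply/measurable_EFinP; exact: measurable_normal_pdf.
  - move=> u _; rewrite lee_fin -[X in _ <= _ + X]mul1r -mulrDl.
    rewrite ler_wpM2r ?normal_pdf_ge0 //.
    have -> : u ^+ 4 + 1 = u ^+ 2 + ((u ^+ 2 - 2^-1) ^+ 2 + 3 / 4) by field.
    by rewrite lerDl addr_ge0 ?sqr_ge0 // divr_ge0.
rewrite (@ge0_integralD _ (measurableTypeR R)) //.
- by rewrite integral_normal_pdf lte_add_pinfty ?ltry //; exact: normal_moment4_fin.
- by move=> u _; rewrite lee_fin mulr_ge0 ?normal_pdf_ge0 // exprn_even_ge0.
- exact: measurable_mul_normal_pdf.
- by move=> u _; rewrite lee_fin normal_pdf_ge0.
- by apply/measurable_EFinP; exact: measurable_normal_pdf.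
Qed.

Lemma normal_moment2_gt0 : (0 < normal_moment 2)%E.
Proof.
have p1 : 0 < normal_peak 1 :> R by apply: normal_peak_gt0; rewrite oner_eq0.
(* On [1, 2] one has u^2 >= 1 and exp(-u^2 / 2) >= exp(-2). *)
pose c : R := normal_peak 1 * expR (- 2).
have c0 : 0 < c by rewrite mulr_gt0 // expR_gt0.
apply: (@lt_le_trans _ _ (\int[mu]_(u in `[1%R, 2%R]) c%:E)%E).
  rewrite integral_cst //= lebesgue_measure_itv /= lte_fin ltr1n /= -EFinD -EFinM lte_fin.
  by rewrite mulr_gt0 // subr_gt0 ltr1n.
apply: (@le_trans _ _ (\int[mu]_(u in `[1%R, 2%R]) (u ^+ 2 * normal_pdf 0 1 u)%:E)%E).
  apply: ge0_le_integral => //.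
  - by move=> u _; rewrite lee_fin ltW.
  - by apply: measurable_funTS; exact: measurable_mul_normal_pdf.
  - move=> u /=; rewrite in_itv /= => /andP[u1 u2]; rewrite lee_fin /c.
    rewrite normal_pdfE ?oner_eq0 // /normal_fun subr0 -[leLHS]mul1r.
    apply: ler_pM => //; first by rewrite ltW.
      by rewrite exprn_ege1.
    rewrite ler_pM2l // ler_expR expr1n mulNr lerN2 ler_pdivrMr //.
    by have : u ^+ 2 <= 2 ^+ 2 by rewrite lerXn2r ?nnegrE //; lra.
apply: ge0_subset_integral => //.
- exact: measurable_mul_normal_pdf.
- by move=> u _; rewrite lee_fin mulr_ge0 ?normal_pdf_ge0 // sqr_ge0.
Qed.

End normal_integrals.

Definition has_gaussian_law d (T : measurableType d) (R : realType) (P : probability T R)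
    (Z : T -> R) (m s : R) : Prop :=
  forall V : set R, measurable V -> P (Z @^-1` V) = gaussian_law m s V.

(** * Moments and sums of centered Gaussian variables *)

Section gaussian_variable.
Context d (T : measurableType d) (R : realType) (P : probability T R).
Local Notation mu := (@lebesgue_measure R).
Variables (Z : T -> R) (m s : R).
Hypothesis mZ : measurable_fun setT Z.
Hypothesis lawZ : has_gaussian_law P Z m s.

Lemma gaussian_integral_pdf (g : R -> R) : s != 0 -> continuous g -> (forall x, 0 <= g x) ->
  (\int[P]_w (g (Z w))%:E = \int[mu]_x (g x * normal_pdf m s x)%:E)%E.
Proof.
move=> s0 cg g0; apply: ge0_integral_density => //.
- exact: measurable_normal_pdf.
- by move=> x; exact: normal_pdf_ge0.
- by move=> V mV; have := lawZ mV; rewrite /gaussian_law (negbTE s0).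
- exact: continuous_measurable_fun.
Qed.

(** Z has the law of m + |s| N with N standard normal. This form also covers the Dirac mass at s =
    0, so later computations need not treat it apart. *)
Lemma gaussian_integral (g : R -> R) : continuous g -> (forall x, 0 <= g x) ->
  (\int[P]_w (g (Z w))%:E = \int[mu]_u (g (m + `|s| * u) * normal_pdf 0 1 u)%:E)%E.
Proof.
move=> cg g0; have [s0|s0] := eqVneq s 0; last first.
  by rewrite gaussian_integral_pdf // integral_normal_scale.
have mg : measurable_fun setT g by exact: continuous_measurable_fun.
transitivity (\int[pushforward P (Z : _ -> measurableTypeR R)]_x (g x)%:E)%E.
  rewrite ge0_integral_pushforward //; first by apply/measurable_EFinP.
  by move=> x _; rewrite lee_fin.
transitivity (\int[@dirac _ (measurableTypeR R) m R]_x (g x)%:E)%E.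
  apply: eq_measure_integral => A mA _ /=.
  by have := lawZ mA; rewrite /gaussian_law s0 eqxx => /esym.
rewrite integral_dirac //; last by apply/measurable_EFinP.
rewrite diracT mul1e s0 normr0.
rewrite -(@integral_cst_normal_pdf R 0 1 (g m)) //.
by apply: eq_integral => u _; rewrite mul0r addr0.
Qed.

Hypothesis mean0 : (\int[P]_w (Z w)%:E = 0)%E.
Hypothesis sqZ : P.-integrable setT (EFin \o (fun w => Z w ^+ 2)).

Lemma square_integrable : P.-integrable setT (EFin \o Z).
Proof.
apply: (@le_integrable _ _ _ _ _ _ _ (EFin \o (fun w => Z w ^+ 2 + 1))) => //.
- by apply/measurable_EFinP.
- move=> w _ /=; rewrite lee_fin.
  rewrite [leRHS]ger0_norm ?addr_ge0 ?sqr_ge0 //.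
  rewrite -(real_normK (num_real (Z w))); have := normr_ge0 (Z w).
  move: (`|Z w|) => a a0; have := sqr_ge0 (a - 2^-1); lra.
- by apply: integrable_EFinD => //; exact: integrable_EFin_cst.
Qed.

(** The law is symmetric about m, so Z and 2 m - Z have the same second moment; as Z has mean zero,
    the second one exceeds the first by 4 m^2. *)
Lemma gaussian_mean0 : m = 0.
Proof.
have iZ := square_integrable.
have shift a : (\int[P]_w ((Z w - a) ^+ 2)%:E = (\int[P]_w (Z w ^+ 2) + a ^+ 2)%:E)%E.
  rewrite -EFin_Rintegral.
    congr (_%:E).
    have -> : (fun w => (Z w - a) ^+ 2) =
        (fun w => Z w ^+ 2 + ((- (2 * a)) * Z w + a ^+ 2)).
      by apply/funext => w; ring.
    rewrite RintegralD // ?RintegralD //.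
    + rewrite Rintegral_prob_cst RintegralZl //.
      by rewrite /Rintegral mean0 /= mulr0 add0r.
    + exact: integrable_EFinZ.
    + exact: integrable_EFin_cst.
    + apply: integrable_EFinD; [exact: integrable_EFinZ|exact: integrable_EFin_cst].
  apply: (eq_integrable _ (EFin \o (fun w => Z w ^+ 2 + ((- (2 * a)) * Z w + a ^+ 2)))) => //.
    by move=> w _ /=; congr (_%:E); ring.
  apply: integrable_EFinD => //.
  by apply: integrable_EFinD; [exact: integrable_EFinZ|exact: integrable_EFin_cst].
have law a : (\int[P]_w ((Z w - a) ^+ 2)%:E =
    \int[mu]_u ((m + `|s| * u - a) ^+ 2 * normal_pdf 0 1 u)%:E)%E.
  apply: (@gaussian_integral (fun x => (x - a) ^+ 2)).
    move=> x; apply: (@continuous_comp _ _ _ (fun x : R => x - a) (fun x => x ^+ 2)).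
      by apply: cvgB; [exact: cvg_id|exact: cvg_cst].
    exact: exprn_continuous.
  by move=> x; exact: sqr_ge0.
have : (\int[P]_w ((Z w - 0) ^+ 2)%:E = \int[P]_w ((Z w - (2 * m)) ^+ 2)%:E)%E.
  rewrite !law -integral_normal_reflect.
  - by apply: eq_integral => u _; congr ((_ * _)%:E); ring.
  - move=> x; apply: (@continuous_comp _ _ _ (fun x : R => m + `|s| * x - 0) (fun x => x ^+ 2)).
      apply: cvgB; last exact: cvg_cst.
      by apply: cvgD; [exact: cvg_cst|apply: cvgM; [exact: cvg_cst|exact: cvg_id]].
    exact: exprn_continuous.
  - by move=> x; exact: sqr_ge0.
rewrite !shift => -[]; rewrite expr0n /= addr0 -[LHS]addr0 => /addrI/esym/eqP.
by rewrite sqrf_eq0 mulf_eq0 pnatr_eq0 /= => /eqP.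
Qed.

Lemma gaussian_moment k : ~~ odd k ->
  (\int[P]_w (Z w ^+ k)%:E = (`|s| ^+ k)%:E * normal_moment R k)%E.
Proof.
move=> ek; have p0 (x : R) : 0 <= x ^+ k by rewrite exprn_even_ge0.
rewrite (gaussian_integral (@exprn_continuous R k) p0).
rewrite gaussian_mean0 -(@ge0_integralZl _ (measurableTypeR R)) //.
- by apply: eq_integral => u _; rewrite add0r exprMn -EFinM mulrA.
- by apply: measurable_mul_normal_pdf; exact: exprn_continuous.
- by move=> u _; rewrite lee_fin mulr_ge0 ?normal_pdf_ge0 // exprn_even_ge0.
Qed.

Lemma gaussian_sqr : \int[P]_w (Z w ^+ 2) = s ^+ 2 * fine (normal_moment R 2).
Proof.
rewrite /Rintegral gaussian_moment // real_normK ?num_real // fineM //.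
rewrite ge0_fin_numE ?normal_moment2_fin //.
by rewrite ltW // normal_moment2_gt0.
Qed.

End gaussian_variable.

(** The ratio of the fourth moment to the squared variance of a centered normal law, left
    symbolic. *)
Definition kurtosis (R : realType) : R :=
  fine (normal_moment R 4) / fine (normal_moment R 2) ^+ 2.

Lemma normal_moment_fine (R : realType) :
  0 < fine (normal_moment R 2) /\ 0 <= fine (normal_moment R 4).
Proof.
split; first by apply: fine_gt0; rewrite normal_moment2_gt0 normal_moment2_fin.
apply: fine_ge0; apply: integral_ge0 => u _.
by rewrite lee_fin mulr_ge0 ?normal_pdf_ge0 // exprn_even_ge0.
Qed.

Section gaussian_facts.
Variable R : realType.
Local Notation mu := (@lebesgue_measure R).

Lemma gaussian_moment4 d (T : measurableType d) (P : probability T R) (Z : T -> R) m s :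
  measurable_fun setT Z ->
  has_gaussian_law P Z m s ->
  (\int[P]_w (Z w)%:E = 0)%E -> P.-integrable setT (EFin \o (fun w => Z w ^+ 2)) ->
  (\int[P]_w (Z w ^+ 4)%:E = (kurtosis R * (\int[P]_w (Z w ^+ 2)) ^+ 2)%:E)%E.
Proof.
move=> mZ lawZ Z0 Z2; rewrite (gaussian_moment mZ lawZ) // (gaussian_sqr mZ lawZ) //.
have [k2 k4] := normal_moment_fine R.
rewrite -[normal_moment R 4]fineK.
  rewrite -EFinM /kurtosis; congr (_%:E).
  have -> : `|s| ^+ 4 = s ^+ 4 by rewrite -normrX ger0_norm // exprn_even_ge0.
  by field; rewrite gt_eqF.
rewrite ge0_fin_numE ?normal_moment4_fin //.
by apply: integral_ge0 => u _; rewrite lee_fin mulr_ge0 ?normal_pdf_ge0 // exprn_even_ge0.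
Qed.

(** The law of Z3 is the convolution of those of Z1 and Z2, being centered Gaussian with the sum of
    their variances. The density computation needs s1 and s2 nonzero; the degenerate cases reduce to
    a single variable. *)
Lemma gaussian_add d1 d2 d3 (T1 : measurableType d1) (T2 : measurableType d2)
    (T3 : measurableType d3) (P1 : probability T1 R) (P2 : probability T2 R)
    (P3 : probability T3 R) (Z1 : T1 -> R) (Z2 : T2 -> R) (Z3 : T3 -> R)
    m1 s1 m2 s2 m3 s3 (g : R -> R) :
  measurable_fun setT Z1 -> measurable_fun setT Z2 -> measurable_fun setT Z3 ->
  has_gaussian_law P1 Z1 m1 s1 ->
  has_gaussian_law P2 Z2 m2 s2 ->
  has_gaussian_law P3 Z3 m3 s3 ->
  (\int[P1]_w (Z1 w)%:E = 0)%E -> (\int[P2]_w (Z2 w)%:E = 0)%E ->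
  (\int[P3]_w (Z3 w)%:E = 0)%E ->
  P1.-integrable setT (EFin \o (fun w => Z1 w ^+ 2)) ->
  P2.-integrable setT (EFin \o (fun w => Z2 w ^+ 2)) ->
  P3.-integrable setT (EFin \o (fun w => Z3 w ^+ 2)) ->
  \int[P3]_w (Z3 w ^+ 2) = \int[P1]_w (Z1 w ^+ 2) + \int[P2]_w (Z2 w ^+ 2) ->
  continuous g -> (forall x, 0 <= g x) ->
  (\int[P3]_w (g (Z3 w))%:E = \int[P1]_w \int[P2]_w' (g (Z1 w + Z2 w'))%:E)%E.
Proof.
move=> mZ1 mZ2 mZ3 L1 L2 L3 E1 E2 E3 q1 q2 q3 var cg g0.
have M1 := gaussian_mean0 mZ1 L1 E1 q1.
have M2 := gaussian_mean0 mZ2 L2 E2 q2.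
have M3 := gaussian_mean0 mZ3 L3 E3 q3.
have [k2 _] := normal_moment_fine R.
have es : s3 ^+ 2 = s1 ^+ 2 + s2 ^+ 2.
  move: var; rewrite (gaussian_sqr mZ1 L1) // (gaussian_sqr mZ2 L2) // (gaussian_sqr mZ3 L3) //.
  by rewrite -mulrDl; apply: mulIf; rewrite gt_eqF.
have abs3 s : s3 ^+ 2 = s ^+ 2 -> `|s3| = `|s|.
  by move=> /(congr1 Num.sqrt); rewrite !sqrtr_sqr.
have cga a : continuous (fun x => g (a + x)).
  move=> x; apply: (@continuous_comp _ _ _ (fun x => a + x) g); last exact: cg.
  by apply: cvgD; [exact: cvg_cst|exact: cvg_id].
have cgr a : continuous (fun x => g (x + a)).
  by under eq_fun do rewrite addrC; exact: cga.
have [z2|n2] := eqVneq s2 0.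
  transitivity (\int[P1]_w (g (Z1 w))%:E)%E.
    rewrite (gaussian_integral mZ3 L3) // (gaussian_integral mZ1 L1) // M1 M3.
    by rewrite (abs3 s1) // es z2 expr0n addr0.
  apply: eq_integral => w _.
  rewrite (@gaussian_integral _ _ _ _ _ _ _ mZ2 L2 (fun x => g (Z1 w + x))) //.
  rewrite M2 z2 normr0.
  rewrite -(@integral_cst_normal_pdf R 0 1 (g (Z1 w))) //.
  by apply: eq_integral => u _; rewrite mul0r !addr0.
have mg : measurable_fun setT g by exact: continuous_measurable_fun.
transitivity (\int[P1]_w \int[mu]_y (g (Z1 w + y) * normal_pdf 0 s2 y)%:E)%E; last first.
  apply: eq_integral => w _.
  by rewrite (@gaussian_integral_pdf _ _ _ _ _ _ _ mZ2 L2 (fun x => g (Z1 w + x))) // M2.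
pose F (p : T1 * R) : \bar R := (g (Z1 p.1 + p.2) * normal_pdf 0 s2 p.2)%:E.
have mF : measurable_fun setT F.
  apply/measurable_EFinP; apply: measurable_funM; last first.
    exact: (measurableT_comp (measurable_normal_pdf 0 s2) measurable_snd).
  apply: (measurableT_comp mg); apply: measurable_funD.
    exact: (measurableT_comp mZ1 measurable_fst).
  exact: measurable_snd.
have F0 p : (0 <= F p)%E by rewrite lee_fin !mulr_ge0 ?normal_pdf_ge0.
transitivity (\int[mu]_y \int[P1]_w F (w, y))%E; last first.
  exact/esym/(@fubini_tonelli _ _ T1 (measurableTypeR R) R P1 mu F mF F0).
have inner y : (\int[P1]_w F (w, y) = (\int[P1]_w (g (Z1 w + y))%:E) * (normal_pdf 0 s2 y)%:E)%E.
  rewrite -ge0_integralZr //.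
  - apply/measurable_EFinP; apply: (measurableT_comp mg).
    by apply: measurable_funD => //; exact: measurable_cst.
  - by move=> w _; rewrite lee_fin.
  - by rewrite lee_fin normal_pdf_ge0.
under [RHS]eq_integral => y _ do rewrite inner.
have [z1|n1] := eqVneq s1 0.
  have n3 : s3 != 0 by rewrite -sqrf_eq0 es z1 expr0n add0r sqrf_eq0.
  rewrite (gaussian_integral mZ3 L3) // M3 (abs3 s2); last by rewrite es z1 expr0n add0r.
  rewrite -integral_normal_scale //; apply: eq_integral => y _.
  rewrite EFinM; congr (_ * _)%E.
  rewrite (@gaussian_integral _ _ _ _ _ _ _ mZ1 L1 (fun x => g (x + y))) //.
  rewrite M1 z1 normr0.
  rewrite -(@integral_cst_normal_pdf R 0 1 (g y)) //.
  by apply: eq_integral => u _; rewrite mul0r !add0r.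
have n3 : s3 != 0.
  by rewrite -sqrf_eq0 es gt_eqF // ltr_pwDl ?sqr_ge0 // exprn_even_gt0.
rewrite (gaussian_integral_pdf mZ3 L3) // M3 -(integral_normal_conv n1 n2 es) //.
apply: eq_integral => y _; congr (_ * _)%E.
rewrite (@gaussian_integral _ _ _ _ _ _ _ mZ1 L1 (fun x => g (x + y))) //.
rewrite integral_normal_scale // M1.
by apply: eq_integral => u _; congr ((g _ * _)%:E); ring.
Qed.

End gaussian_facts.

(** * Linear combinations of square-integrable families *)

Section square_integrable_families.
Context d (T : measurableType d) (R : realType) (P : probability T R).
Implicit Types f g : T -> R.

Lemma integrable_EFin_sum (I : Type) (r : seq I) (Q : pred I) (F : I -> T -> R) :
  (forall i, P.-integrable setT (EFin \o F i)) ->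
  P.-integrable setT (EFin \o (fun w => \sum_(i <- r | Q i) F i w)).
Proof.
move=> iF; elim: r => [|i r IH].
  under eq_fun do rewrite big_nil; exact: integrable_EFin_cst.
under eq_fun do rewrite big_cons.
by case: (Q i) => //; exact: integrable_EFinD.
Qed.

Lemma integrable_mul f g : measurable_fun setT f -> measurable_fun setT g ->
  P.-integrable setT (EFin \o (fun w => f w ^+ 2)) ->
  P.-integrable setT (EFin \o (fun w => g w ^+ 2)) ->
  P.-integrable setT (EFin \o (fun w => f w * g w)).
Proof.
move=> mf mg f2 g2.
apply: (@le_integrable _ _ _ _ _ _ _ (EFin \o (fun w => f w ^+ 2 + g w ^+ 2))) => //.
- by apply/measurable_EFinP; exact: measurable_funM.
- move=> w _ /=; rewrite lee_fin [leRHS]ger0_norm ?addr_ge0 ?sqr_ge0 //.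
  rewrite normrM -(real_normK (num_real (f w))) -(real_normK (num_real (g w))).
  move: (`|f w|) (`|g w|) => a b.
  by have := sqr_ge0 (a - b); have := sqr_ge0 (a + b); lra.
- exact: integrable_EFinD.
Qed.

Variables (I : finType) (Y : I -> T -> R).
Hypothesis mY : forall i, measurable_fun setT (Y i).
Hypothesis sqY : forall i, P.-integrable setT (EFin \o (fun w => Y i w ^+ 2)).

Lemma measurable_lincomb (c : I -> R) :
  measurable_fun setT (fun w => \sum_i c i * Y i w).
Proof. by apply: measurable_sum => i; exact: measurable_funM. Qed.

Lemma lincomb_mul (c e : I -> R) w : (\sum_i c i * Y i w) * (\sum_i e i * Y i w) =
  \sum_i \sum_j (c i * e j) * (Y i w * Y j w).
Proof.
rewrite mulr_suml; apply: eq_bigr => i _; rewrite mulr_sumr; apply: eq_bigr => j _.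
by rewrite mulrACA.
Qed.

Lemma integrable_lincomb_mul (c e : I -> R) :
  P.-integrable setT (EFin \o (fun w => (\sum_i c i * Y i w) * (\sum_i e i * Y i w))).
Proof.
under eq_fun do rewrite lincomb_mul.
by do 2! (apply: integrable_EFin_sum => ?); apply: integrable_EFinZ; exact: integrable_mul.
Qed.

Lemma Rintegral_lincomb_mul (c e : I -> R) :
  \int[P]_w ((\sum_i c i * Y i w) * (\sum_i e i * Y i w)) =
  \sum_i \sum_j c i * e j * \int[P]_w (Y i w * Y j w).
Proof.
under eq_Rintegral do rewrite lincomb_mul.
have ij i j : P.-integrable setT (EFin \o (fun w => c i * e j * (Y i w * Y j w))).
  by apply: integrable_EFinZ; exact: integrable_mul.
rewrite Rintegral_sum => [|i]; last by apply: integrable_EFin_sum.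
apply: eq_bigr => i _; rewrite Rintegral_sum //; apply: eq_bigr => j _.
by rewrite RintegralZl //; exact: integrable_mul.
Qed.

Lemma integral_lincomb0 (c : I -> R) : (forall i, (\int[P]_w (Y i w)%:E = 0)%E) ->
  (\int[P]_w (\sum_i c i * Y i w)%:E = 0)%E.
Proof.
move=> m0; have iY i : P.-integrable setT (EFin \o Y i) by exact: square_integrable.
rewrite -EFin_Rintegral; last first.
  by apply: integrable_EFin_sum => i; exact: integrable_EFinZ.
rewrite Rintegral_sum => [|i]; last exact: integrable_EFinZ.
rewrite big1 // => i _; rewrite RintegralZl // /Rintegral m0 /=; exact: mulr0.
Qed.

End square_integrable_families.

(** * Decoupling of uncorrelated Gaussian families *)

Section gaussian_decoupling.
Context d (T : measurableType d) (R : realType) (P : probability T R).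
Variables (I : finType) (D : {set I}) (G : I -> T -> R).
Hypothesis mG : forall i, measurable_fun setT (G i).
Hypothesis sqG : forall i, P.-integrable setT (EFin \o (fun w => G i w ^+ 2)).
Hypothesis meanG : forall i, (\int[P]_w (G i w)%:E = 0)%E.
Hypothesis gaussG : jointly_gaussian P D G.
Variables a b : pred I.
Hypothesis aD : forall i, a i -> i \in D.
Hypothesis bD : forall i, b i -> i \in D.
Hypothesis uncorr : forall i j, a i -> b j -> \int[P]_w (G i w * G j w) = 0.

Let lin (e : pred I) (c : I -> R) i : R := if e i then c i else 0.

Let restr_lin (e : pred I) (c : I -> R) w :
  \sum_i c i * restr e (G ^~ w) i = \sum_i lin e c i * G i w.
Proof.
apply: eq_bigr => i _; rewrite /restr /lin.
by case: (e i); rewrite ?mulr0 ?mul0r.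
Qed.

Let law (c : I -> R) : (forall i, i \notin D -> c i = 0) -> exists m s,
  has_gaussian_law P (fun w => \sum_i c i * G i w) m s.
Proof.
move=> c0; have [m [s H]] := gaussG c; exists m, s => V mV; rewrite -H //.
congr (P (_ @^-1` V)); apply/funext => w; rewrite [RHS]big_mkcond /=.
by apply: eq_bigr => i _; case: ifPn => // /c0 ->; rewrite mul0r.
Qed.

(** By [same_law_lipschitz] it is enough to test cosines of linear forms. A form splits as Z1 + Z2
    over the two families; joint Gaussianity gives the law of the sum, and the vanishing covariances
    make its variance additive, so [gaussian_add] applies. *)
Lemma gaussian_decouple (F : (I -> R) -> R) (lip B : R) :
  0 <= lip -> state_measurable F -> (forall x, `|F x| <= B) ->
  (forall x x', `|F x - F x'| <= lip * \sum_i `|x i - x' i|) ->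
  \int[P]_w F (fun i => restr a (G ^~ w) i + restr b (G ^~ w) i) =
  \int[P]_w \int[P]_w' F (fun i => restr a (G ^~ w) i + restr b (G ^~ w') i).
Proof.
move=> lip0 mF bF lF.
pose U w i := restr a (G ^~ w) i + restr b (G ^~ w) i.
pose V (p : T * T) i := restr a (G ^~ p.1) i + restr b (G ^~ p.2) i.
have mU i : measurable_fun setT (fun w => U w i).
  by apply: measurable_funD; exact: measurable_restr.
have mV i : measurable_fun setT (fun p => V p i).
  apply: measurable_funD.
    by apply: (@measurable_restr _ _ _ _ _ (fun p : T * T => G ^~ p.1)) => j;
      exact: (measurableT_comp (mG j) measurable_fst).
  by apply: (@measurable_restr _ _ _ _ _ (fun p : T * T => G ^~ p.2)) => j;
      exact: (measurableT_comp (mG j) measurable_snd).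
rewrite -(@Rintegral_prod _ _ _ _ _ P P (fun p => F (V p)) B) //; last exact: mF.
apply: (same_law_lipschitz mU mV _ lip0 mF bF lF) => c th.
pose Z1 w := \sum_i lin a c i * G i w.
pose Z2 w := \sum_i lin b c i * G i w.
pose Z3 w := \sum_i (lin a c i + lin b c i) * G i w.
have Z3E w : Z3 w = Z1 w + Z2 w.
  by rewrite -big_split; apply: eq_bigr => i _; rewrite mulrDl.
have UE w : \sum_i c i * U w i = Z3 w.
  rewrite Z3E -[Z1 w]restr_lin -[Z2 w]restr_lin -big_split.
  by apply: eq_bigr => i _; rewrite mulrDr.
have VE p : \sum_i c i * V p i = Z1 p.1 + Z2 p.2.
  rewrite -[Z1 _]restr_lin -[Z2 _]restr_lin -big_split.
  by apply: eq_bigr => i _; rewrite mulrDr.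
have la i : i \notin D -> lin a c i = 0.
  by rewrite /lin; case: ifP => // /aD ->.
have lb i : i \notin D -> lin b c i = 0.
  by rewrite /lin; case: ifP => // /bD ->.
have [m1 [s1 L1]] := law la; have [m2 [s2 L2]] := law lb.
have [m3 [s3 L3]] : exists m s, has_gaussian_law P Z3 m s.
  by apply: law => i iD; rewrite la // lb // addr0.
have mZ1 : measurable_fun setT Z1 by exact: measurable_lincomb.
have mZ2 : measurable_fun setT Z2 by exact: measurable_lincomb.
have mZ3 : measurable_fun setT Z3 by exact: measurable_lincomb.
have q1 : P.-integrable setT (EFin \o (fun w => Z1 w ^+ 2)) by exact: integrable_lincomb_mul.
have q2 : P.-integrable setT (EFin \o (fun w => Z2 w ^+ 2)) by exact: integrable_lincomb_mul.
have q3 : P.-integrable setT (EFin \o (fun w => Z3 w ^+ 2)) by exact: integrable_lincomb_mul.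
have q12 : P.-integrable setT (EFin \o (fun w => Z1 w * Z2 w)) by exact: integrable_lincomb_mul.
have cross : \int[P]_w (Z1 w * Z2 w) = 0.
  rewrite Rintegral_lincomb_mul // big1 // => i _; rewrite big1 // => j _.
  rewrite /lin; case: ifPn => [ai|_]; last by rewrite !mul0r.
  by case: ifPn => [bj|_]; [rewrite uncorr // mulr0|rewrite mulr0 mul0r].
have var : \int[P]_w (Z3 w ^+ 2) = \int[P]_w (Z1 w ^+ 2) + \int[P]_w (Z2 w ^+ 2).
  have -> : \int[P]_w (Z3 w ^+ 2) = \int[P]_w (Z1 w ^+ 2 + (Z2 w ^+ 2 + 2 * (Z1 w * Z2 w))).
    by apply: eq_Rintegral => w _; rewrite Z3E; ring.
  rewrite RintegralD //; last by apply: integrable_EFinD => //; exact: integrable_EFinZ.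
  rewrite RintegralD //; last exact: integrable_EFinZ.
  by rewrite RintegralZl // cross mulr0 addr0.
(* The constant 1 makes the test function nonnegative, as [gaussian_add] requires; it cancels at the
   end. *)
pose g (x : R) := 1 + cos (x + th).
have cg : continuous g.
  move=> x; apply: cvgD; first exact: cvg_cst.
  apply: (@continuous_comp _ _ _ (fun x : R => x + th) cos); last exact: continuous_cos.
  by apply: cvgD; [exact: cvg_id|exact: cvg_cst].
have g0 x : 0 <= g x by have := cos_geN1 (x + th); rewrite /g; lra.
have gb x : `|g x| <= 2.
  by rewrite ger0_norm //; have := cos_le1 (x + th); rewrite /g; lra.
have mg : measurable_fun setT g by exact: continuous_measurable_fun.
have mZ12 : measurable_fun setT (fun p : T * T => Z1 p.1 + Z2 p.2).
  apply: measurable_funD; first exact: (measurableT_comp mZ1 measurable_fst).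
  exact: (measurableT_comp mZ2 measurable_snd).
have mcos : measurable_fun setT (fun x : R => cos (x + th)).
  apply: continuous_measurable_fun => x.
  apply: (@continuous_comp _ _ _ (fun x : R => x + th) cos); last exact: continuous_cos.
  by apply: cvgD; [exact: cvg_id|exact: cvg_cst].
have key : \int[P]_w g (Z3 w) = \int[P]_w \int[P]_w' g (Z1 w + Z2 w').
  have mg12 : measurable_fun setT (fun p : T * T => g (Z1 p.1 + Z2 p.2)).
    exact: measurableT_comp.
  have := gaussian_add mZ1 mZ2 mZ3 L1 L2 L3 (integral_lincomb0 mG sqG _ meanG)
    (integral_lincomb0 mG sqG _ meanG) (integral_lincomb0 mG sqG _ meanG) q1 q2 q3 var cg g0.
  rewrite -EFin_Rintegral; last first.
    by apply: (@bounded_integrable _ _ _ _ _ 2) => //; exact: measurableT_comp.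
  under [RHS]eq_integral => w _.
    rewrite -EFin_Rintegral; last first.
      apply: (@bounded_integrable _ _ _ _ _ 2) => //.
      by apply: (measurableT_comp mg); apply: measurable_funD => //; exact: measurable_cst.
    over.
  rewrite -EFin_Rintegral => [[]//|].
  apply: (@bounded_integrable _ _ _ _ _ 2).
    exact: (@measurable_Rintegral_fst _ _ _ _ _ P P (fun p => g (Z1 p.1 + Z2 p.2)) 2).
  move=> w; apply: Rintegral_norm_le => //; apply: (@bounded_integrable _ _ _ _ _ 2) => //.
  by apply: (measurableT_comp mg); apply: measurable_funD => //; exact: measurable_cst.
rewrite -(@Rintegral_prod _ _ _ _ _ P P (fun p => g (Z1 p.1 + Z2 p.2)) 2) in key => //; last first.
  exact: measurableT_comp.
have i3 : P.-integrable setT (EFin \o (fun w => cos (Z3 w + th))).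
  apply: (@bounded_integrable _ _ _ _ _ 1); first exact: (measurableT_comp mcos).
  by move=> w; rewrite ler_norml cos_geN1 cos_le1.
have i12 : (P \x P)%E.-integrable setT (EFin \o (fun p => cos (Z1 p.1 + Z2 p.2 + th))).
  apply: (@bounded_integrable _ _ _ _ _ 1); first exact: (measurableT_comp mcos).
  by move=> w; rewrite ler_norml cos_geN1 cos_le1.
move: key; rewrite /g RintegralD //; last exact: integrable_EFin_cst.
rewrite RintegralD //; last exact: integrable_EFin_cst.
rewrite !Rintegral_prob_cst => /addrI key.
under eq_Rintegral do rewrite UE.
by rewrite key; apply: eq_Rintegral => p _; rewrite VE.
Qed.

End gaussian_decoupling.

(** * Lindeberg's replacement argument *)

Section lindeberg_swap.
Context d1 d2 (T1 : measurableType d1) (T2 : measurableType d2) (R : realType).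
Variables (P : probability T1 R) (Q : probability T2 R).
Variables (I : Type) (X : I -> T1 -> R) (G : I -> T2 -> R) (D : pred I) (bid : I -> nat).
Variables (F : (I -> R) -> R) (B : R).
Hypothesis mX : forall i, measurable_fun setT (X i).
Hypothesis mG : forall i, measurable_fun setT (G i).
Hypothesis mF : state_measurable F.
Hypothesis bF : forall x, `|F x| <= B.

Definition above b : pred I := fun i => D i && (b <= bid i)%N.

Hypothesis ind : forall b, independent_sigma_fields P
  (sigma_field [set i | below D bid b i] X) (sigma_field [set i | level D bid b i] X).
Hypothesis decG : forall b (x : I -> R),
  \int[Q]_w F (fun i => x i + (restr (level D bid b) (G ^~ w) i + restr (above b.+1) (G ^~ w) i)) =
  \int[Q]_w \int[Q]_w' F (fun i =>
    x i + (restr (level D bid b) (G ^~ w) i + restr (above b.+1) (G ^~ w') i)).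

Let smooth (e : pred I) (x : I -> R) : R :=
  \int[Q]_w F (fun i => x i + restr e (G ^~ w) i).

Let measurable_pair d (T : measurableType d) (Y : T -> I -> R) (e : pred I) :
  (forall i, measurable_fun setT (fun w => Y w i)) ->
  measurable_fun setT (fun p : T * T2 => F (fun i => Y p.1 i + restr e (G ^~ p.2) i)).
Proof.
move=> mY; apply: mF => i; apply: measurable_funD.
  exact: (measurableT_comp (mY i) measurable_fst).
apply: (@measurable_restr _ _ _ _ _ (fun p : T * T2 => G ^~ p.2)) => j.
exact: (measurableT_comp (mG j) measurable_snd).
Qed.

Let measurable_smooth e : state_measurable (smooth e).
Proof.
move=> d T Y mY.
apply: (@measurable_Rintegral_param _ _ _ _ _ Q
  (fun p : T * T2 => F (fun i => Y p.1 i + restr e (G ^~ p.2) i)) B) => //.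
exact: measurable_pair.
Qed.

Let measurable_shift (x : I -> R) e :
  measurable_fun setT (fun w => F (fun i => x i + restr e (G ^~ w) i)).
Proof.
apply: mF => i; apply: measurable_funD; first exact: measurable_cst.
exact: measurable_restr.
Qed.

Let smooth_bound e x : `|smooth e x| <= B.
Proof.
by apply: Rintegral_norm_le => //; apply: (@bounded_integrable _ _ _ _ _ B).
Qed.

Variable err : nat -> R.
Hypothesis swap : forall b W,
  `|\int[P]_w F (fun i => W i + restr (level D bid b) (X ^~ w) i) -
    \int[Q]_w F (fun i => W i + restr (level D bid b) (G ^~ w) i)| <= err b.

(** Blocks before b are taken from X and the others from G, as an iterated integral over the two
    spaces. *)
Let hybrid b := \int[P]_w smooth (above b) (restr (below D bid b) (X ^~ w)).

Let aboveS b (x : I -> R) :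
  restr (above b) x = (fun i => restr (level D bid b) x i + restr (above b.+1) x i).
Proof.
apply/funext => i; rewrite /restr /above /level; case: (D i) => /=; last by rewrite addr0.
by case: (ltngtP b (bid i)) => h; rewrite ?addr0 ?add0r.
Qed.

Let mXb (e : pred I) i : measurable_fun setT (fun w => restr e (X ^~ w) i).
Proof. exact: measurable_restr. Qed.

(** Block b is decoupled from the earlier blocks of X and from the later ones of G. Fubini moves the
    integral over the later blocks outside, and [swap] then applies with all other coordinates
    frozen in [W]. *)
Let hybrid_step b : `|hybrid b.+1 - hybrid b| <= err b.
Proof.
pose U w := restr (below D bid b) (X ^~ w).
pose V w := restr (level D bid b) (X ^~ w).
pose H w := restr (level D bid b) (G ^~ w).
pose A w := restr (above b.+1) (G ^~ w).
have -> : hybrid b.+1 = \int[P]_w \int[P]_w' smooth (above b.+1) (fun i => U w i + V w' i).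
  exact: (@decouple_level _ _ _ P _ X D bid mX ind b _ B).
have mI1 : measurable_fun setT
    (fun w => \int[P]_w' smooth (above b.+1) (fun i => U w i + V w' i)).
  apply: (@measurable_Rintegral_param _ _ _ _ _ P
    (fun p : T1 * T1 => smooth (above b.+1) (fun i => U p.1 i + V p.2 i)) B) => //.
  apply: measurable_smooth => i; apply: measurable_funD.
    exact: (measurableT_comp (mXb _ i) measurable_fst).
  exact: (measurableT_comp (mXb _ i) measurable_snd).
have sI1 w : P.-integrable setT
    (EFin \o (fun w' => smooth (above b.+1) (fun i => U w i + V w' i))).
  apply: (@bounded_integrable _ _ _ _ _ B) => //; apply: measurable_smooth => i.
  by apply: measurable_funD; [exact: measurable_cst|exact: mXb].
have iI1 : P.-integrable setT
    (EFin \o (fun w => \int[P]_w' smooth (above b.+1) (fun i => U w i + V w' i))).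
  by apply: (@bounded_integrable _ _ _ _ _ B) => // w; exact: Rintegral_norm_le.
have iI2 : P.-integrable setT (EFin \o (fun w => smooth (above b) (U w))).
  apply: (@bounded_integrable _ _ _ _ _ B) => //; apply: measurable_smooth => i.
  exact: mXb.
rewrite /hybrid -RintegralB //; apply: Rintegral_norm_le.
  exact: integrable_EFinB.
move=> w; set x := U w.
have mHA : measurable_fun setT (fun p : T2 * T2 => F (fun i => x i + (H p.1 i + A p.2 i))).
  apply: mF => i; apply: measurable_funD; first exact: measurable_cst.
  apply: measurable_funD.
    apply: (@measurable_restr _ _ _ _ _ (fun p : T2 * T2 => G ^~ p.1)) => j.
    exact: (measurableT_comp (mG j) measurable_fst).
  apply: (@measurable_restr _ _ _ _ _ (fun p : T2 * T2 => G ^~ p.2)) => j.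
  exact: (measurableT_comp (mG j) measurable_snd).
have -> : smooth (above b) x = \int[Q]_w'' \int[Q]_w' F (fun i => x i + (H w' i + A w'' i)).
  rewrite /smooth; under eq_Rintegral do rewrite aboveS.
  rewrite decG.
  exact: (@Rintegral_fubini _ _ _ _ _ Q Q (fun p => F (fun i => x i + (H p.1 i + A p.2 i))) B).
have mVA : measurable_fun setT (fun p : T1 * T2 => F (fun i => (x i + V p.1 i) + A p.2 i)).
  apply: (@measurable_pair _ _ (fun w' i => x i + V w' i)) => i.
  by apply: measurable_funD; [exact: measurable_cst|exact: mXb].
have -> : \int[P]_w' smooth (above b.+1) (fun i => x i + V w' i) =
    \int[Q]_w'' \int[P]_w' F (fun i => (x i + V w' i) + A w'' i).
  exact: (@Rintegral_fubini _ _ _ _ _ P Q (fun p => F (fun i => (x i + V p.1 i) + A p.2 i)) B).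
have mswap d d' (S : measurableType d) (S' : measurableType d') (f : S * S' -> R) :
    measurable_fun setT f -> measurable_fun setT (fun p : S' * S => f (p.2, p.1)).
  by move=> mf; exact: (measurableT_comp mf (@measurable_swap _ _ _ _)).
have iX : Q.-integrable setT
    (EFin \o (fun w'' => \int[P]_w' F (fun i => (x i + V w' i) + A w'' i))).
  apply: (@bounded_integrable _ _ _ _ _ B).
    by apply: (@measurable_Rintegral_param _ _ _ _ _ P
      (fun p : T2 * T1 => F (fun i => (x i + V p.2 i) + A p.1 i)) B) => //; exact: (mswap _ _ _ _ _ mVA).
  move=> w''; apply: Rintegral_norm_le => //; apply: (@bounded_integrable _ _ _ _ _ B) => //.
  exact: (measurableT_comp mVA (measurable_pair2 w'')).
have iG : Q.-integrable setT
    (EFin \o (fun w'' => \int[Q]_w' F (fun i => x i + (H w' i + A w'' i)))).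
  apply: (@bounded_integrable _ _ _ _ _ B).
    by apply: (@measurable_Rintegral_param _ _ _ _ _ Q
      (fun p : T2 * T2 => F (fun i => x i + (H p.2 i + A p.1 i))) B) => //; exact: (mswap _ _ _ _ _ mHA).
  move=> w''; apply: Rintegral_norm_le => //; apply: (@bounded_integrable _ _ _ _ _ B) => //.
  exact: (measurableT_comp mHA (measurable_pair2 w'')).
rewrite -RintegralB //; apply: Rintegral_norm_le; first exact: integrable_EFinB.
move=> w''; have := swap b (fun i => x i + A w'' i).
have -> : \int[P]_w' F (fun i => x i + A w'' i + restr (level D bid b) (X^~ w') i) =
    \int[P]_w' F (fun i => x i + V w' i + A w'' i).
  by apply: eq_Rintegral => w' _; congr F; apply/funext => i; rewrite addrAC.
have -> : \int[Q]_w' F (fun i => x i + A w'' i + restr (level D bid b) (G^~ w') i) =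
    \int[Q]_w' F (fun i => x i + (H w' i + A w'' i)).
  by apply: eq_Rintegral => w' _; congr F; apply/funext => i; rewrite addrAC addrA.
by [].
Qed.

Lemma lindeberg_swap N : (forall i, D i -> (bid i < N)%N) ->
  `|\int[P]_w F (restr D (X ^~ w)) - \int[Q]_w F (restr D (G ^~ w))| <= \sum_(b < N) err b.
Proof.
move=> hN.
have -> : \int[P]_w F (restr D (X ^~ w)) = hybrid N.
  apply: eq_Rintegral => w _; rewrite /smooth.
  (* A vacuous integral over the other space gives the left-hand side the shape of a hybrid. *)
  rewrite -[LHS](Rintegral_prob_cst Q); apply: eq_Rintegral => w' _; congr F.
  apply/funext => i; rewrite /restr /above /below.
  case: (boolP (D i)) => [/hN iN|_]; last by rewrite addr0.
  by rewrite iN leqNgt iN addr0.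
have -> : \int[Q]_w F (restr D (G ^~ w)) = hybrid 0.
  rewrite -[LHS](Rintegral_prob_cst P); apply: eq_Rintegral => w' _.
  apply: eq_Rintegral => w _; congr F.
  apply/funext => i; rewrite /restr /above /below ltn0 andbF add0r.
  by rewrite leq0n andbT.
elim: {hN} N => [|N IH]; first by rewrite big_ord0 subrr normr0.
rewrite big_ord_recr /= addrC.
apply: le_trans (lerD (hybrid_step N) IH).
by rewrite -[X in `|X|](subrKA (hybrid N)); exact: ler_normD.
Qed.

End lindeberg_swap.

(** * Truncated second moments and the Taylor remainder of one block *)

Definition tail_sqr (R : realType) (t x : R) : R := if t < `|x| then x ^+ 2 else 0.

Lemma tail_sqr_ge0 (R : realType) (t x : R) : 0 <= tail_sqr t x.
Proof. by rewrite /tail_sqr; case: ifP => // _; exact: sqr_ge0. Qed.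

Lemma tail_sqr_le (R : realType) (t x : R) : tail_sqr t x <= x ^+ 2.
Proof. by rewrite /tail_sqr; case: ifP => // _; exact: sqr_ge0. Qed.

Lemma sqr_le_tail (R : realType) (t x : R) : 0 <= t -> x ^+ 2 <= t ^+ 2 + tail_sqr t x.
Proof.
move=> t0; rewrite /tail_sqr; case: ltP => [_|h]; first by rewrite lerDr sqr_ge0.
by rewrite addr0 -(real_normK (num_real x)) ler_sqr ?nnegrE.
Qed.

Lemma measurable_tail_sqr (R : realType) (t : R) : measurable_fun setT (tail_sqr t).
Proof.
apply: measurable_fun_ifT => //.
by apply: measurable_fun_ltr => //; exact: measurableT_comp.
Qed.

Section tail_sqr_integral.
Context d (T : measurableType d) (R : realType) (P : probability T R).
Variable Y : T -> R.
Hypothesis mY : measurable_fun setT Y.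
Hypothesis sqY : P.-integrable setT (EFin \o (fun w => Y w ^+ 2)).

Lemma tail_sqr_integrable t : P.-integrable setT (EFin \o (fun w => tail_sqr t (Y w))).
Proof.
apply: (@le_integrable _ _ _ _ _ _ _ (EFin \o (fun w => Y w ^+ 2))) => //.
- by apply/measurable_EFinP; apply: measurableT_comp => //; exact: measurable_tail_sqr.
- move=> w _ /=; rewrite lee_fin [leRHS]ger0_norm ?sqr_ge0 // ger0_norm ?tail_sqr_ge0 //.
  exact: tail_sqr_le.
Qed.

Lemma Rintegral_tail_sqr_ge0 t : 0 <= \int[P]_w tail_sqr t (Y w).
Proof. by apply: Rintegral_ge0 => w _; exact: tail_sqr_ge0. Qed.

Lemma Rintegral_sqr_le_tail t : 0 <= t ->
  \int[P]_w (Y w ^+ 2) <= t ^+ 2 + \int[P]_w tail_sqr t (Y w).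
Proof.
move=> t0; have it := tail_sqr_integrable t.
rewrite -[X in _ <= X + _](Rintegral_prob_cst P) -RintegralD //; last exact: integrable_EFin_cst.
apply: le_Rintegral => //.
- by apply: integrable_EFinD => //; exact: integrable_EFin_cst.
- by move=> w _; exact: sqr_le_tail.
Qed.

Lemma Rintegral_tail_sqr_le t : \int[P]_w tail_sqr t (Y w) <= \int[P]_w (Y w ^+ 2).
Proof.
apply: le_Rintegral => //; first exact: tail_sqr_integrable.
by move=> w _; exact: tail_sqr_le.
Qed.

End tail_sqr_integral.

(** The threshold is s = del^2. Below it sqrt s <= del and the cubic bound gains the small factor
    [del]; above it the large entries dominate s and the quadratic bound is affordable. *)
Lemma taylor_remainder_split (R : realType) (I : finType) (a : pred I) (x : I -> R)
    (k c1 c2 r t del : R) (N : nat) : 0 <= k -> 0 <= c1 -> 0 <= c2 -> 0 <= t -> 0 <= del ->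
  (#|a| <= N)%N -> 2 * N%:R * (k * t ^+ 2) <= del ^+ 2 ->
  let s := k * \sum_(u | a u) x u ^+ 2 in
  r <= c1 * s -> r <= c2 * (s * Num.sqrt s) ->
  r <= c2 * del * s + 2 * c1 * (k * \sum_(u | a u) tail_sqr t (x u)).
Proof.
move=> k0 c10 c20 t0 del0 aN hdel s r1 r2.
have s0 : 0 <= s by rewrite mulr_ge0 // sumr_ge0 // => u _; exact: sqr_ge0.
set b := k * \sum_(u | a u) tail_sqr t (x u).
have b0 : 0 <= b by rewrite mulr_ge0 // sumr_ge0 // => u _; exact: tail_sqr_ge0.
have [sd|sd] := leP s (del ^+ 2).
  apply: le_trans r2 _; rewrite -[leLHS]addr0 lerD //; last by apply: mulr_ge0 => //; exact: mulr_ge0.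
  rewrite -mulrA ler_wpM2l // mulrC ler_wpM2r //.
  by rewrite -(ger0_norm del0) -sqrtr_sqr ler_wsqrtr.
have sb : s <= k * (N%:R * t ^+ 2) + b.
  rewrite -mulrDr ler_wpM2l //.
  apply: le_trans (_ : \sum_(u | a u) (t ^+ 2 + tail_sqr t (x u)) <= _).
    by apply: ler_sum => u _; exact: sqr_le_tail.
  rewrite big_split /= lerD2r sumr_const -[leLHS]mulr_natl.
  by apply: ler_wpM2r; rewrite ?sqr_ge0 // ler_nat.
(* Beyond the threshold the entries bounded by [t] carry at most half of [s]. *)
have sb2 : s <= 2 * b.
  have -> : 2 * b = b + b by ring.
  have h : 2 * (k * (N%:R * t ^+ 2)) < s.
    by apply: le_lt_trans sd; apply: le_trans hdel; rewrite le_eqVlt; apply/orP; left; apply/eqP; ring.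
  lra.
apply: le_trans r1 _; rewrite -[leLHS]add0r lerD //; first by apply: mulr_ge0 => //; exact: mulr_ge0.
have -> : 2 * c1 * b = c1 * (2 * b) by ring.
exact: ler_wpM2l.
Qed.

Section block_taylor.
Variables (R : realType) (n : nat) (z : R[i]).
Hypothesis hz : 0 < complex.Im z.
Variables (re : bool) (a : pred ('I_n * 'I_n)) (t del : R) (N : nat).
Hypothesis aD : forall u, a u -> u \in lower_triangle n.
Hypothesis aN : (#|a| <= N)%N.
Hypothesis t0 : 0 <= t.
Hypothesis del0 : 0 <= del.
Hypothesis hdel : 2 * N%:R * (2 / n%:R * t ^+ 2) <= del ^+ 2.
Local Notation y := (complex.Im z).
Local Notation f := (pst z re).
Local Notation state := ('I_n * 'I_n -> R).
Local Notation k := (2 / n%:R : R).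
Let c1 : R := 2 / y ^+ 3 / n%:R.
Let c2 : R := (y ^+ 4)^-1 / n%:R.

Lemma tri_norm2_restr (x : state) : tri_norm2 (restr a x) = k * \sum_(u | a u) x u ^+ 2.
Proof.
rewrite /tri_norm2; congr (_ * _); rewrite big_mkcond [RHS]big_mkcond.
apply: eq_bigr => u _; rewrite /restr; case: (boolP (a u)) => [/aD ->//|_].
by rewrite expr0n /= if_same.
Qed.

Definition block_error d (T : measurableType d) (P : probability T R)
    (Y : 'I_n * 'I_n -> T -> R) : R :=
  c2 * del * (k * \sum_(u | a u) \int[P]_w (Y u w ^+ 2)) +
  2 * c1 * (k * \sum_(u | a u) \int[P]_w tail_sqr t (Y u w)).

(** The linear term has mean zero and the quadratic one involves only covariances inside the block.
    The coefficients are parameters, so that X and G share the same expansion at W. *)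
Lemma taylor_expectation d (T : measurableType d) (P : probability T R)
    (Y : 'I_n * 'I_n -> T -> R) (W : state) (A : state)
    (q : 'I_n * 'I_n -> 'I_n * 'I_n -> R) :
  (forall u, measurable_fun setT (Y u)) ->
  (forall u, P.-integrable setT (EFin \o (fun w => Y u w ^+ 2))) ->
  (forall u, (\int[P]_w (Y u w)%:E = 0)%E) ->
  (forall h, let r := `|f (fun u => W u + h u) -
    (f W + \sum_(u in lower_triangle n) A u * h u
      + \sum_(u in lower_triangle n) \sum_(v in lower_triangle n)
          q u v * (h u * h v))| in
   r <= c1 * tri_norm2 h /\ r <= c2 * (tri_norm2 h * Num.sqrt (tri_norm2 h))) ->
  `|\int[P]_w f (fun u => W u + restr a (Y ^~ w) u) -
    (f W + \sum_(u in lower_triangle n) \sum_(v in lower_triangle n)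
       q u v * (if a u && a v then \int[P]_w (Y u w * Y v w) else 0))| <= block_error P Y.
Proof.
move=> mY sqY mean0 taylor.
have iY u : P.-integrable setT (EFin \o Y u) by exact: square_integrable.
have iYY u v : P.-integrable setT (EFin \o (fun w => Y u w * Y v w)).
  exact: integrable_mul.
have irY u : P.-integrable setT (EFin \o (fun w => restr a (Y ^~ w) u)).
  rewrite /restr; case: (a u) => //; exact: integrable_EFin_cst.
have irYY u v : P.-integrable setT
    (EFin \o (fun w => restr a (Y ^~ w) u * restr a (Y ^~ w) v)).
  rewrite /restr; case: (a u); case: (a v) => //=.
  - by under eq_fun do rewrite mulr0; exact: integrable_EFin_cst.
  - by under eq_fun do rewrite mul0r; exact: integrable_EFin_cst.
  - by under eq_fun do rewrite mul0r; exact: integrable_EFin_cst.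
pose lin w := \sum_(u in lower_triangle n) A u * restr a (Y ^~ w) u.
pose quad w := \sum_(u in lower_triangle n) \sum_(v in lower_triangle n)
  q u v * (restr a (Y ^~ w) u * restr a (Y ^~ w) v).
have iAr u : P.-integrable setT (EFin \o (fun w => A u * restr a (Y ^~ w) u)).
  exact: integrable_EFinZ.
have iqr u v : P.-integrable setT
    (EFin \o (fun w => q u v * (restr a (Y ^~ w) u * restr a (Y ^~ w) v))).
  exact: integrable_EFinZ.
have ilin : P.-integrable setT (EFin \o lin) by exact: integrable_EFin_sum.
have iquad : P.-integrable setT (EFin \o quad).
  by apply: integrable_EFin_sum => u; exact: integrable_EFin_sum.
have Elin : \int[P]_w lin w = 0.
  rewrite Rintegral_sum // big1 // => u _; rewrite RintegralZl // /restr.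
  by case: (a u); rewrite ?Rintegral_prob_cst ?mulr0 // /Rintegral mean0 mulr0.
have Equad : \int[P]_w quad w =
    \sum_(u in lower_triangle n) \sum_(v in lower_triangle n)
       q u v * (if a u && a v then \int[P]_w (Y u w * Y v w) else 0).
  rewrite Rintegral_sum => [|u]; last exact: integrable_EFin_sum.
  apply: eq_bigr => u _; rewrite Rintegral_sum //; apply: eq_bigr => v _.
  rewrite RintegralZl //; congr (_ * _); rewrite /restr.
  by case: (a u); case: (a v) => //=; [under eq_Rintegral do rewrite mulr0
    |under eq_Rintegral do rewrite mul0r|under eq_Rintegral do rewrite mul0r];
    rewrite Rintegral_prob_cst.
pose F w := f (fun u => W u + restr a (Y ^~ w) u).
have mF : measurable_fun setT F.
  apply: (@pst_measurable _ _ _ hz re) => u; apply: measurable_funD; first exact: measurable_cst.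
  exact: measurable_restr.
have iF : P.-integrable setT (EFin \o F).
  by apply: (@bounded_integrable _ _ _ _ _ y^-1) => // w; exact: pst_bound.
have imain : P.-integrable setT (EFin \o (fun w => f W + lin w + quad w)).
  by do 2! apply: integrable_EFinD => //; exact: integrable_EFin_cst.
have -> : \int[P]_w F w - (f W + \sum_(u in lower_triangle n) \sum_(v in lower_triangle n)
       q u v * (if a u && a v then \int[P]_w (Y u w * Y v w) else 0)) =
    \int[P]_w (F w - (f W + lin w + quad w)).
  rewrite RintegralB // RintegralD //; last first.
    by apply: integrable_EFinD => //; exact: integrable_EFin_cst.
  rewrite RintegralD //; last exact: integrable_EFin_cst.
  by rewrite Elin Equad Rintegral_prob_cst addr0.
have iR := integrable_EFinB iF imain.
apply: le_trans (le_normr_Rintegral _ iR) _ => //.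
pose E w := c2 * del * (k * \sum_(u | a u) (Y u w ^+ 2)) +
  2 * c1 * (k * \sum_(u | a u) tail_sqr t (Y u w)).
have itail u : P.-integrable setT (EFin \o (fun w => tail_sqr t (Y u w))).
  exact: tail_sqr_integrable.
have is1 : P.-integrable setT (EFin \o (fun w => \sum_(u | a u) (Y u w ^+ 2))).
  exact: integrable_EFin_sum.
have is2 : P.-integrable setT (EFin \o (fun w => \sum_(u | a u) tail_sqr t (Y u w))).
  exact: integrable_EFin_sum.
have iE : P.-integrable setT (EFin \o E).
  by apply: integrable_EFinD; do 2! apply: integrable_EFinZ.
have -> : block_error P Y = \int[P]_w E w.
  rewrite RintegralD //; [|by do 2! apply: integrable_EFinZ..].
  rewrite !RintegralZl //; [|by apply: integrable_EFinZ..].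
  by rewrite !Rintegral_sum.
apply: le_Rintegral => //.
  have := integrable_norm iR.
  by apply: eq_integrable.
move=> w _.
have [r1 r2] := taylor (restr a (Y ^~ w)).
rewrite !tri_norm2_restr in r1 r2.
apply: (taylor_remainder_split _ _ _ t0 del0 aN hdel r1 r2).
- by rewrite divr_ge0.
- by rewrite !divr_ge0 // exprn_ge0 // ltW.
- by rewrite divr_ge0 // invr_ge0 exprn_ge0 // ltW.
Qed.

End block_taylor.

Lemma block_swap (R : realType) (n : nat) (z : R[i]) (re : bool) (a : pred ('I_n * 'I_n))
    (t del : R) (N : nat) d1 d2 (T1 : measurableType d1) (T2 : measurableType d2)
    (P : probability T1 R) (Q : probability T2 R)
    (X : 'I_n * 'I_n -> T1 -> R) (G : 'I_n * 'I_n -> T2 -> R) (W : 'I_n * 'I_n -> R) :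
  0 < complex.Im z -> (forall u, a u -> u \in lower_triangle n) -> (#|a| <= N)%N ->
  0 <= t -> 0 <= del -> 2 * N%:R * (2 / n%:R * t ^+ 2) <= del ^+ 2 ->
  (forall u, measurable_fun setT (X u)) -> (forall u, measurable_fun setT (G u)) ->
  (forall u, P.-integrable setT (EFin \o (fun w => X u w ^+ 2))) ->
  (forall u, Q.-integrable setT (EFin \o (fun w => G u w ^+ 2))) ->
  (forall u, (\int[P]_w (X u w)%:E = 0)%E) -> (forall u, (\int[Q]_w (G u w)%:E = 0)%E) ->
  (forall u v, a u -> a v -> \int[Q]_w (G u w * G v w) = \int[P]_w (X u w * X v w)) ->
  `|\int[P]_w pst z re (fun u => W u + restr a (X ^~ w) u) -
    \int[Q]_w pst z re (fun u => W u + restr a (G ^~ w) u)| <=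
  block_error z a t del P X + block_error z a t del Q G.
Proof.
move=> hz aD aN t0 del0 hdel mX mG sqX sqG mean_X mean_G cov.
have [A [q taylor]] := pst_taylor hz re W.
have hX := taylor_expectation hz aD aN t0 del0 hdel mX sqX mean_X taylor.
have hG := taylor_expectation hz aD aN t0 del0 hdel mG sqG mean_G taylor.
move: hX hG; set EX := \int[P]_w _; set EG := \int[Q]_w _.
set MX := _ + \sum_(u in _) _; set MG := _ + \sum_(u in _) _.
have -> : MG = MX.
  congr (_ + _); apply: eq_bigr => u _; apply: eq_bigr => v _; congr (_ * _).
  by case: ifP => // /andP[au av]; exact: cov.
move=> hX hG; apply: le_trans (ler_distD MX EX EG) _.
by rewrite [X in _ + X]distrC; exact: lerD.
Qed.

(** * Cells *)

Section cells.
Variables (n K L : nat).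
Hypothesis K0 : (0 < K)%N.
Hypothesis L0 : (0 < L)%N.
Local Notation m := (L + K)%N.
Local Notation index := ('I_n * 'I_n)%type.
Implicit Types (s : nat) (u v : index).

Definition in_cell s u : bool :=
  [&& u \in lower_triangle n, ((u.1 + s) %% m < L)%N & ((u.2 + s) %% m < L)%N].

(** The two grid coordinates are encoded as a number in base n + s, which exceeds both of them. *)
Definition cell s u : nat := ((u.1 + s) %/ m * (n + s) + (u.2 + s) %/ m)%N.

Let cell_coord_lt s (i : 'I_n) : ((i + s) %/ m < n + s)%N.
Proof. by apply: leq_ltn_trans (leq_div _ _) _; rewrite ltn_add2r. Qed.

Lemma cell_eq s u v : cell s u = cell s v ->
  ((u.1 + s) %/ m = (v.1 + s) %/ m)%N /\ ((u.2 + s) %/ m = (v.2 + s) %/ m)%N.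
Proof.
have p : (0 < n + s)%N by apply: leq_ltn_trans (cell_coord_lt s u.1).
move=> e; split.
  have := congr1 (fun k => (k %/ (n + s))%N) e.
  by rewrite /cell !divnMDl // !(divn_small (cell_coord_lt _ _)) !addn0.
have := congr1 (fun k => (k %% (n + s))%N) e.
by rewrite /cell !modnMDl !modn_small.
Qed.

Lemma cell_lt s u : (cell s u < (n + s).+1 * (n + s))%N.
Proof.
rewrite /cell mulSn addnC; have := cell_coord_lt s u.1; have := cell_coord_lt s u.2.
move: (_ %/ _)%N (_ %/ _)%N => a b h1 h2.
by rewrite -addSn leq_add // leq_mul // ltnW.
Qed.

(** Distinct cells differ in a row or a column quotient, and the maximum distance needs only one far
    coordinate. *)
Lemma cell_separated s u v : in_cell s u -> in_cell s v -> cell s u != cell s v ->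
  (K < index_dist u v)%N.
Proof.
rewrite /index_dist leq_max.
have gap (i j : 'I_n) : ((i + s) %% m < L)%N -> ((j + s) %% m < L)%N ->
    ((i + s) %/ m)%N != ((j + s) %/ m)%N -> (K < `|(i : nat)%:Z - (j : nat)%:Z|)%N.
  move=> hi hj; rewrite neq_ltn => /orP[] h.
    by move: (divn_gap hi h (leqnn _)); rewrite addnAC ltn_add2r; clear; lia.
  by move: (divn_gap hj h (leqnn _)); rewrite addnAC ltn_add2r; clear; lia.
case/and3P=> _ u1 u2 /and3P[_ v1 v2] ne.
have [e1|ne1] := eqVneq ((u.1 + s) %/ m)%N ((v.1 + s) %/ m)%N; last first.
  by rewrite gap.
rewrite orbC gap //; apply: contra ne => /eqP e2.
by rewrite /cell e1 e2.
Qed.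

(** Inside a cell the quotients are fixed, so the two residues, both below L, determine the
    index. *)
Lemma card_cell s b : (#|level (in_cell s) (cell s) b| <= L * L)%N.
Proof.
pose f u : 'I_L.-1.+1 * 'I_L.-1.+1 := (inord ((u.1 + s) %% m), inord ((u.2 + s) %% m)).
have LE : L.-1.+1 = L by rewrite prednK.
have fI : {in level (in_cell s) (cell s) b &, injective f}.
  move=> u v /andP[/and3P[_ u1 u2] /eqP bu] /andP[/and3P[_ v1 v2] /eqP bv] [e1 e2].
  have [q1 q2] := cell_eq (etrans bu (esym bv)).
  have {}e1 : ((u.1 + s) %% m = (v.1 + s) %% m)%N.
    by rewrite -(@inordK L.-1 ((u.1 + s) %% m)) ?e1 ?inordK ?LE.
  have {}e2 : ((u.2 + s) %% m = (v.2 + s) %% m)%N.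
    by rewrite -(@inordK L.-1 ((u.2 + s) %% m)) ?e2 ?inordK ?LE.
  have r1 : u.1 = v.1 :> nat.
    by apply/eqP; rewrite -(eqn_add2r s) (divn_eq (u.1 + s) m) (divn_eq (v.1 + s) m) q1 e1.
  have r2 : u.2 = v.2 :> nat.
    by apply/eqP; rewrite -(eqn_add2r s) (divn_eq (u.2 + s) m) (divn_eq (v.2 + s) m) q2 e2.
  case: u v r1 r2 {u1 u2 v1 v2 bu bv q1 q2 e1 e2} => [u1 u2] [v1 v2] /= r1 r2.
  by congr (_, _); apply: val_inj.
by apply: leq_trans (leq_card_in _ _ fI) _; rewrite card_prod !card_ord LE.
Qed.

(** Over a full period of shifts the residue of i + s takes each value once, and only K values are
    at least L. *)
Lemma card_gap_shifts (i : nat) : (#|[set s : 'I_m | (L <= (i + s) %% m)%N]%SET| <= K)%N.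
Proof.
pose f (s : 'I_m) : 'I_K.-1.+1 := inord ((i + s) %% m - L).
have m0 : (0 < m)%N by rewrite addn_gt0 L0.
have bnd (s : 'I_m) : (L <= (i + s) %% m)%N -> ((i + s) %% m - L < K.-1.+1)%N.
  by move=> h; have := ltn_pmod (i + s) m0; rewrite prednK //; lia.
have fI : {in [set s : 'I_m | (L <= (i + s) %% m)%N]%SET &, injective f}.
  move=> s s'; rewrite !inE => h h' e.
  have {}e : ((i + s) %% m - L = (i + s') %% m - L)%N.
    by rewrite -(inordK (bnd _ h)) -(inordK (bnd _ h')); congr nat_of_ord.
  apply: val_inj => /=; rewrite -(modn_small (ltn_ord s)) -(modn_small (ltn_ord s')).
  apply/eqP; rewrite -(eqn_modDl i); apply/eqP.
  by rewrite -(subnK h) -(subnK h') e.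
by apply: leq_trans (leq_card_in _ _ fI) _; rewrite card_ord prednK.
Qed.

(** Averaging: among the m shifts an index is lost at most K times through its row and K times
    through its column, so the best shift loses at most the fraction 2 K / m of the total. *)
Lemma exists_shift (R : realType) (g : index -> R) : (forall u, 0 <= g u) -> exists s,
  \sum_(u in lower_triangle n | ~~ in_cell s u) g u <=
  2 * K%:R / m%:R * \sum_(u in lower_triangle n) g u.
Proof.
move=> g0.
have m0 : (0 < m)%N by rewrite addn_gt0 L0.
pose gap (s : 'I_m) := \sum_(u in lower_triangle n | ~~ in_cell s u) g u.
have total : \sum_s gap s <= 2 * K%:R * \sum_(u in lower_triangle n) g u.
  rewrite /gap; under eq_bigr do rewrite big_mkcondr.
  rewrite exchange_big /= mulr_sumr; apply: ler_sum => u uD.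
  rewrite -big_mkcond sumr_const -[leLHS]mulr_natl ler_wpM2r // -natrM ler_nat mul2n -addnn.
  apply: leq_trans (leq_add (card_gap_shifts u.1) (card_gap_shifts u.2)).
  apply: leq_trans (leq_card_setU _ _); apply: subset_leq_card; apply/fintype.subsetP => s.
  by rewrite unfold_in /in_cell uD /= negb_and -!leqNgt !inE.
pose s0 : 'I_m := Ordinal m0.
case: (@Order.TotalTheory.arg_minP _ _ _ s0 predT gap isT) => s _ smin.
exists s; rewrite mulrAC ler_pdivlMr ?ltr0n //.
apply: le_trans total; rewrite mulr_natr -[X in _ *+ X]card_ord -sumr_const.
by apply: ler_sum => s' _; exact: smin.
Qed.

End cells.

(** The right-hand side is affine in s: a Lipschitz bound containing a square root can thus be
    integrated knowing second moments only. *)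
Lemma sqrt_le_amgm (R : realType) (s del : R) : 0 <= s -> 0 < del ->
  Num.sqrt s <= s / del + del.
Proof.
move=> s0 d0; rewrite -(@ler_pM2r _ del) // mulrDl divfK ?gt_eqF //.
rewrite -{2}(sqr_sqrtr s0); have := sqrtr_ge0 s; move: (Num.sqrt s) => a a0.
by have := sqr_ge0 (a - del); have := sqr_ge0 (a + del); nra.
Qed.

Lemma Rintegral_pst_restr (R : realType) (n : nat) (z : R[i]) (re : bool)
    d (T : measurableType d) (P : probability T R) (Y : 'I_n * 'I_n -> T -> R)
    (e : pred ('I_n * 'I_n)) (del : R) :
  0 < complex.Im z -> 0 < del ->
  (forall u, measurable_fun setT (Y u)) ->
  (forall u, P.-integrable setT (EFin \o (fun w => Y u w ^+ 2))) ->
  `|\int[P]_w pst z re (Y ^~ w) - \int[P]_w pst z re (restr e (Y ^~ w))| <=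
  (2 / n%:R / n%:R * (\sum_(u in lower_triangle n | ~~ e u) \int[P]_w (Y u w ^+ 2)) / del + del)
     / complex.Im z ^+ 2.
Proof.
move=> hz del0 mY sqY; set y := complex.Im z.
have y2 : 0 < y ^+ 2 by rewrite exprn_gt0.
have i1 : P.-integrable setT (EFin \o (fun w => pst z re (Y ^~ w))).
  apply: (@bounded_integrable _ _ _ _ _ y^-1) => [|w]; last exact: pst_bound.
  exact: (@pst_measurable _ _ _ hz re).
have i2 : P.-integrable setT (EFin \o (fun w => pst z re (restr e (Y ^~ w)))).
  apply: (@bounded_integrable _ _ _ _ _ y^-1) => [|w]; last exact: pst_bound.
  by apply: (@pst_measurable _ _ _ hz re) => u; exact: measurable_restr.
have iB := integrable_EFinB i1 i2.
rewrite -RintegralB //; apply: le_trans (le_normr_Rintegral _ iB) _ => //.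
pose S w := \sum_(u in lower_triangle n | ~~ e u) (Y u w ^+ 2).
have iS : P.-integrable setT (EFin \o S) by exact: integrable_EFin_sum.
pose E w := (2 / n%:R / n%:R / del / y ^+ 2) * S w + del / y ^+ 2.
have iE : P.-integrable setT (EFin \o E).
  by apply: integrable_EFinD; [exact: integrable_EFinZ|exact: integrable_EFin_cst].
have -> : (2 / n%:R / n%:R * (\sum_(u in lower_triangle n | ~~ e u) \int[P]_w (Y u w ^+ 2)) / del
    + del) / y ^+ 2 = \int[P]_w E w.
  rewrite RintegralD //; [|exact: integrable_EFinZ|exact: integrable_EFin_cst].
  rewrite Rintegral_prob_cst RintegralZl // /S Rintegral_sum // [LHS]mulrDl; congr (_ + _).
  by move: (\sum_(_ in _ | _) _) => s; move: (_^-1) (_^-1) (_^-1) => a b c; ring.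
apply: le_Rintegral => //.
  by have := integrable_norm iB; apply: eq_integrable.
move=> w _; apply: le_trans (pst_lipschitz hz _ _ _) _.
have tri : tri_norm2 (fun u => Y u w - restr e (Y ^~ w) u) / n%:R = 2 / n%:R / n%:R * S w.
  rewrite /tri_norm2 /S mulrAC; congr (_ * _); rewrite big_mkcondr; apply: eq_bigr => u _.
  by rewrite /restr; case: (e u) => /=; rewrite ?subrr ?subr0 // expr0n.
rewrite tri /E; have -> : 2 / n%:R / n%:R / del / y ^+ 2 * S w + del / y ^+ 2 =
    (2 / n%:R / n%:R * S w / del + del) / y ^+ 2.
  by move: (S w) => s; move: (_^-1) (_^-1) (_^-1) => a b c; ring.
rewrite ler_pM2r ?invr_gt0 //; apply: sqrt_le_amgm => //.
apply: mulr_ge0; first by rewrite !divr_ge0.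
by apply: sumr_ge0 => u _; exact: sqr_ge0.
Qed.

Lemma sum_levels (R : realType) (I : finType) (D : pred I) (bid : I -> nat) (g : I -> R) N :
  (forall u, D u -> (bid u < N)%N) ->
  \sum_(b < N) \sum_(u | level D bid b u) g u = \sum_(u | D u) g u.
Proof.
move=> hN; under eq_bigr do rewrite big_mkcond.
rewrite exchange_big [RHS]big_mkcond; apply: eq_bigr => u _.
rewrite -big_mkcond /level; case: (boolP (D u)) => [/hN uN|_]; last by rewrite big_pred0.
by apply: (big_pred1 (Ordinal uN)) => b; rewrite /= -val_eqE eq_sym.
Qed.

(** * Truncated second moment of a Gaussian variable *)

Section gaussian_tail.
Context d (T : measurableType d) (R : realType) (P : probability T R).

Lemma coordinate_law (I : finType) (D : {set I}) (G : I -> T -> R) u :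
  jointly_gaussian P D G -> u \in D -> exists m s, has_gaussian_law P (G u) m s.
Proof.
move=> gaussG uD; have [m [s H]] := gaussG (fun i => (i == u)%:R).
exists m, s => V mV; rewrite -H //; congr (P (_ @^-1` V)); apply/funext => w.
rewrite (bigD1 u) //= eqxx mul1r big1 ?addr0 // => i /andP[_ /negbTE ->].
by rewrite mul0r.
Qed.

Lemma tail_sqr_le4 (t x : R) : 0 < t -> tail_sqr t x <= x ^+ 4 / t ^+ 2.
Proof.
move=> t0; have t2 : 0 < t ^+ 2 by rewrite exprn_gt0.
rewrite ler_pdivlMr // /tail_sqr; case: ltP => [h|_]; last by rewrite mul0r exprn_even_ge0.
have -> : x ^+ 4 = x ^+ 2 * x ^+ 2 by rewrite -exprD.
apply: ler_wpM2l; first exact: sqr_ge0.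
by rewrite -[leRHS](real_normK (num_real x)) ler_sqr ?nnegrE // ltW.
Qed.

(** If the variance is at most 2 e it bounds the tail by itself. Otherwise it is at most 2 (eta
    v)^2, and the fourth moment divided by (tau v)^2 gives the first term. In the application e is
    the truncated second moment of the matching entry of X, which is how G inherits the Lindeberg
    condition. *)
Lemma gaussian_tail_sqr (Z : T -> R) m s (tau eta v e : R) :
  measurable_fun setT Z ->
  has_gaussian_law P Z m s ->
  (\int[P]_w (Z w)%:E = 0)%E -> P.-integrable setT (EFin \o (fun w => Z w ^+ 2)) ->
  0 < tau -> 0 < eta -> 0 < v -> 0 <= e ->
  \int[P]_w (Z w ^+ 2) <= (eta * v) ^+ 2 + e ->
  \int[P]_w tail_sqr (tau * v) (Z w) <=
  2 * kurtosis R * (eta / tau) ^+ 2 * \int[P]_w (Z w ^+ 2) + 2 * e.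
Proof.
move=> mZ lawZ Z0 Z2 tau0 eta0 v0 e0; set sg := \int[P]_w (Z w ^+ 2) => hsg.
have [k2 k4] := normal_moment_fine R.
have kap0 : 0 <= kurtosis R by rewrite divr_ge0 // sqr_ge0.
have sg0 : 0 <= sg by apply: Rintegral_ge0 => w _; exact: sqr_ge0.
have [le_e|lt_e] := leP sg (2 * e).
  apply: le_trans (Rintegral_tail_sqr_le mZ Z2 _) _; apply: le_trans le_e _.
  by rewrite lerDr; apply: mulr_ge0 => //; apply: mulr_ge0; [exact: mulr_ge0|exact: sqr_ge0].
have sgle : sg <= 2 * (eta * v) ^+ 2 by lra.
have i4 : P.-integrable setT (EFin \o (fun w => Z w ^+ 4)).
  apply/integrableP; split.
    by apply/measurable_EFinP; exact: measurable_funX.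
  under eq_integral do rewrite /= ger0_norm ?exprn_even_ge0 //.
  by rewrite (gaussian_moment4 mZ lawZ Z0 Z2) ltry.
have tv : 0 < (tau * v) ^+ 2 by rewrite exprn_gt0 // mulr_gt0.
have h4 : \int[P]_w tail_sqr (tau * v) (Z w) <= kurtosis R * sg ^+ 2 / (tau * v) ^+ 2.
  have -> : kurtosis R * sg ^+ 2 / (tau * v) ^+ 2 = \int[P]_w (Z w ^+ 4 / (tau * v) ^+ 2).
    under [RHS]eq_Rintegral do rewrite mulrC.
    rewrite RintegralZl // mulrC; congr (_ * _).
    by rewrite /Rintegral (gaussian_moment4 mZ lawZ Z0 Z2).
  apply: le_Rintegral => //; first exact: tail_sqr_integrable.
    exact: integrable_EFinZr.
  by move=> w _; apply: tail_sqr_le4; rewrite mulr_gt0.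
apply: le_trans h4 _; rewrite -[leLHS]addr0 lerD ?mulr_ge0 //.
rewrite ler_pdivrMr // .
have -> : 2 * kurtosis R * (eta / tau) ^+ 2 * sg * (tau * v) ^+ 2 =
    kurtosis R * sg * (2 * (eta * v) ^+ 2) by field; rewrite gt_eqF.
have -> : kurtosis R * sg ^+ 2 = kurtosis R * sg * sg by ring.
by apply: ler_wpM2l => //; exact: mulr_ge0.
Qed.

End gaussian_tail.

(** * Comparison of the two expectations at fixed n *)

Section comparison.
Context d1 d2 (T1 : measurableType d1) (T2 : measurableType d2) (R : realType).
Variables (P : probability T1 R) (Q : probability T2 R) (n K L : nat).
Variables (X : 'I_n * 'I_n -> T1 -> R) (G : 'I_n * 'I_n -> T2 -> R).
Variables (z : R[i]) (re : bool) (C del tau eta : R).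
Hypothesis hz : 0 < complex.Im z.
Hypothesis n0 : (0 < n)%N.
Hypothesis K0 : (0 < K)%N.
Hypothesis L0 : (0 < L)%N.
Hypothesis del0 : 0 < del.
Hypothesis tau0 : 0 < tau.
Hypothesis eta0 : 0 < eta.
Hypothesis mX : forall u, measurable_fun setT (X u).
Hypothesis mG : forall u, measurable_fun setT (G u).
Hypothesis sqX : forall u, P.-integrable setT (EFin \o (fun w => X u w ^+ 2)).
Hypothesis sqG : forall u, Q.-integrable setT (EFin \o (fun w => G u w ^+ 2)).
Hypothesis meanX : forall u, (\int[P]_w (X u w)%:E = 0)%E.
Hypothesis meanG : forall u, (\int[Q]_w (G u w)%:E = 0)%E.
Hypothesis cov : forall u v, u \in lower_triangle n -> v \in lower_triangle n ->
  \int[Q]_w (G u w * G v w) = \int[P]_w (X u w * X v w).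
Hypothesis gaussG : jointly_gaussian Q (lower_triangle n) G.
Hypothesis indX : far_independent P K X.
Hypothesis varX : (n%:R ^- 2) * \sum_(u in lower_triangle n) \int[P]_w (X u w ^+ 2) <= C.

Local Notation y := (complex.Im z).
Local Notation f := (@pst R n z re).
Local Notation m := (L + K)%N.

Definition lindeberg_sum (t : R) : R :=
  (n%:R ^- 2) * \sum_(u in lower_triangle n) \int[P]_w tail_sqr (t * Num.sqrt n%:R) (X u w).

Let sqrn0 : 0 < Num.sqrt n%:R :> R.
Proof. by rewrite sqrtr_gt0 ltr0n. Qed.

Let variance u : u \in lower_triangle n -> \int[Q]_w (G u w ^+ 2) = \int[P]_w (X u w ^+ 2).
Proof. by move=> uD; exact: cov. Qed.

(** [gaussian_decouple] asks for a Lipschitz bound in the l1 norm; the size of the constant is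
    immaterial, as it does not enter the resulting identity. *)
Let lipschitz_l1 : exists2 lip : R, 0 <= lip &
  forall x x', `|f x - f x'| <= lip * \sum_i `|x i - x' i|.
Proof.
exists (Num.sqrt (2 / n%:R / n%:R) / y ^+ 2) => [|x x'].
  by rewrite divr_ge0 ?sqrtr_ge0 // sqr_ge0.
apply: le_trans (pst_lipschitz hz _ _ _) _.
rewrite [leRHS]mulrAC ler_pM2r ?invr_gt0 ?exprn_gt0 //.
have c0 : 0 <= 2 / n%:R / n%:R :> R by rewrite !divr_ge0.
have s0 : 0 <= \sum_i `|x i - x' i| by apply: sumr_ge0.
rewrite -[X in _ <= _ * X](ger0_norm s0) -sqrtr_sqr -sqrtrM // ler_wsqrtr //.
rewrite /tri_norm2 mulrAC ler_wpM2l //.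
apply: le_trans (_ : \sum_i `|x i - x' i| ^+ 2 <= _).
  rewrite big_mkcond; apply: ler_sum => i _; case: ifP => _; last exact: sqr_ge0.
  by rewrite real_normK ?num_real.
rewrite expr2 mulr_suml; apply: ler_sum => i _; rewrite expr2 ler_wpM2l //.
by rewrite (bigD1 i) //= lerDl sumr_ge0.
Qed.

Let cells_close s :
  `|\int[P]_w f (restr (in_cell K L s) (X ^~ w)) - \int[Q]_w f (restr (in_cell K L s) (G ^~ w))|
  <= 8 * L%:R * tau * C / y ^+ 4
     + 8 / y ^+ 3 * (lindeberg_sum tau + 2 * kurtosis R * (eta / tau) ^+ 2 * C + 2 * lindeberg_sum eta).
Proof.
pose D := in_cell (n := n) K L s; pose bid := cell (n := n) K L s.
have Dtri u : D u -> u \in lower_triangle n by case/and3P.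
have lD b u : level D bid b u -> u \in lower_triangle n by case/andP=> /Dtri.
have ind_cell b : independent_sigma_fields P
    (sigma_field [set i | below D bid b i] X) (sigma_field [set i | level D bid b i] X).
  apply: (independent_pred indX) => [p /andP[/Dtri]//|p /lD//|p q].
  move=> /andP[pD pb] /andP[qD /eqP qb]; apply: (@cell_separated n K L s) => //.
  by rewrite neq_ltn -/bid qb pb.
have [lip lip0 lipf] := lipschitz_l1.
pose N := ((n + s).+1 * (n + s))%N.
have bidN u : D u -> (bid u < N)%N by move=> _; exact: cell_lt.
(* With t = tau sqrt n, del = 2 L tau and L^2 indices per cell, 2 L^2 (2 / n) t^2 = 4 L^2 tau^2 =
   del^2: the side condition of [block_swap] is an equality. *)
pose err b := block_error z (level D bid b) (tau * Num.sqrt n%:R) (2 * L%:R * tau) P X +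
  block_error z (level D bid b) (tau * Num.sqrt n%:R) (2 * L%:R * tau) Q G.
have mf : state_measurable f by exact: pst_measurable.
have bf x : `|f x| <= y^-1 by exact: pst_bound.
have decG b (x : 'I_n * 'I_n -> R) :
    \int[Q]_w f (fun i => x i + (restr (level D bid b) (G ^~ w) i
                                 + restr (above D bid b.+1) (G ^~ w) i)) =
    \int[Q]_w \int[Q]_w' f (fun i => x i + (restr (level D bid b) (G ^~ w) i
                                 + restr (above D bid b.+1) (G ^~ w') i)).
  apply: (@gaussian_decouple _ _ _ Q _ (lower_triangle n) G mG sqG meanG gaussG
    (level D bid b) (above D bid b.+1) _ _ _ (fun h => f (fun i => x i + h i)) lip y^-1 lip0).
  - exact: lD.
  - by move=> u /andP[/Dtri].
  (* Entries of G in distinct cells are uncorrelated because the corresponding entries of X are far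
     apart, hence independent and centered. *)
  - move=> u v /andP[uD /eqP ub] /andP[vD vb]; rewrite cov ?Dtri //.
    have indUV : independent_sigma_fields P (sigma_field [set i | i == u] X)
        (sigma_field [set i | i == v] X).
      apply: (independent_pred indX) => [p /eqP->|p /eqP->|p q /eqP-> /eqP->].
      + exact: Dtri.
      + exact: Dtri.
      + apply: (@cell_separated n K L s) => //.
        by rewrite neq_ltn -/bid ub vb.
    have := decouple_product mX indUV (eqxx u) (eqxx v)
      (square_integrable (mX u) (sqX u)) (square_integrable (mX v) (sqX v)).
    by rewrite /Rintegral meanX mul0e => ->.
  - move=> d T Y mY; apply: mf => i; apply: measurable_funD => //; exact: measurable_cst.
  - by move=> h.
  - move=> h h'; apply: le_trans (lipf _ _) _; apply: ler_wpM2l => //; apply: ler_sum => i _.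
    by rewrite opprD addrACA subrr add0r.
have swapb b W : `|\int[P]_w f (fun i => W i + restr (level D bid b) (X ^~ w) i) -
    \int[Q]_w f (fun i => W i + restr (level D bid b) (G ^~ w) i)| <= err b.
  apply: (@block_swap _ _ _ _ _ _ _ (L * L)%N) => //.
  - exact: lD.
  - exact: card_cell.
  - by rewrite mulr_ge0 // ltW.
  - by rewrite !mulr_ge0 // ltW.
  - rewrite [in leLHS]exprMn sqr_sqrtr // natrM.
    rewrite le_eqVlt; apply/orP; left; apply/eqP; field.
    by rewrite pnatr_eq0 -lt0n.
  - by move=> u v /lD uD /lD vD; exact: cov.
apply: le_trans (lindeberg_swap mX mG mf bf ind_cell decG swapb bidN) _.
rewrite /err big_split /=.
have c40 : 0 <= 4 * L%:R * tau / y ^+ 4.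
  by rewrite divr_ge0 ?exprn_ge0 ?(ltW hz) // mulr_ge0 ?(ltW tau0) // mulr_ge0.
have c80 : 0 <= 8 / y ^+ 3 by rewrite divr_ge0 ?exprn_ge0 ?(ltW hz).
(* The cells partition the retained indices. The factor 1 / n of the transform and 2 / n of
   [tri_norm2] combine into the normalisation n^-2 of the hypotheses. *)
have sum_err d (T : measurableType d) (p : probability T R) (Y : 'I_n * 'I_n -> T -> R) :
    \sum_(b < N) block_error z (level D bid b) (tau * Num.sqrt n%:R) (2 * L%:R * tau) p Y <=
    4 * L%:R * tau / y ^+ 4 * (n%:R ^- 2 * \sum_(u in lower_triangle n) \int[p]_w (Y u w ^+ 2)) +
    8 / y ^+ 3 * (n%:R ^- 2 * \sum_(u in lower_triangle n)
       \int[p]_w tail_sqr (tau * Num.sqrt n%:R) (Y u w)).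
  rewrite big_split /= -!mulr_sumr !sum_levels //.
  have sub (g : 'I_n * 'I_n -> R) : (forall u, 0 <= g u) ->
      \sum_(u | D u) g u <= \sum_(u in lower_triangle n) g u.
    move=> g0; rewrite big_mkcond [leRHS]big_mkcond; apply: ler_sum => u _.
    by case: (boolP (D u)) => [/Dtri ->//|_]; case: ifP.
  have := sub (fun u => \int[p]_w (Y u w ^+ 2)) (fun u => Rintegral_ge0 p (fun w _ => sqr_ge0 _)).
  have := sub (fun u => \int[p]_w tail_sqr (tau * Num.sqrt n%:R) (Y u w))
     (fun u => Rintegral_ge0 p (fun w _ => tail_sqr_ge0 _ _)).
  set a' := \sum_(u | D u) _; set b' := \sum_(u in _) _ => ab'.
  set a := \sum_(u | D u) _; set b := \sum_(u in _) _ => ab.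
  have n2 : 0 <= n%:R ^- 2 :> R by rewrite invr_ge0 sqr_ge0.
  have nn : n%:R != 0 :> R by rewrite pnatr_eq0 -lt0n.
  have yn : y != 0 by rewrite gt_eqF.
  have -> : (y ^+ 4)^-1 / n%:R * (2 * L%:R * tau) * (2 / n%:R * a) =
      4 * L%:R * tau / y ^+ 4 * (n%:R ^- 2 * a) by field; rewrite nn yn.
  have -> : 2 * (2 / y ^+ 3 / n%:R) * (2 / n%:R * a') = 8 / y ^+ 3 * (n%:R ^- 2 * a').
    by field; rewrite nn yn.
  by apply: lerD; apply: ler_wpM2l; rewrite ?c40 ?c80 //; exact: ler_wpM2l.
apply: le_trans (lerD (sum_err _ _ _ _) (sum_err _ _ _ _)) _.
have -> : \sum_(u in lower_triangle n) \int[Q]_w (G u w ^+ 2) =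
    \sum_(u in lower_triangle n) \int[P]_w (X u w ^+ 2) by apply: eq_bigr.
have n2 : 0 <= n%:R ^- 2 :> R by rewrite invr_ge0 sqr_ge0.
have [_ k4] := normal_moment_fine R.
have kap0 : 0 <= 2 * kurtosis R * (eta / tau) ^+ 2.
  by rewrite mulr_ge0 ?sqr_ge0 // mulr_ge0 // divr_ge0 // sqr_ge0.
(* [gaussian_tail_sqr] entry by entry: the variance of G equals that of X, which is at most (eta
   sqrt n)^2 plus its part beyond eta sqrt n. *)
have tailG : n%:R ^- 2 * (\sum_(u in lower_triangle n)
      \int[Q]_w tail_sqr (tau * Num.sqrt n%:R) (G u w)) <=
    2 * kurtosis R * (eta / tau) ^+ 2 * C + 2 * lindeberg_sum eta.
  apply: le_trans (_ : 2 * kurtosis R * (eta / tau) ^+ 2 *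
    (n%:R ^- 2 * \sum_(u in lower_triangle n) \int[P]_w (X u w ^+ 2)) + 2 * lindeberg_sum eta <= _).
    rewrite /lindeberg_sum mulrCA [X in _ <= _ + X]mulrCA -mulrDr ler_wpM2l //.
    rewrite !mulr_sumr -big_split; apply: ler_sum => u uD /=.
    have [mu [sg law]] := coordinate_law gaussG uD.
    rewrite -variance //.
    apply: (gaussian_tail_sqr (mG u) law (meanG u) (sqG u)) => //.
      exact: Rintegral_tail_sqr_ge0.
    rewrite variance //; apply: Rintegral_sqr_le_tail => //.
    by rewrite mulr_ge0 // ltW.
  by rewrite lerD2r ler_wpM2l.
move: varX tailG; rewrite -/(lindeberg_sum tau).
set v := n%:R ^- 2 * _; set tG := n%:R ^- 2 * _ => vC tGle.
have -> : 8 * L%:R * tau * C / y ^+ 4 = 4 * L%:R * tau / y ^+ 4 * C + 4 * L%:R * tau / y ^+ 4 * C.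
  by move: (_ ^-1) => i; ring.
rewrite addrACA; apply: lerD; first by apply: lerD; apply: ler_wpM2l.
by rewrite -mulrDr; apply: ler_wpM2l => //; rewrite -addrA lerD2l.
Qed.

(** Dropping the strips costs the same for X and G, whose variances agree, hence the factor 2 in
    front. The 4 in 4 K / m combines the 2 of [tri_norm2] with the 2 of [exists_shift]. *)
Lemma gaussian_comparison :
  `|\int[P]_w f (X ^~ w) - \int[Q]_w f (G ^~ w)| <=
  2 * ((4 * K%:R / m%:R * C / del + del) / y ^+ 2) +
  (8 * L%:R * tau * C / y ^+ 4
   + 8 / y ^+ 3 * (lindeberg_sum tau + 2 * kurtosis R * (eta / tau) ^+ 2 * C + 2 * lindeberg_sum eta)).
Proof.
have [s hs] : exists s, \sum_(u in lower_triangle n | ~~ in_cell K L s u) \int[P]_w (X u w ^+ 2)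
    <= 2 * K%:R / m%:R * \sum_(u in lower_triangle n) \int[P]_w (X u w ^+ 2).
  by apply: exists_shift => // u; apply: Rintegral_ge0 => w _; exact: sqr_ge0.
have gap_le : 2 / n%:R / n%:R * (\sum_(u in lower_triangle n | ~~ in_cell K L s u)
    \int[P]_w (X u w ^+ 2)) / del + del <= 4 * K%:R / m%:R * C / del + del.
  rewrite lerD2r ler_pM2r ?invr_gt0 //.
  have n2 : 0 <= 2 / n%:R / n%:R :> R by rewrite !divr_ge0.
  apply: le_trans (ler_wpM2l n2 hs) _.
  have k0 : 0 <= 4 * K%:R / m%:R :> R by rewrite !divr_ge0 // mulr_ge0.
  apply: le_trans (ler_wpM2l k0 varX); rewrite le_eqVlt; apply/orP; left; apply/eqP.
  have nn : n%:R != 0 :> R by rewrite pnatr_eq0 -lt0n.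
  have mm : L%:R + K%:R != 0 :> R by rewrite -natrD pnatr_eq0 -lt0n addn_gt0 L0.
  by field; rewrite nn mm.
have y2 : 0 < y ^+ 2 by rewrite exprn_gt0.
have gX := Rintegral_pst_restr re (in_cell K L s) hz del0 mX sqX.
have gG := Rintegral_pst_restr re (in_cell K L s) hz del0 mG sqG.
have eG : \sum_(u in lower_triangle n | ~~ in_cell K L s u) \int[Q]_w (G u w ^+ 2) =
    \sum_(u in lower_triangle n | ~~ in_cell K L s u) \int[P]_w (X u w ^+ 2).
  by apply: eq_bigr => u /andP[uD _]; exact: variance.
rewrite eG in gG; rewrite distrC in gG.
have gle : forall x, x <= (2 / n%:R / n%:R * (\sum_(u in lower_triangle n | ~~ in_cell K L s u)
    \int[P]_w (X u w ^+ 2)) / del + del) / y ^+ 2 -> x <= (4 * K%:R / m%:R * C / del + del) / y ^+ 2.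
  by move=> x /le_trans; apply; rewrite ler_pM2r ?invr_gt0.
have {gX}gX := gle _ gX; have {gG}gG := gle _ gG; have hc := cells_close s.
apply: le_trans (ler_distD (\int[P]_w f (restr (in_cell K L s) (X ^~ w))) _ _) _.
rewrite mulr_natl mulr2n -addrA; apply: lerD gX _.
apply: le_trans (ler_distD (\int[Q]_w f (restr (in_cell K L s) (G ^~ w))) _ _) _.
by rewrite addrC; apply: lerD.
Qed.

End comparison.

(** The parameters are fixed in the order [del], [L], [tau], [eta], each depending on the previous
    ones, and n is large last. Six terms of at most e / 8 remain. *)
Lemma comparison_limit (R : realType) (D : nat -> R) (S : R -> nat -> R) (K : nat)
    (C y kap : R) : 0 < y -> 0 <= C -> 0 <= kap -> (forall n, 0 <= D n) ->
  (forall n L (del tau eta : R), (0 < n)%N -> (0 < L)%N -> 0 < del -> 0 < tau -> 0 < eta ->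
    D n <= 2 * ((4 * K%:R / (L + K)%:R * C / del + del) / y ^+ 2) +
      (8 * L%:R * tau * C / y ^+ 4
       + 8 / y ^+ 3 * (S tau n + 2 * kap * (eta / tau) ^+ 2 * C + 2 * S eta n))) ->
  (forall tau, 0 < tau -> S tau @ \oo --> (0 : R)) ->
  D @ \oo --> (0 : R).
Proof.
move=> y0 C0 kap0 D0 bound S0; apply/cvgr0Pnorm_le => e e0.
have y2 : 0 < y ^+ 2 by rewrite exprn_gt0.
have y3 : 0 < y ^+ 3 by rewrite exprn_gt0.
have y4 : 0 < y ^+ 4 by rewrite exprn_gt0.
pose del := e * y ^+ 2 / 16.
have del0 : 0 < del by rewrite divr_gt0 // mulr_gt0.
have K0 : 0 <= K%:R :> R by [].
pose q := 8 * K%:R * C / del / y ^+ 2.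
have q0 : 0 <= q by do 2! (apply: divr_ge0; last exact: ltW); apply: mulr_ge0 => //; exact: mulr_ge0.
(* Here, and for [r] and [p] below, 1 is added because the coefficient may vanish. *)
have q1 : 0 < q + 1 by rewrite ltr_wpDl.
have [L hL] : exists N : nat, forall n : nat, (N <= n)%N -> (0 < n)%N /\ n%:R^-1 <= e / 8 / (q + 1).
  by apply: archi_inv; rewrite !divr_gt0.
have [L0 {}hL] := hL _ (leqnn L).
have term1 : 2 * (4 * K%:R / (L + K)%:R * C / del / y ^+ 2) <= e / 8.
  have -> : 2 * (4 * K%:R / (L + K)%:R * C / del / y ^+ 2) = q * (L + K)%:R^-1.
    by rewrite /q; move: (_^-1) (_^-1) (_^-1) => a b c; ring.
  apply: le_trans (_ : (q + 1) * (e / 8 / (q + 1)) <= _); last by rewrite mulrC divfK // gt_eqF.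
  apply: ler_pM => //; [by rewrite lerDl|].
  by apply: le_trans hL; rewrite lef_pV2 ?posrE ?ltr0n ?addn_gt0 ?L0 // ler_nat leq_addr.
have term2 : 2 * (del / y ^+ 2) = e / 8 by rewrite /del; field; rewrite gt_eqF.
pose r := 8 * L%:R * C / y ^+ 4.
have r0 : 0 <= r by apply: divr_ge0; [apply: mulr_ge0 => //; exact: mulr_ge0|exact: ltW].
have r1 : 0 < r + 1 by rewrite ltr_wpDl.
pose tau := e / 8 / (r + 1).
have tau0 : 0 < tau by rewrite !divr_gt0.
have term3 : 8 * L%:R * tau * C / y ^+ 4 <= e / 8.
  have -> : 8 * L%:R * tau * C / y ^+ 4 = r * tau by rewrite /r; move: (_^-1) => a; ring.
  apply: le_trans (_ : (r + 1) * tau <= _); first by rewrite ler_wpM2r ?(ltW tau0) // lerDl.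
  by rewrite /tau mulrC divfK // gt_eqF.
pose p := 16 * kap * C / y ^+ 3 / tau ^+ 2.
have p0 : 0 <= p by do 2! (apply: divr_ge0; last by [exact: ltW|exact: sqr_ge0]);
    apply: mulr_ge0 => //; exact: mulr_ge0.
(* The extra [e] in the divisor gives eta <= 1, hence eta^2 <= eta. *)
have p1 : 0 < p + 1 + e by lra.
pose eta := e / 8 / (p + 1 + e).
have eta0 : 0 < eta by rewrite !divr_gt0.
have eta1 : eta <= 1 by rewrite /eta ler_pdivrMr //; lra.
have term4 : 8 / y ^+ 3 * (2 * kap * (eta / tau) ^+ 2 * C) <= e / 8.
  have -> : 8 / y ^+ 3 * (2 * kap * (eta / tau) ^+ 2 * C) = p * eta ^+ 2.
    by rewrite /p; field; rewrite !gt_eqF.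
  apply: le_trans (_ : p * eta <= _).
    rewrite ler_wpM2l // expr2 -[leRHS]mul1r ler_wpM2r // ltW //.
  apply: le_trans (_ : (p + 1 + e) * eta <= _).
    by rewrite ler_wpM2r ?(ltW eta0) //; lra.
  by rewrite /eta mulrC divfK // gt_eqF.
have c8 : 0 < 8 / y ^+ 3 by rewrite divr_gt0.
have s0 : 0 < e / 8 / (8 / y ^+ 3) by rewrite !divr_gt0.
have s1 : 0 < e / 16 / (8 / y ^+ 3) by rewrite !divr_gt0.
have := (cvgr0Pnorm_le _).1 (S0 _ tau0) _ s0; have := (cvgr0Pnorm_le _).1 (S0 _ eta0) _ s1.
move=> hSe hSt; near=> n.
rewrite ger0_norm //; apply: le_trans (bound n L del tau eta _ L0 del0 tau0 eta0) _.
  by near: n; exact: nbhs_infty_gt.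
have h5 : 8 / y ^+ 3 * S tau n <= e / 8.
  rewrite mulrC -ler_pdivlMr //; apply: le_trans (ler_norm _) _; near: n; exact: hSt.
have h6 : 8 / y ^+ 3 * (2 * S eta n) <= e / 8.
  have : 8 / y ^+ 3 * S eta n <= e / 16.
    rewrite mulrC -ler_pdivlMr //; apply: le_trans (ler_norm _) _; near: n; exact: hSe.
  by rewrite mulrCA; lra.
rewrite [(_ + del) / _]mulrDl !mulrDr.
move: e0 term1 term2 term3 term4 h5 h6; clear; lra.
Unshelve. all: by end_near.
Qed.

(** * Symmetric arrays and almost sure convergence *)

Lemma sum_lower_triangle (T : Type) (idx : T) (op : Monoid.com_law idx) (n : nat)
    (F : 'I_n -> 'I_n -> T) :
  \big[op/idx]_(k < n) \big[op/idx]_(l < n | (l <= k)%N) F k l =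
  \big[op/idx]_(u in lower_triangle n) F u.1 u.2.
Proof. by rewrite pair_big_dep; apply: eq_bigl => u; rewrite inE. Qed.

(** The hypotheses concern the lower triangle, whereas the lemmas above ask for integrability and
    zero mean at all index pairs; symmetry of the arrays bridges the two. *)
Lemma lower_triangle_ind (n : nat) (Q : 'I_n * 'I_n -> Prop) :
  (forall u, Q (u.2, u.1) -> Q u) -> (forall u, u \in lower_triangle n -> Q u) ->
  forall u, Q u.
Proof.
move=> symQ lowQ u; have [uD|uD] := boolP (u \in lower_triangle n); first exact: lowQ.
by apply/symQ/lowQ; move: uD; rewrite !inE /= -ltnNge; exact: ltnW.
Qed.

Theorem theorem11 (R : realType)
    (d : measure_display) (T : measurableType d) (P : probability T R)
    (X : forall n : nat, 'I_n -> 'I_n -> {RV P >-> R})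
    (Xsym : forall (n : nat) (k l : 'I_n) (w : T), X n k l w = X n l k w)
    (A1_mean : forall (n : nat) (k l : 'I_n), (0 < n)%N -> (l <= k)%N ->
      ('E_P[X n k l] = 0)%E)
    (A1_bound : exists C : R, forall n : nat, (0 < n)%N ->
      ((n%:R ^- 2)%R%:E * \sum_(k < n) \sum_(l < n | (l <= k)%N)
         'E_P[fun w => (`|X n k l w| ^+ 2)%R] <= C%:E)%E)
    (A2 : forall tau : R, 0 < tau ->
      (fun n : nat => ((n%:R ^- 2)%R%:E * \sum_(k < n) \sum_(l < n | (l <= k)%N)
         'E_P[fun w => (`|X n k l w| ^+ 2 *
                \1_[set u | tau * Num.sqrt n%:R < `|X n k l u|] w)%R])%E)
        @ \oo --> 0%E)
    (A3 : exists K : nat, (0 < K)%N /\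
      forall (n : nat) (A B : {set 'I_n * 'I_n}), (0 < n)%N ->
        A != finset.set0 -> B != finset.set0 ->
        A \subset lower_triangle n -> B \subset lower_triangle n ->
        (forall p q, p \in A -> q \in B -> (K < index_dist p q)%N) ->
        independent_sigma_fields P
          (sigma_field [set` A] (fun p => X n p.1 p.2 : T -> R))
          (sigma_field [set` B] (fun p => X n p.1 p.2 : T -> R)))
    (dG : nat -> measure_display) (TG : forall n : nat, measurableType (dG n))
    (PG : forall n : nat, probability (TG n) R)
    (G : forall n : nat, 'I_n -> 'I_n -> {RV (PG n) >-> R})
    (Gsym : forall (n : nat) (k l : 'I_n) (w : TG n), G n k l w = G n l k w)
    (Ggauss : forall n : nat, (0 < n)%N ->
      jointly_gaussian (PG n) (lower_triangle n)
        (fun p => G n p.1 p.2 : TG n -> R))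
    (Gmean : forall (n : nat) (k l : 'I_n), (0 < n)%N -> (l <= k)%N ->
      ('E_(PG n)[G n k l] = 0)%E)
    (Gcov : forall (n : nat) (k l i j : 'I_n), (0 < n)%N ->
      (l <= k)%N -> (j <= i)%N ->
      ('E_(PG n)[fun w => (G n k l w * G n i j w)%R] =
       'E_P[fun w => (X n k l w * X n i j w)%R])%E)
    (z : R[i]) (hz : 0 < complex.Im z) :
  {ae P, forall w,
    (fun n : nat => ComplexField.Normc.normc
       (stieltjes (scaled_mx (fun k l => X n k l : T -> R) w) z -
        cexpectation (PG n) (fun w' =>
          stieltjes (scaled_mx (fun k l => G n k l : TG n -> R) w') z)))
      @ \oo --> (0 : R)}.
Proof.
pose Y n (u : 'I_n * 'I_n) : T -> R := X n u.1 u.2.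
pose H n (u : 'I_n * 'I_n) : TG n -> R := G n u.1 u.2.
(* The existence of an index forces n to be positive, so hypotheses stated for n >= 1 apply to every
   index. *)
have npos n (u : 'I_n * 'I_n) : (0 < n)%N by apply: leq_ltn_trans (ltn_ord u.1).
have mY n u : measurable_fun setT (@Y n u) by exact: measurable_funPT.
have mH n u : measurable_fun setT (@H n u) by exact: measurable_funPT.
have Ysym n (u : 'I_n * 'I_n) : Y n u = Y n (u.2, u.1) by apply/funext => w; exact: Xsym.
have Hsym n (u : 'I_n * 'I_n) : H n u = H n (u.2, u.1) by apply/funext => w; exact: Gsym.
have lowP n (u : 'I_n * 'I_n) : u \in lower_triangle n = (u.2 <= u.1)%N by rewrite inE.
have [C0 bound] := A1_bound.
have sqE n : (\sum_(k < n) \sum_(l < n | (l <= k)%N) 'E_P[fun w => (`|X n k l w| ^+ 2)%R] =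
    \sum_(u in lower_triangle n) \int[P]_w (Y n u w ^+ 2)%:E)%E.
  rewrite sum_lower_triangle; apply: eq_bigr => u _; rewrite unlock.
  by apply: eq_integral => w _ /=; rewrite real_normK ?num_real.
have sq0 n u : (0 <= \int[P]_w (Y n u w ^+ 2)%:E)%E.
  by apply: integral_ge0 => w _; rewrite lee_fin sqr_ge0.
(* A sum of nonnegative extended reals with a finite bound has finite terms: this is how the moment
   bound yields square integrability of each entry. *)
have sqfin n u : u \in lower_triangle n -> (\int[P]_w (Y n u w ^+ 2)%:E < +oo)%E.
  move=> uD; have := bound n (npos n u); rewrite sqE (bigD1 u) //= => h.
  rewrite ltey; apply/negP => /eqP e; move: h; rewrite e addye; last first.
    by rewrite gt_eqF // (lt_le_trans (ltNyr 0)) // sume_ge0.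
  by rewrite gt0_muley ?leye_eq // lte_fin invr_gt0 exprn_gt0 // ltr0n (npos n u).
have sqY n u : P.-integrable setT (EFin \o (fun w => Y n u w ^+ 2)).
  elim/(@lower_triangle_ind n): u => [u|u uD]; first by rewrite (Ysym n u).
  apply/integrableP; split; first by apply/measurable_EFinP; exact: measurable_funX.
  by under eq_integral do rewrite /= ger0_norm ?sqr_ge0 //; exact: sqfin.
have meanY n u : (\int[P]_w (Y n u w)%:E = 0)%E.
  elim/(@lower_triangle_ind n): u => [u|u uD]; first by rewrite (Ysym n u).
  by rewrite lowP in uD; have := A1_mean n u.1 u.2 (npos n u) uD; rewrite unlock.
have meanH n u : (\int[PG n]_w (H n u w)%:E = 0)%E.
  elim/(@lower_triangle_ind n): u => [u|u uD]; first by rewrite (Hsym n u).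
  by rewrite lowP in uD; have := Gmean n u.1 u.2 (npos n u) uD; rewrite unlock.
have covE n u v : u \in lower_triangle n -> v \in lower_triangle n ->
    (\int[PG n]_w (H n u w * H n v w)%:E = \int[P]_w (Y n u w * Y n v w)%:E)%E.
  rewrite !lowP => uD vD.
  by have := Gcov n u.1 u.2 v.1 v.2 (npos n u) uD vD; rewrite unlock.
have cov n u v : u \in lower_triangle n -> v \in lower_triangle n ->
    \int[PG n]_w (H n u w * H n v w) = \int[P]_w (Y n u w * Y n v w).
  by move=> uD vD; rewrite /Rintegral covE.
(* The covariance identity with both indices equal carries finiteness of the second moment over to
   G. *)
have sqH n u : (PG n).-integrable setT (EFin \o (fun w => H n u w ^+ 2)).
  elim/(@lower_triangle_ind n): u => [u|u uD]; first by rewrite (Hsym n u).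
  apply/integrableP; split; first by apply/measurable_EFinP; exact: measurable_funX.
  under eq_integral do rewrite /= ger0_norm ?sqr_ge0 // expr2.
  by rewrite covE //; exact: sqfin.
pose C := `|C0|.
have varY n : (0 < n)%N ->
    (n%:R ^- 2) * \sum_(u in lower_triangle n) \int[P]_w (Y n u w ^+ 2) <= C.
  move=> n0; apply: le_trans (ler_norm C0); have := bound n n0; rewrite sqE.
  under eq_bigr do rewrite -EFin_Rintegral //.
  by rewrite sumEFin -EFinM lee_fin.
(* The hypothesis is a limit in the extended reals; square integrability makes each term finite, and
   [fine] carries the limit over to the reals. *)
have lindeberg tau : 0 < tau -> (fun n => lindeberg_sum P (Y n) tau) @ \oo --> (0 : R).
  move=> tau0; have /fine_cvg := A2 tau tau0; apply: cvg_trans.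
  apply: near_eq_cvg; near=> n => /=; rewrite sum_lower_triangle /lindeberg_sum.
  under eq_bigr => u _.
    rewrite unlock (_ : (\int[P]_w _)%E = (\int[P]_w tail_sqr (tau * Num.sqrt n%:R) (Y n u w))%:E).
      over.
    rewrite EFin_Rintegral; last exact: tail_sqr_integrable.
    apply: eq_integral => w _ /=; rewrite /tail_sqr indicE real_normK ?num_real //.
    rewrite (_ : (w \in _) = (tau * Num.sqrt n%:R < `|Y n u w|)).
      by case: ifP; rewrite ?mulr1 ?mulr0.
    by apply/idP/idP; rewrite inE.
  by rewrite sumEFin -EFinM.
have [K [K0 far]] := A3.
have limit re : (fun n => `|\int[P]_w pst z re (Y n ^~ w) - \int[PG n]_w pst z re (H n ^~ w)|)
    @ \oo --> (0 : R).
  have [k2 k4] := normal_moment_fine R.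
  apply: (@comparison_limit R _ (fun tau n => lindeberg_sum P (Y n) tau) K C
    (complex.Im z) (kurtosis R)) => //.
  - exact: normr_ge0.
  - by rewrite /kurtosis divr_ge0 // sqr_ge0.
  - move=> n L del tau eta n0 L0 del0 tau0 eta0.
    apply: gaussian_comparison => //.
    + exact: cov.
    + exact: Ggauss.
    + by move=> A B; exact: far.
    + exact: varY.
have conc re := pst_ae_concentration re mY (fun n n0 A B => @far n A B n0) hz.
have scaled d' (T' : measurableType d') n (Z : 'I_n -> 'I_n -> T' -> R) w :
    (forall k l w, Z k l w = Z l k w) ->
    scaled_mx Z w = (Num.sqrt n%:R)^-1 *: symx (fun u => Z u.1 u.2 w).
  move=> Zsym; congr (_ *: _); apply/matrixP => k l; rewrite !mxE.
  by case: ifP => //= _; exact: Zsym.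
(* The exceptional null set comes from the concentration of the two parts alone, since the
   comparison of expectations is deterministic. *)
apply: filterS2 (conc true) (conc false) => w h1 h2.
have part n : cexpectation (PG n) (fun w' =>
      stieltjes (scaled_mx (fun k l => G n k l : TG n -> R) w') z) =
    Complex (\int[PG n]_w' pst z true (H n ^~ w')) (\int[PG n]_w' pst z false (H n ^~ w')).
  have statE : (fun w' => stieltjes (scaled_mx (fun k l => G n k l : TG n -> R) w') z) =
      (fun w' => state_stieltjes z (H n ^~ w')).
    by apply/funext => w'; rewrite scaled // => *; exact: Gsym.
  by rewrite statE /cexpectation unlock.
pose D re n := `|pst z re (Y n ^~ w) - \int[P]_w' pst z re (Y n ^~ w')| +
  `|\int[P]_w' pst z re (Y n ^~ w') - \int[PG n]_w' pst z re (H n ^~ w')|.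
have D0 : (fun n => D true n + D false n) @ \oo --> (0 : R).
  have Dre re : (fun n => pst z re (Y n ^~ w) - \int[P]_w' pst z re (Y n ^~ w')) @ \oo --> (0 : R) ->
      D re @ \oo --> (0 : R).
    move=> h; rewrite -[X in _ --> X]addr0; apply: cvgD; last exact: limit.
    by rewrite -(@normr0 _ R); exact: cvg_norm.
  by rewrite -[X in _ --> X]addr0; apply: cvgD; exact: Dre.
apply: (squeeze_cvgr _ (cvg_cst (0 : R)) D0); apply: nearW => n; rewrite normc_ge0 /=.
rewrite part scaled; last by move=> *; exact: Xsym.
apply: le_trans (normc_Re_Im _) _.
have -> : stieltjes ((Num.sqrt n%:R)^-1 *: symx (fun u => X n u.1 u.2 w)) z =
    Complex (pst z true (Y n ^~ w)) (pst z false (Y n ^~ w)).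
  by rewrite /pst /state_stieltjes /=; case: (stieltjes _ _).
by rewrite /=; apply: lerD; apply: ler_distD.
Unshelve. all: by end_near.
Qed.
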